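(* Let $\mathcal{G}$ be an étale groupoid which has strong subexponential growth with respect to some locally bounded length function on $\mathcal{G}$. Then, for $\ast = 0,1$, the $K$-group $K_\ast(F_\lambda^p(\mathcal{G}))$ is independent of $p \in [1,\infty)$; that is, $K_\ast(F_\lambda^p(\mathcal{G})) \cong K_\ast(F_\lambda^{p'}(\mathcal{G}))$ for all $p, p' \in [1,\infty)$.
   Context: Étale groupoid: a locally compact Hausdorff groupoid $\mathcal{G}$ with unit space $\mathcal{G}^{(0)}$ whose range and source maps $r(x)=xx^{-1}$, $s(x)=x^{-1}x$ are local homeomorphisms. For $u \in \mathcal{G}^{(0)}$, $\mathcal{G}_u = \{x : s(x)=u\}$ and $\mathcal{G}^u=\{x: r(x)=u\}$ (discrete sets). A length function on $\mathcal{G}$ is a map $\ell\colon \mathcal{G}\to [0,\infty)$ with $\ell(u)=0$ for all $u\in\mathcal{G}^{(0)}$, $\ell(x^{-1})=\ell(x)$ for all $x$, and $\ell(xy)\le \ell(x)+\ell(y)$ whenever $x,y$ are composable. It is locally bounded if it is bounded on compact sets. Put $B_{\mathcal{G}_u}(t)=\{x\in\mathcal{G}_u : \ell(x)\le t\}$. $\mathcal{G}$ has strong subexponential growth with respect to $\ell$ if there are $\alpha>0$, $0<\beta<1$ and $C>0$ with $\sup_{u\in\mathcal{G}^{(0)}}|B_{\mathcal{G}_u}(t)|\le C\exp(\alpha t^\beta)$ for all $t\ge 0$. Reduced $L^p$-operator algebra: for $p\in[1,\infty)$, $u\in\mathcal{G}^{(0)}$ and $f\in C_c(\mathcal{G})$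 (a convolution algebra via $f*g(x)=\sum_{y\in\mathcal{G}_{s(x)}}f(xy^{-1})g(y)$), let $\lambda_u(f)\in B(\ell^p(\mathcal{G}_u))$ be $\lambda_u(f)\xi(x)=\sum_{y\in\mathcal{G}_u}f(xy^{-1})\xi(y)$. $F_\lambda^p(\mathcal{G})$ is the completion of $C_c(\mathcal{G})$ in the norm $\|f\|_{F_\lambda^p}=\sup_{u}\|\lambda_u(f)\|$. It is a Banach algebra, and $K_\ast$ denotes the usual (topological) $K$-theory of Banach algebras. *)

(* Defs.v *)
From HB Require Import structures.
From mathcomp Require Import all_boot all_order all_algebra.
From mathcomp Require Import complex ssrAC.
From mathcomp Require Import all_classical all_reals all_analysis.

Set Implicit Arguments.
Unset Strict Implicit.
Unset Printing Implicit Defensive.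

Import Order.TTheory GRing.Theory Num.Theory.
Import numFieldNormedType.Exports.
Local Open Scope classical_set_scope.
Local Open Scope ring_scope.
Local Open Scope quotient_scope.

HB.instance Definition _ (R : realType) := NormedModule.copy R[i] R[i]^o.

HB.mixin Record isBanachAlg (R : realType) A
    of CompleteNormedModule R[i] A := {
  bmul : A -> A -> A ;
  bmulA : associative bmul ;
  bmulDl : left_distributive bmul +%R ;
  bmulDr : right_distributive bmul +%R ;
  bmulZl : forall (a : R[i]) x y, bmul (a *: x) y = a *: bmul x y ;
  bmulZr : forall (a : R[i]) x y, bmul x (a *: y) = a *: bmul x y ;
  ler_norm_bmul : forall x y, `|bmul x y| <= `|x| * `|y|
}.

#[short(type="banachAlgType")]
HB.structure Definition BanachAlg (R : realType) :=
  {A of isBanachAlg R A & CompleteNormedModule R[i] A}.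

Section Unitization.
Variables (R : realType) (A : banachAlgType R).

(* A^+ = A (+) C, also when A already has a unit. *)
Definition unitization : Type := (A * R[i])%type.

HB.instance Definition _ := NormedModule.copy unitization (A * R[i])%type.

Definition umul (x y : unitization) : unitization :=
  (bmul x.1 y.1 + x.2 *: y.1 + y.2 *: x.1, x.2 * y.2).

Definition uone : unitization := (0, 1).

Let bmul0l (y : A) : bmul 0 y = 0.
Proof. by rewrite -(scale0r (0 : A)) bmulZl !scale0r. Qed.

Let bmul0r (y : A) : bmul y 0 = 0.
Proof. by rewrite -(scale0r (0 : A)) bmulZr !scale0r. Qed.

Fact umulA : associative umul.
Proof.
move=> [a x] [b y] [c z]; rewrite /umul /=; congr (_, _); last exact: mulrA.
rewrite !(bmulDl, bmulDr, bmulZl, bmulZr, scalerDr, scalerDl, scalerA) bmulA.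
rewrite [z * x]mulrC [z * y]mulrC.
by rewrite [LHS](AC (3*3*1) (1*4*2*5*3*6*7)) !addrA.
Qed.

Fact umul1x : left_id uone umul.
Proof.
by move=> [a x]; rewrite /umul /= bmul0l scale1r scaler0 add0r addr0 mul1r.
Qed.

Fact umulx1 : right_id uone umul.
Proof.
by move=> [a x]; rewrite /umul /= bmul0r scale1r scaler0 !add0r mulr1.
Qed.

Fact umulDl : left_distributive umul +%R.
Proof.
move=> [a x] [b y] [c z]; rewrite /umul /=; congr (_, _); last exact: mulrDl.
by rewrite bmulDl scalerDl scalerDr [LHS](AC (2*2*2) ((1*3*5)*(2*4*6))).
Qed.

Fact umulDr : right_distributive umul +%R.
Proof.
move=> [c z] [a x] [b y]; rewrite /umul /=; congr (_, _); last exact: mulrDr.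
by rewrite bmulDr scalerDl scalerDr [LHS](AC (2*2*2) ((1*3*5)*(2*4*6))).
Qed.

Fact uone_neq0 : uone != 0.
Proof. by apply/eqP => -[/eqP]; rewrite oner_eq0. Qed.

HB.instance Definition _ := GRing.Zmodule_isNzRing.Build unitization
  umulA umul1x umulx1 umulDl umulDr uone_neq0.

Definition scalar_part (x : unitization) : R[i] := x.2.

Fact scalar_part_additive : {morph scalar_part : x y / x - y}.
Proof. by []. Qed.

Fact scalar_part_monoid : GRing.monoid_morphism scalar_part.
Proof. by []. Qed.

HB.instance Definition _ :=
  GRing.isZmodMorphism.Build unitization R[i] scalar_part scalar_part_additive.
HB.instance Definition _ :=
  GRing.isMonoidMorphism.Build unitization R[i] scalar_part scalar_part_monoid.

End Unitization.
Section K0Unital.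
Variable S : nzRingType.

Definition idempotent : Type := {n : nat & {e : 'M[S]_n | e *m e == e}}.

Definition idem_dim (e : idempotent) : nat := tag e.
Definition idem_mx (e : idempotent) : 'M[S]_(idem_dim e) := val (tagged e).

Lemma idem_mxP (e : idempotent) : idem_mx e *m idem_mx e = idem_mx e.
Proof. exact/eqP/(valP (tagged e)). Qed.

Definition Idem n (e : 'M[S]_n) (eP : e *m e == e) : idempotent :=
  Tagged (fun n => {e : 'M[S]_n | e *m e == e}) (exist _ e eP).

(* Murray-von Neumann equivalence in M_oo(S), without padding to square
   matrices of a common size. *)
Definition mvn (e f : idempotent) : Prop :=
  exists (x : 'M[S]_(idem_dim e, idem_dim f))
         (y : 'M[S]_(idem_dim f, idem_dim e)),
    x *m y = idem_mx e /\ y *m x = idem_mx f.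

Lemma mvn_refl e : mvn e e.
Proof. by exists (idem_mx e), (idem_mx e); rewrite idem_mxP. Qed.

Lemma mvn_sym e f : mvn e f -> mvn f e.
Proof. by move=> [x [y [xy yx]]]; exists y, x. Qed.

Lemma mvn_trans f e g : mvn e f -> mvn f g -> mvn e g.
Proof.
move=> [x [y [xy yx]]] [z [w [zw wz]]]; exists (x *m z), (w *m y); split.
  rewrite -mulmxA (mulmxA z) zw -yx -(mulmxA y) mulmxA xy.
  by rewrite idem_mxP.
rewrite -mulmxA (mulmxA y) yx -zw -(mulmxA z) mulmxA wz.
by rewrite idem_mxP.
Qed.

Fact isum_proof (e f : idempotent) :
  let g := block_mx (idem_mx e) 0 0 (idem_mx f) in g *m g == g.
Proof.
by rewrite /= mulmx_block !(mulmx0, mul0mx, addr0, add0r) !idem_mxP.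
Qed.

Definition isum (e f : idempotent) : idempotent := Idem (isum_proof e f).

Fact izero_proof : (0 : 'M[S]_0) *m 0 == 0 :> 'M[S]_0. Proof. by rewrite mulmx0. Qed.

Definition izero : idempotent := Idem izero_proof.

Lemma mvn_isum e e' f f' : mvn e e' -> mvn f f' -> mvn (isum e f) (isum e' f').
Proof.
move=> [x [y [xy yx]]] [z [w [zw wz]]].
exists (block_mx x 0 0 z), (block_mx y 0 0 w).
by split; rewrite mulmx_block !(mulmx0, mul0mx, addr0, add0r) ?(xy,zw,yx,wz).
Qed.

Lemma isumC e f : mvn (isum e f) (isum f e).
Proof.
exists (block_mx 0 (idem_mx e) (idem_mx f) 0).
exists (block_mx 0 (idem_mx f) (idem_mx e) 0).
by split; rewrite mulmx_block !(mulmx0, mul0mx, addr0, add0r) !idem_mxP.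
Qed.

Lemma isumA e f g : mvn (isum e (isum f g)) (isum (isum e f) g).
Proof.
exists (block_mx (row_mx (idem_mx e) 0) 0
          (block_mx 0 (idem_mx f) 0 0) (col_mx 0 (idem_mx g))).
exists (block_mx (col_mx (idem_mx e) 0) (block_mx 0 0 (idem_mx f) 0)
          0 (row_mx 0 (idem_mx g))).
split; rewrite mulmx_block ?(mul_row_block, mul_block_col, mul_row_col,
  mul_col_row, mulmx_block) !(mulmx0, mul0mx) !(mul_row_block, mul_block_col,
  mul_row_col, mul_col_row, mulmx_block, mulmx0, mul0mx, addr0, add0r,
  row_mx0, col_mx0, add_block_mx) !idem_mxP //.
- rewrite mul_mx_row idem_mxP mulmx0 -[X in col_mx _ X]row_mx0 -block_mxEv.
  by rewrite add_block_mx !(addr0, add0r).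
- rewrite mul_mx_row idem_mxP mulmx0 -[X in col_mx X _]row_mx0 -block_mxEv.
  by rewrite add_block_mx !(addr0, add0r).
Qed.

Lemma isum0 e : mvn (isum izero e) e.
Proof.
exists (col_mx 0 (idem_mx e)), (row_mx 0 (idem_mx e)); split.
  by rewrite mul_col_row !(mulmx0, mul0mx) idem_mxP.
by rewrite mul_row_col mul0mx add0r idem_mxP.
Qed.

Definition mvnb : rel idempotent := fun e f => `[< mvn e f >].

Fact mvnb_refl : reflexive mvnb. Proof. by move=> e; apply/asboolP/mvn_refl. Qed.
Fact mvnb_sym : symmetric mvnb.
Proof. by move=> e f; apply/asboolP/asboolP; exact: mvn_sym. Qed.
Fact mvnb_trans : transitive mvnb.
Proof.
by move=> f e g /asboolP ef /asboolP fg; apply/asboolP/(mvn_trans ef fg).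
Qed.

Canonical mvn_equiv := EquivRel mvnb mvnb_refl mvnb_sym mvnb_trans.

(* The monoid V(S) of classes of idempotents of M_oo(S). *)
Definition idem_classes : Type := {eq_quot mvn_equiv}.

HB.instance Definition _ := Choice.on idem_classes.
HB.instance Definition _ := EqQuotient.on idem_classes.

Definition idem_class (e : idempotent) : idem_classes := \pi_idem_classes e.

Lemma idem_classP e f : idem_class e = idem_class f <-> mvn e f.
Proof.
rewrite /idem_class; split=> [/eqmodP/asboolP //|ef].
exact/eqmodP/asboolP.
Qed.

Lemma mvn_repr e : mvn (repr (idem_class e)) e.
Proof. by apply/idem_classP; rewrite /idem_class reprK. Qed.

Definition vadd (x y : idem_classes) : idem_classes :=
  idem_class (isum (repr x) (repr y)).

Lemma vaddE e f : vadd (idem_class e) (idem_class f) = idem_class (isum e f).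
Proof. by apply/idem_classP/mvn_isum; apply: mvn_repr. Qed.

Lemma idem_classW (P : idem_classes -> Prop) :
  (forall e, P (idem_class e)) -> forall x, P x.
Proof. by move=> Pc x; have := Pc (repr x); rewrite /idem_class reprK. Qed.

Fact vaddA : associative vadd.
Proof.
elim/idem_classW => e; elim/idem_classW => f; elim/idem_classW => g.
by rewrite !vaddE; apply/idem_classP/isumA.
Qed.

Fact vaddC : commutative vadd.
Proof.
elim/idem_classW => e; elim/idem_classW => f.
by rewrite !vaddE; apply/idem_classP/isumC.
Qed.

Fact vadd0 : left_id (idem_class izero) vadd.
Proof. by elim/idem_classW => e; rewrite vaddE; apply/idem_classP/isum0. Qed.

HB.instance Definition _ := GRing.isNmodule.Build idem_classes
  vaddA vaddC vadd0.

End K0Unital.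

Section IdemMap.
Variables (S T : nzRingType) (phi : {rmorphism S -> T}).

Fact imap_proof (e : idempotent S) :
  map_mx phi (idem_mx e) *m map_mx phi (idem_mx e) == map_mx phi (idem_mx e).
Proof. by rewrite -map_mxM idem_mxP. Qed.

Definition imap (e : idempotent S) : idempotent T := Idem (imap_proof e).

Lemma mvn_imap e f : mvn e f -> mvn (imap e) (imap f).
Proof.
move=> [x [y [xy yx]]]; exists (map_mx phi x), (map_mx phi y).
by rewrite -!map_mxM xy yx.
Qed.

Definition idem_classes_map (x : idem_classes S) : idem_classes T :=
  idem_class (imap (repr x)).

Lemma idem_classes_mapE e :
  idem_classes_map (idem_class e) = idem_class (imap e).
Proof. exact/idem_classP/mvn_imap/mvn_repr. Qed.

Fact idem_classes_map_additive : nmod_morphism idem_classes_map.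
Proof.
have idem_classD U (e f : idempotent U) :
    idem_class e + idem_class f = idem_class (isum e f) by exact: vaddE.
split; first rewrite [idem_classes_map 0]idem_classes_mapE.
  by apply/idem_classP; exists 0, 0; split; apply/matrixP => -[].
elim/idem_classW => e; elim/idem_classW => f.
rewrite idem_classD !idem_classes_mapE idem_classD; apply/idem_classP.
exists (idem_mx (isum (imap e) (imap f))), (idem_mx (isum (imap e) (imap f))).
rewrite !idem_mxP; split=> //.
by rewrite [RHS]map_block_mx !raddf0.
Qed.

HB.instance Definition _ := GRing.isNmodMorphism.Build
  (idem_classes S) (idem_classes T) idem_classes_map idem_classes_map_additive.

End IdemMap.

Section Grothendieck.
Variable M : nmodType.

Definition groth_rel : rel (M * M) :=
  fun x y => `[< exists k, x.1 + y.2 + k = y.1 + x.2 + k >].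

Fact groth_refl : reflexive groth_rel.
Proof. by move=> x; apply/asboolP; exists 0. Qed.

Fact groth_sym : symmetric groth_rel.
Proof. by move=> x y; apply/asboolP/asboolP => -[k kP]; exists k. Qed.

Fact groth_trans : transitive groth_rel.
Proof.
move=> [c d] [a b] [e f] /asboolP[/= k kP] /asboolP[/= l lP].
apply/asboolP; exists (c + d + k + l) => /=.
rewrite [LHS](AC (2*4) ((1*4*5)*(3*2*6))) /=.
rewrite [RHS](AC (2*4) ((3*2*5)*(1*4*6))) /=.
have -> : a + d + k + (c + f + l) = c + b + k + (e + d + l) by rewrite kP lP.
done.
Qed.

Canonical groth_equiv := EquivRel groth_rel groth_refl groth_sym groth_trans.

Definition groth : Type := {eq_quot groth_equiv}.

HB.instance Definition _ := Choice.on groth.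
HB.instance Definition _ := EqQuotient.on groth.

(* The formal difference a - b. *)
Definition gdiff (a b : M) : groth := \pi_groth (a, b).

Lemma gdiffP a b c d :
  gdiff a b = gdiff c d <-> exists k, a + d + k = c + b + k.
Proof.
rewrite /gdiff; split=> [/eqmodP/asboolP //|ef].
exact/eqmodP/asboolP.
Qed.

Lemma gdiffW (P : groth -> Prop) :
  (forall a b, P (gdiff a b)) -> forall x, P x.
Proof.
move=> Pc x; have := Pc (repr x).1 (repr x).2.
by rewrite /gdiff -surjective_pairing reprK.
Qed.

Lemma gdiff_repr a b :
  exists k, (repr (gdiff a b)).1 + b + k = a + (repr (gdiff a b)).2 + k.
Proof. by apply/gdiffP; rewrite /gdiff -surjective_pairing reprK. Qed.

Definition gadd (x y : groth) : groth :=
  gdiff ((repr x).1 + (repr y).1) ((repr x).2 + (repr y).2).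
Definition gopp (x : groth) : groth := gdiff (repr x).2 (repr x).1.

Lemma gaddE a b c d : gadd (gdiff a b) (gdiff c d) = gdiff (a + c) (b + d).
Proof.
apply/gdiffP; have [k kP] := gdiff_repr a b; have [l lP] := gdiff_repr c d.
exists (k + l); rewrite [LHS](AC (2*2*2) ((1*3*5)*(2*4*6))) /= kP lP.
by rewrite [RHS](AC (2*2*2) ((1*3*5)*(2*4*6))) /=.
Qed.

Lemma goppE a b : gopp (gdiff a b) = gdiff b a.
Proof.
apply/gdiffP; have [k kP] := gdiff_repr a b.
by exists k; rewrite [_ + a]addrC -kP [b + _]addrC.
Qed.

Fact gaddA : associative gadd.
Proof.
by elim/gdiffW => a b; elim/gdiffW => c d; elim/gdiffW => e f;
  rewrite !gaddE !addrA.
Qed.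

Fact gaddC : commutative gadd.
Proof.
elim/gdiffW => a b; elim/gdiffW => c d.
by rewrite !gaddE [a + c]addrC [b + d]addrC.
Qed.

Fact gadd0 : left_id (gdiff 0 0) gadd.
Proof. by elim/gdiffW => a b; rewrite gaddE !add0r. Qed.

Fact gaddN : left_inverse (gdiff 0 0) gopp gadd.
Proof.
elim/gdiffW => a b; rewrite goppE gaddE; apply/gdiffP; exists 0.
by rewrite !(addr0, add0r) addrC.
Qed.

HB.instance Definition _ := GRing.isZmodule.Build groth gaddA gaddC gadd0 gaddN.

End Grothendieck.

Section GrothMap.
Variables (M N : nmodType) (phi : {additive M -> N}).

Definition groth_map (x : groth M) : groth N :=
  gdiff (phi (repr x).1) (phi (repr x).2).

Lemma groth_mapE a b : groth_map (gdiff a b) = gdiff (phi a) (phi b).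
Proof.
apply/gdiffP; have [k kP] := gdiff_repr a b.
by exists (phi k); rewrite -!raddfD kP.
Qed.

Fact groth_map_additive : zmod_morphism groth_map.
Proof.
elim/gdiffW => a b; elim/gdiffW => c d.
rewrite [- gdiff c d]goppE [_ + _]gaddE !groth_mapE.
by rewrite [- gdiff _ _]goppE [RHS]gaddE !raddfD.
Qed.

HB.instance Definition _ := GRing.isZmodMorphism.Build
  (groth M) (groth N) groth_map groth_map_additive.

End GrothMap.

Definition K0_unital (S : nzRingType) : zmodType := groth (idem_classes S).

Section K0.
Variables (R : realType) (A : banachAlgType R).

Definition K0_scalar : {additive K0_unital (unitization A) -> K0_unital R[i]} :=
  groth_map (idem_classes_map (@scalar_part R A)).

Definition in_K0 : {pred K0_unital (unitization A)} :=
  fun x => K0_scalar x == 0.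

Fact in_K0_zmod_closed : zmod_closed in_K0.
Proof.
split=> [|x y]; first by rewrite unfold_in /in_K0 raddf0.
by rewrite !unfold_in /in_K0 raddfB => /eqP-> /eqP->; rewrite subrr.
Qed.

HB.instance Definition _ :=
  GRing.isZmodClosed.Build _ in_K0 in_K0_zmod_closed.

(* K_0(A) is the kernel of K_0(A^+) -> K_0(C), also when A has a unit. *)
Record K0 := InK0 { K0_val : K0_unital (unitization A); _ : in_K0 K0_val }.

HB.instance Definition _ := [isSub for K0_val].
HB.instance Definition _ := [Choice of K0 by <:].
HB.instance Definition _ := [SubChoice_isSubZmodule of K0 by <:].

End K0.

Section MatrixPaths.
Variables (R : realType) (A : banachAlgType R).
Local Notation S := (unitization A).
Context {T : Type} {F : set_system T} {FF : Filter F}.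

Lemma cvg_bmul (f g : T -> A) (a b : A) :
  f @ F --> a -> g @ F --> b -> (fun t => bmul (f t) (g t)) @ F --> bmul a b.
Proof.
move=> /cvgrPdist_lt fa /cvgrPdist_lt gb; apply/cvgrPdist_lt => e e0.
pose D := `|a| + `|b| + 1 + e.
have D0 : 0 < D by rewrite ltr_wpDl// addr_ge0// addr_ge0.
pose d := e / D; have d0 : 0 < d by rewrite divr_gt0.
have d1 : d < 1 by rewrite ltr_pdivrMr// mul1r ltrDr ltr_wpDl// addr_ge0.
near=> t.
have fat : `|a - f t| < d by near: t; exact: fa.
have gbt : `|b - g t| < d by near: t; exact: gb.
have ft : `|f t| <= `|a| + 1.
  rewrite -[f t](subrK a) addrC (le_trans (ler_normD _ _))// lerD2l distrC.
  exact/ltW/(lt_trans fat).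
have -> : bmul a b - bmul (f t) (g t) = bmul (a - f t) b + bmul (f t) (b - g t).
  have bmulBl x y z : bmul (x - y) z = bmul x z - bmul y z :> A.
    by rewrite bmulDl -[- y]scaleN1r bmulZl scaleN1r.
  have bmulBr x y z : bmul z (x - y) = bmul z x - bmul z y :> A.
    by rewrite bmulDr -[- y]scaleN1r bmulZr scaleN1r.
  by rewrite bmulBl bmulBr addrA subrK.
apply: (@le_lt_trans _ _ (d * (`|a| + `|b| + 1))); last first.
  by rewrite /d mulrAC ltr_pdivrMr// ltr_pM2l// ltrDl.
rewrite (le_trans (ler_normD _ _))// [X in _ <= d * X]addrAC [_ + `|b|]addrC.
rewrite mulrDr lerD// (le_trans (ler_norm_bmul _ _))//.
  by rewrite ler_wpM2r// ltW.
by rewrite mulrC ler_pM// ltW.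
Unshelve. all: by end_near. Qed.

Lemma cvg_mxE m n (f : T -> 'M[S]_(m, n)) (a : 'M[S]_(m, n)) :
  f @ F --> a <-> forall i j, (fun t => f t i j) @ F --> a i j.
Proof.
split=> [fa i j|fa].
  move=> U aU; have := fa [set M | U (M i j)]; apply.
  exists (fun i' j' => [set x | (i' == i) && (j' == j) -> U x]).
    move=> i' j'; have [->|ne] := eqVneq i' i; last exact: filterE.
    have [->|ne] := eqVneq j' j; last exact: filterE.
    by apply: filterS aU => x Ux _.
  by move=> M /(_ i j); apply; rewrite !eqxx.
move=> U [P aP PU].
have aux (s : seq ('I_m * 'I_n)) :
    F [set t | forall ij, ij \in s -> P ij.1 ij.2 (f t ij.1 ij.2)].
  elim: s => [|[i j] s IHs]; first exact: filterE.
  have Pij : F [set t | P i j (f t i j)] by exact: (fa i j _ (aP i j)).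
  apply: filterS (filterI Pij IHs) => t [Pt st] kl; rewrite inE => /predU1P[-> //|].
  exact: st.
suff: F (f @^-1` U) by [].
apply: filterS (aux (enum {: 'I_m * 'I_n})) => t Pt.
by apply: PU => i j; apply: (Pt (i, j)); rewrite mem_enum.
Qed.

Lemma cvg_unitization (f : T -> S) (a : S) :
  f @ F --> a <->
  (fun t => (f t).1) @ F --> a.1 /\ (fun t => (f t).2) @ F --> a.2.
Proof.
split=> [fa|[fa1 fa2]].
  split; first exact: (cvg_comp _ _ fa (@cvg_fst _ _ _ _ _)).
  exact: (cvg_comp _ _ fa (@cvg_snd _ _ _ _ _)).
have fE : f = (fun t => ((f t).1, (f t).2)).
  by apply/funext => t; case: (f t).
rewrite fE; case: a fa1 fa2 => a1 a2 /= fa1 fa2.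
exact: cvg_pair fa1 fa2.
Qed.

Lemma cvg_umul (f g : T -> S) (a b : S) :
  f @ F --> a -> g @ F --> b -> (fun t => f t * g t) @ F --> a * b.
Proof.
move=> /cvg_unitization[fa1 fa2] /cvg_unitization[gb1 gb2].
apply/(cvg_unitization (fun t => f t * g t) (a * b)).
have h2 : (fun t => (f t).2 * (g t).2) @ F --> a.2 * b.2.
  exact: (@cvgM R[i] T F FF (fun t => (f t).2) (fun t => (g t).2) a.2 b.2
    fa2 gb2).
split; last by exact: h2.
have h1 : (fun t => bmul (f t).1 (g t).1 + (f t).2 *: (g t).1
    + (g t).2 *: (f t).1) @ F --> bmul a.1 b.1 + a.2 *: b.1 + b.2 *: a.1.
  have cZ (u : T -> R[i]) (v : T -> A) (x : R[i]) (y : A) :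
      u @ F --> x -> v @ F --> y -> (fun t => u t *: v t) @ F --> x *: y.
    by move=> ux vy; exact: (@cvgZ R[i] A T F FF u v x y ux vy).
  apply: cvgD; last exact: cZ gb2 fa1.
  by apply: cvgD; [exact: cvg_bmul|exact: cZ fa2 gb1].
exact: h1.
Qed.

Lemma cvg_mulmx m n p (f : T -> 'M[S]_(m, n)) (g : T -> 'M[S]_(n, p))
    (a : 'M[S]_(m, n)) (b : 'M[S]_(n, p)) :
  f @ F --> a -> g @ F --> b -> (fun t => f t *m g t) @ F --> a *m b.
Proof.
move=> /cvg_mxE fa /cvg_mxE gb.
apply/(cvg_mxE (fun t => f t *m g t)) => i j; rewrite mxE.
under eq_fun do rewrite mxE.
elim: (index_enum _) => [|k r IHr].
  by rewrite big_nil; under eq_fun do rewrite big_nil; exact: cvg_cst.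
rewrite big_cons.
have -> : (fun t => \sum_(l <- k :: r) f t i l * g t l j) =
    (fun t => f t i k * g t k j + \sum_(l <- r) f t i l * g t l j).
  by apply/funext => t; rewrite big_cons.
have hk : (fun t => f t i k * g t k j) @ F --> a i k * b k j.
  exact: (@cvg_umul (fun t => f t i k) (fun t => g t k j) (a i k) (b k j)
    (fa i k) (gb k j)).
exact: (@cvgD R[i] S T F FF (fun t => f t i k * g t k j)
  (fun t => \sum_(l <- r) f t i l * g t l j) _ _ hk IHr).
Qed.

End MatrixPaths.

Section GL.
Variables (R : realType) (A : banachAlgType R).
Local Notation S := (unitization A).

(* GL_n(A) is the group of invertible matrices over A^+ congruent to 1 modulo A. *)
Definition in_gl n (g : 'M[S]_n) : Prop :=
  map_mx (@scalar_part R A) g = 1%:M /\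
  exists h, g *m h = 1%:M /\ h *m g = 1%:M.

Lemma in_gl1 n : in_gl (1%:M : 'M[S]_n).
Proof. by split; [exact: map_mx1|exists 1%:M; rewrite mulmx1]. Qed.

Lemma in_glM n (g h : 'M[S]_n) : in_gl g -> in_gl h -> in_gl (g *m h).
Proof.
move=> [g1 [g' [gg' g'g]]] [h1 [h' [hh' h'h]]]; split.
  by rewrite map_mxM g1 h1 mulmx1.
exists (h' *m g'); split.
  by rewrite -mulmxA (mulmxA h) hh' mul1mx.
by rewrite -mulmxA (mulmxA g') g'g mul1mx.
Qed.

Lemma in_gl_inv n (g h : 'M[S]_n) :
  in_gl g -> g *m h = 1%:M -> h *m g = 1%:M -> in_gl h.
Proof.
move=> [g1 _] gh hg; split; last by exists g.
by rewrite -(mulmx1 (map_mx _ h)) -g1 -map_mxM hg map_mx1.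
Qed.

(* The upper-left corner embedding g |-> diag(g, 1), meant for n <= N. *)
Definition pad N n (g : 'M[S]_n) : 'M[S]_N :=
  \matrix_(i, j)
    if (insub (val i) : option 'I_n, insub (val j) : option 'I_n)
      is (Some i', Some j') then g i' j' else (i == j)%:R.

Lemma pad_block n k (g : 'M[S]_n) : pad (n + k) g = block_mx g 0 0 1%:M.
Proof.
apply/matrixP => i j; rewrite mxE.
case: (split_ordP i) => i' ->; case: (split_ordP j) => j' ->.
- by rewrite block_mxEul !insubT //= => ? ?; congr (g _ _); apply: val_inj.
- rewrite block_mxEur mxE insubT //= => ?; rewrite insubF ?ltnNge ?leq_addr //.
  by case: eqP => // /(congr1 val) /= e; have := ltn_ord i'; rewrite e ltnNge leq_addr.
- rewrite block_mxEdl mxE insubF ?ltnNge ?leq_addr //.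
  by case: eqP => // /(congr1 val) /= e; have := ltn_ord j'; rewrite -e ltnNge leq_addr.
- rewrite block_mxEdr mxE insubF ?ltnNge ?leq_addr //.
  by rewrite (inj_eq (@rshift_inj _ _)).
Qed.

Lemma pad_id n (g : 'M[S]_n) : pad n g = g.
Proof.
apply/matrixP => i j; rewrite mxE !insubT //= => ? ?.
by congr (g _ _); apply: val_inj.
Qed.

Lemma pad_pad n M N (g : 'M[S]_n) : (n <= M)%N -> pad N (pad M g) = pad N g.
Proof.
move=> nM; apply/matrixP => i j; rewrite !mxE.
case: (insubP 'I_M (val i)) => [i' _ ii'|iM].
  case: (insubP 'I_M (val j)) => [j' _ jj'|jM].
    by rewrite mxE ii' jj' -!val_eqE /= ii' jj'.
  rewrite (@insubF _ _ 'I_n (val j)) //; last first.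
    by apply: contraNF jM => /leq_trans; apply.
  by case: insub.
rewrite (@insubF _ _ 'I_n (val i)) //.
by apply: contraNF iM => /leq_trans; apply.
Qed.

Lemma padM n N (g h : 'M[S]_n) :
  (n <= N)%N -> pad N (g *m h) = pad N g *m pad N h.
Proof.
move=> /subnKC <-; rewrite !pad_block mulmx_block.
by rewrite !(mulmx0, mul0mx, addr0, add0r) mulmx1.
Qed.

Lemma pad1 n N : (n <= N)%N -> pad N (1%:M : 'M[S]_n) = 1%:M.
Proof. by move=> /subnKC <-; rewrite pad_block -scalar_mx_block. Qed.

Lemma in_gl_pad n N (g : 'M[S]_n) : (n <= N)%N -> in_gl g -> in_gl (pad N g).
Proof.
move=> nN [g1 [h [gh hg]]]; split; last first.
  by exists (pad N h); rewrite -!padM // gh hg pad1.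
rewrite -(subnKC nN) pad_block map_block_mx g1 map_mx1 !raddf0.
by rewrite -scalar_mx_block.
Qed.

Lemma cvg_pad n N (T : Type) (F : set_system T) (FF : Filter F)
    (f : T -> 'M[S]_n) (a : 'M[S]_n) :
  f @ F --> a -> (fun t => pad N (f t)) @ F --> pad N a.
Proof.
move=> /cvg_mxE fa; apply/(cvg_mxE (fun t => pad N (f t))) => i j.
rewrite mxE; under eq_fun do rewrite mxE.
by case: insub => [i'|]; last exact: cvg_cst; case: insub => [j'|];
  [exact: fa|exact: cvg_cst].
Qed.

(* Being in the same path component of GL_n(A). *)
Definition homotopic n (g h : 'M[S]_n) : Prop :=
  exists gamma : R -> 'M[S]_n,
    [/\ {within `[0, 1], continuous gamma}, gamma 0 = g, gamma 1 = h &
        forall t, 0 <= t <= 1 -> in_gl (gamma t)].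

Lemma homotopic_refl n (g : 'M[S]_n) : in_gl g -> homotopic g g.
Proof.
by move=> gP; exists (fun=> g); split=> // x; exact: cvg_cst.
Qed.

Lemma homotopic_rev n (g h : 'M[S]_n) : homotopic g h -> homotopic h g.
Proof.
move=> [c [/subspace_continuousP cc c0 c1 cP]]; exists (fun t => c (1 - t)).
split; [|by rewrite subr0|by rewrite subrr|]; last first.
  by move=> t /andP[t0 t1]; apply: cP; rewrite subr_ge0 t1 gerBl t0.
have rev01 (t : R) : `[0, 1]%classic t -> `[0, 1]%classic (1 - t).
  by rewrite /= !in_itv /= subr_ge0 gerBl => /andP[-> ->].
apply/subspace_continuousP => x x01.
apply: (@cvg_comp _ _ _ (fun t => 1 - t) c _ (within `[0, 1] (nbhs (1 - x))));
  last exact: cc (rev01 _ x01).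
move=> U /= xU.
have cx : (fun t : R => 1 - t) @ x --> 1 - x.
  by apply: cvgB; [exact: cvg_cst|exact: cvg_id].
suff: nbhs x [set t | `[0, 1]%classic t -> U (1 - t)] by [].
have tU (t : R) : (`[0, 1]%classic (1 - t) -> U (1 - t)) ->
    `[0, 1]%classic t -> U (1 - t) by move=> tU /rev01.
exact: (@filterS _ (nbhs x) _ _ _ tU (cx _ xU)).
Qed.

Lemma homotopicM n (g h g' h' : 'M[S]_n) :
  homotopic g h -> homotopic g' h' -> homotopic (g *m g') (h *m h').
Proof.
move=> [c [cc c0 c1 cP]] [d [dc d0 d1 dP]]; exists (fun t => c t *m d t).
split; last by move=> t t01; apply: in_glM; [exact: cP|exact: dP].
- move/subspace_continuousP: cc => cc; move/subspace_continuousP: dc => dc.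
  apply/subspace_continuousP => x x01.
  exact: (@cvg_mulmx _ _ _ _ _ _ _ _ c d (c x) (d x) (cc _ x01) (dc _ x01)).
- by rewrite c0 d0.
- by rewrite c1 d1.
Qed.

Lemma homotopic_gl n (g h : 'M[S]_n) : homotopic g h -> in_gl g /\ in_gl h.
Proof.
move=> [c [_ <- <- cP]]; split; apply: cP; rewrite ?lexx ?ler01 //.
Qed.

Lemma homotopic_trans n (g h k : 'M[S]_n) :
  homotopic g h -> homotopic h k -> homotopic g k.
Proof.
move=> gh hk; have [_ hP] := homotopic_gl gh.
have [_ [h' [hh' h'h]]] := hP; have h'P := in_gl_inv hP hh' h'h.
have := homotopicM (homotopicM gh (homotopic_refl h'P)) hk.
by rewrite -mulmxA h'h mulmx1 hh' mul1mx.
Qed.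

Lemma homotopic_inv n (g h g' h' : 'M[S]_n) :
    homotopic g h -> g *m g' = 1%:M -> g' *m g = 1%:M ->
    h *m h' = 1%:M -> h' *m h = 1%:M -> homotopic g' h'.
Proof.
move=> gh gg' g'g hh' h'h; have [gP hP] := homotopic_gl gh.
have g'P := in_gl_inv gP gg' g'g; have h'P := in_gl_inv hP hh' h'h.
have := homotopicM (homotopicM (homotopic_refl g'P) (homotopic_rev gh))
  (homotopic_refl h'P).
by rewrite g'g mul1mx -mulmxA hh' mulmx1.
Qed.

Lemma homotopic_pad n N (g h : 'M[S]_n) :
  (n <= N)%N -> homotopic g h -> homotopic (pad N g) (pad N h).
Proof.
move=> nN [c [/subspace_continuousP cc c0 c1 cP]].
exists (fun t => pad N (c t)).
split; last by move=> t t01; apply: in_gl_pad => //; exact: cP.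
- by apply/subspace_continuousP => x x01; exact: (@cvg_pad n N _ _ _ c _ (cc _ x01)).
- by rewrite c0.
- by rewrite c1.
Qed.

(* Representatives of the elements of GL_oo(A), the union of the GL_n(A). *)
Definition GLinf : Type := {n : nat & {g : 'M[S]_n | `[< in_gl g >]}}.

Definition gl_dim (g : GLinf) : nat := tag g.
Definition gl_mx (g : GLinf) : 'M[S]_(gl_dim g) := val (tagged g).

Lemma gl_mxP (g : GLinf) : in_gl (gl_mx g).
Proof. exact/asboolP/(valP (tagged g)). Qed.

Definition GLmk n (g : 'M[S]_n) (gP : in_gl g) : GLinf :=
  Tagged (fun n => {g : 'M[S]_n | `[< in_gl g >]}) (exist _ g (asboolT gP)).

Definition gl_mul_mx (g h : GLinf) : 'M[S]_(maxn (gl_dim g) (gl_dim h)) :=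
  pad _ (gl_mx g) *m pad _ (gl_mx h).

Fact gl_mul_proof (g h : GLinf) : in_gl (gl_mul_mx g h).
Proof.
by apply: in_glM; (apply: in_gl_pad; last exact: gl_mxP);
  [exact: leq_maxl|exact: leq_maxr].
Qed.

Definition gl_mul (g h : GLinf) : GLinf := GLmk (gl_mul_proof g h).

Definition gl_one : GLinf := GLmk (in_gl1 0).

Definition gl_inv_mx (g : GLinf) : 'M[S]_(gl_dim g) :=
  xget 1%:M [set h | gl_mx g *m h = 1%:M /\ h *m gl_mx g = 1%:M].

Lemma gl_inv_mxP (g : GLinf) :
  gl_mx g *m gl_inv_mx g = 1%:M /\ gl_inv_mx g *m gl_mx g = 1%:M.
Proof.
have [_ gP] := gl_mxP g.
exact: (@xgetPex _ 1%:M
  [set h | gl_mx g *m h = 1%:M /\ h *m gl_mx g = 1%:M] gP).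
Qed.

Fact gl_inv_proof (g : GLinf) : in_gl (gl_inv_mx g).
Proof. by have [] := gl_inv_mxP g; apply: in_gl_inv; exact: gl_mxP. Qed.

Definition gl_inv (g : GLinf) : GLinf := GLmk (gl_inv_proof g).

(* Homotopy in GL_oo(A), i.e. in GL_N(A) for some large N. *)
Definition gl_eqv (g h : GLinf) : Prop :=
  exists N, [/\ (gl_dim g <= N)%N, (gl_dim h <= N)%N &
    homotopic (pad N (gl_mx g)) (pad N (gl_mx h))].

Lemma gl_eqv_widen g h N N' : (gl_dim g <= N)%N -> (gl_dim h <= N)%N ->
  (N <= N')%N -> homotopic (pad N (gl_mx g)) (pad N (gl_mx h)) ->
  homotopic (pad N' (gl_mx g)) (pad N' (gl_mx h)).
Proof.
move=> gN hN NN' /(homotopic_pad NN').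
by rewrite !pad_pad.
Qed.

Lemma gl_eqv_eq N g h : (gl_dim g <= N)%N -> (gl_dim h <= N)%N ->
  pad N (gl_mx g) = pad N (gl_mx h) -> gl_eqv g h.
Proof.
move=> gN hN gh; exists N; split=> //; rewrite -gh.
by apply/homotopic_refl/in_gl_pad => //; exact: gl_mxP.
Qed.

Definition gl_eqvb : rel GLinf := fun g h => `[< gl_eqv g h >].

Fact gl_eqv_refl : reflexive gl_eqvb.
Proof. by move=> g; apply/asboolP; exact: (@gl_eqv_eq (gl_dim g)). Qed.

Fact gl_eqv_sym : symmetric gl_eqvb.
Proof.
move=> g h; apply/asboolP/asboolP => -[N [gN hN gh]];
  by exists N; split=> //; exact: homotopic_rev.
Qed.

Fact gl_eqv_trans : transitive gl_eqvb.
Proof.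
move=> h g k /asboolP[N [gN hN gh]] /asboolP[M [hM kM hk]]; apply/asboolP.
have NX := leq_maxl N M; have MX := leq_maxr N M.
exists (maxn N M); split; rewrite ?(leq_trans gN)// ?(leq_trans kM)//.
exact: homotopic_trans (gl_eqv_widen gN hN NX gh) (gl_eqv_widen hM kM MX hk).
Qed.

Canonical gl_equiv := EquivRel gl_eqvb gl_eqv_refl gl_eqv_sym gl_eqv_trans.

(* K_1(A) = GL_oo(A) / GL_oo(A)_0 = pi_0(GL_oo(A)). *)
Definition K1 : Type := {eq_quot gl_equiv}.

HB.instance Definition _ := Choice.on K1.
HB.instance Definition _ := EqQuotient.on K1.

Definition K1_class (g : GLinf) : K1 := \pi_K1 g.

Lemma K1_classP g h : K1_class g = K1_class h <-> gl_eqv g h.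
Proof.
rewrite /K1_class; split=> [/eqmodP/asboolP //|gh].
exact/eqmodP/asboolP.
Qed.

Lemma K1W (P : K1 -> Prop) : (forall g, P (K1_class g)) -> forall x, P x.
Proof. by move=> Pc x; have := Pc (repr x); rewrite /K1_class reprK. Qed.

Lemma gl_eqv_repr g : gl_eqv (repr (K1_class g)) g.
Proof. by apply/K1_classP; rewrite /K1_class reprK. Qed.

Definition K1_mul (x y : K1) : K1 := K1_class (gl_mul (repr x) (repr y)).
Definition K1_inv (x : K1) : K1 := K1_class (gl_inv (repr x)).
Definition K1_one : K1 := K1_class gl_one.

Lemma pad_mul g h N : (gl_dim g <= N)%N -> (gl_dim h <= N)%N ->
  pad N (gl_mx (gl_mul g h)) = pad N (gl_mx g) *m pad N (gl_mx h).
Proof.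
move=> gN hN; rewrite {1}/gl_mx /= padM ?geq_max ?gN //.
by rewrite !pad_pad ?leq_maxl ?leq_maxr.
Qed.

Lemma K1_mulE g h : K1_mul (K1_class g) (K1_class h) = K1_class (gl_mul g h).
Proof.
apply/K1_classP.
have [N [g1 g2 gP]] := gl_eqv_repr g; have [M [h1 h2 hP]] := gl_eqv_repr h.
have NX := leq_maxl N M; have MX := leq_maxr N M.
exists (maxn N M); split; rewrite /= ?geq_max.
- by rewrite (leq_trans g1)// (leq_trans h1).
- by rewrite (leq_trans g2)// (leq_trans h2).
rewrite !pad_mul ?(leq_trans g1)// ?(leq_trans h1)// ?(leq_trans g2)//
  ?(leq_trans h2)//.
by apply: homotopicM; [exact: gl_eqv_widen NX gP|exact: gl_eqv_widen MX hP].
Qed.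

Lemma pad_inv g N : (gl_dim g <= N)%N ->
  pad N (gl_mx g) *m pad N (gl_mx (gl_inv g)) = 1%:M /\
  pad N (gl_mx (gl_inv g)) *m pad N (gl_mx g) = 1%:M.
Proof.
move=> gN; have [gV Vg] := gl_inv_mxP g.
by rewrite -[gl_mx (gl_inv g)]/(gl_inv_mx g) -!padM // gV Vg pad1.
Qed.

Lemma K1_invE g : K1_inv (K1_class g) = K1_class (gl_inv g).
Proof.
apply/K1_classP; have [N [g1 g2 gP]] := gl_eqv_repr g.
exists N; split=> //.
have [r1 r2] := pad_inv g1; have [i1 i2] := pad_inv g2.
exact: homotopic_inv gP r1 r2 i1 i2.
Qed.

Fact K1_mulA : associative K1_mul.
Proof.
elim/K1W => g; elim/K1W => h; elim/K1W => k; rewrite !K1_mulE.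
apply/K1_classP; pose N := maxn (gl_dim g) (maxn (gl_dim h) (gl_dim k)).
have gN : (gl_dim g <= N)%N by rewrite leq_maxl.
have hN : (gl_dim h <= N)%N by rewrite leq_max leq_maxl orbT.
have kN : (gl_dim k <= N)%N by rewrite leq_max leq_maxr orbT.
apply: (@gl_eqv_eq N); rewrite ?pad_mul /= ?geq_max ?gN ?hN ?kN //.
exact: mulmxA.
Qed.

Fact K1_mul1 : left_id K1_one K1_mul.
Proof.
elim/K1W => g; rewrite K1_mulE; apply/K1_classP.
apply: (@gl_eqv_eq (gl_dim g)); rewrite ?pad_mul //= ?geq_max ?leqnn //.
by rewrite pad1 // mul1mx.
Qed.

Fact K1_1mul : right_id K1_one K1_mul.
Proof.
elim/K1W => g; rewrite K1_mulE; apply/K1_classP.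
apply: (@gl_eqv_eq (gl_dim g)); rewrite ?pad_mul //= ?geq_max ?leqnn //.
by rewrite pad1 // mulmx1.
Qed.

Fact K1_mulV : left_inverse K1_one K1_inv K1_mul.
Proof.
elim/K1W => g; rewrite K1_invE K1_mulE; apply/K1_classP.
apply: (@gl_eqv_eq (gl_dim g)); rewrite ?pad_mul //= ?geq_max ?leqnn //.
by have [_ ->] := @pad_inv g _ (leqnn _); rewrite pad1.
Qed.

Fact K1_Vmul : right_inverse K1_one K1_inv K1_mul.
Proof.
elim/K1W => g; rewrite K1_invE K1_mulE; apply/K1_classP.
apply: (@gl_eqv_eq (gl_dim g)); rewrite ?pad_mul //= ?geq_max ?leqnn //.
by have [-> _] := @pad_inv g _ (leqnn _); rewrite pad1.
Qed.

HB.instance Definition _ := isGroup.Build K1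
  K1_mulA K1_mul1 K1_1mul K1_mulV K1_Vmul.

End GL.

(* [gmul] and [ginv] are those of the groupoid; the value of [gmul x y] is
   irrelevant unless (x, y) is composable. *)
Record topGroupoid := TopGroupoid {
  gpd_sort :> topologicalType ;
  composable : set (gpd_sort * gpd_sort) ;
  gmul : gpd_sort -> gpd_sort -> gpd_sort ;
  ginv : gpd_sort -> gpd_sort ;
  ginvK : involutive ginv ;
  gmulA : forall x y z, composable (x, y) -> composable (y, z) ->
    [/\ composable (gmul x y, z), composable (x, gmul y z) &
        gmul (gmul x y) z = gmul x (gmul y z)] ;
  composableV : forall x, composable (x, ginv x) ;
  gmulKV : forall x y, composable (x, y) ->
    gmul (ginv x) (gmul x y) = y /\ gmul (gmul x y) (ginv y) = x ;
  gmul_continuous : {within composable, continuous (fun xy => gmul xy.1 xy.2)} ;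
  ginv_continuous : continuous ginv
}.

Section Groupoid.
Variable G : topGroupoid.

Definition grange (x : G) : G := gmul x (ginv x).
Definition gsource (x : G) : G := gmul (ginv x) x.
Definition gunits : set G := range grange.
Definition gfiber (u : G) : set G := [set x | gsource x = u].

(* [f] is a local homeomorphism of G onto an open part of the subspace B. *)
Definition local_homeo_to (B : set G) (f : G -> G) : Prop :=
  forall x, exists U : set G,
    [/\ open U, U x, {in U &, injective f},
        {within U, continuous f} &
        forall V, open V -> V `<=` U ->
          exists2 W, open W & f @` V = W `&` B].

Definition etale : Prop :=
  [/\ hausdorff_space G, locally_compact [set: G],
      local_homeo_to gunits grange & local_homeo_to gunits gsource].

End Groupoid.

Section LengthFunctions.
Variables (R : realType) (G : topGroupoid).

Record length_function (l : G -> R) : Prop := LengthFunction {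
  length_ge0 : forall x, 0 <= l x ;
  length_unit : forall u, gunits u -> l u = 0 ;
  length_inv : forall x, l (ginv x) = l x ;
  length_mul : forall x y, composable (x, y) -> l (gmul x y) <= l x + l y
}.

Definition locally_bounded (l : G -> R) : Prop :=
  forall K : set G, compact K -> exists M, forall x, K x -> l x <= M.

Definition fiber_ball (l : G -> R) (u : G) (t : R) : set G :=
  [set x | gfiber u x /\ l x <= t].

Definition strong_subexponential_growth (l : G -> R) : Prop :=
  exists alpha beta C : R, [/\ 0 < alpha, 0 < beta < 1, 0 < C &
    forall t, 0 <= t ->
      (ereal_sup [set counting (fiber_ball l u t) | u in @gunits G] <=
       (C * expR (alpha * t `^ beta))%:E)%E].

End LengthFunctions.

Section ReducedLp.
Variables (R : realType) (G : topGroupoid).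
Implicit Types (f g xi : G -> R[i]) (p : R).

Definition Cc : set (G -> R[i]) :=
  [set f | continuous f /\ compact (closure [set x | f x != 0])].

Definition convolution f g : G -> R[i] := fun x =>
  \sum_(y \in gfiber (gsource x)) f (gmul x (ginv y)) * g y.

(* Vectors of l^p(G_u) are represented by functions on G, of which only the
   restriction to G_u matters. *)
Definition lpnorm p (u : G) xi : \bar R :=
  ((\esum_(x in gfiber u) (complex.Re `|xi x| `^ p)%:E) `^ p^-1)%E.

Definition lreg (u : G) f xi : G -> R[i] := fun x =>
  \sum_(y \in gfiber u) f (gmul x (ginv y)) * xi y.

Definition lreg_opnorm p (u : G) f : \bar R :=
  ereal_sup [set lpnorm p u (lreg u f xi) | xi in
    [set xi | (lpnorm p u xi <= 1)%E]].

(* The supremum is taken in [0, +oo], so that it is 0 for the empty groupoid. *)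
Definition reduced_norm p f : \bar R :=
  ereal_sup (0%E |` [set lreg_opnorm p u f | u in @gunits G]).

(* The completion of the normed algebra C_c(G), i.e. a Banach algebra with an
   isometric homomorphism from C_c(G) onto a dense subalgebra.  It is unique up
   to isometric isomorphism.  Values of [Flp_in] outside of C_c(G) are
   irrelevant. *)
Record reducedLp p := ReducedLp {
  Flp_alg :> banachAlgType R ;
  Flp_in : (G -> R[i]) -> Flp_alg ;
  Flp_inD : forall f g, Cc f -> Cc g ->
    Flp_in (fun x => f x + g x) = Flp_in f + Flp_in g ;
  Flp_inZ : forall (a : R[i]) f, Cc f ->
    Flp_in (fun x => a * f x) = a *: Flp_in f ;
  Flp_inM : forall f g, Cc f -> Cc g ->
    Flp_in (convolution f g) = bmul (Flp_in f) (Flp_in g) ;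
  Flp_in_norm : forall f, Cc f ->
    (complex.Re `|Flp_in f|)%:E = reduced_norm p f ;
  Flp_in_dense : closure (Flp_in @` Cc) = [set: Flp_alg]
}.

End ReducedLp.

(* Main.v *)
(* Let [D] be the convolution algebra C_c(G), with the norms of F^p and F^p'.  If [f]
   in [D] is supported in the ball of radius [t] and [b] bounds the number of points
   of that ball in each fibre, then the norm of [f] in F^p' is at most [b^2] times
   its norm in F^p, because both compare with the supremum norm.  The m-th power of
   a matrix over the unitization of [D] is supported in the ball of radius [m t],
   where [b^2] grows subexponentially in [m], so the spectral radius of such a
   matrix does not depend on the exponent.  Hence neither does its invertibility,
   nor the convergence of the Newton iteration a |-> 3 a^2 - 2 a^3 towards an
   idempotent.  Since [D] is dense, every K-theory class has a representative over
   [D], or one that is the Newton limit of a matrix over [D], and paths can be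
   replaced by polygons over [D]; the correspondence between the classes having a
   common representative over [D] is then an isomorphism. *)

Require Import Defs.
From HB Require Import structures.
From mathcomp Require Import all_boot all_order all_algebra.
From mathcomp Require Import ssrAC complex finmap ring lra.
From mathcomp Require Import all_classical all_reals all_analysis.

Set Implicit Arguments.
Unset Strict Implicit.
Unset Printing Implicit Defensive.

Import Order.TTheory GRing.Theory Num.Theory.
Import numFieldNormedType.Exports.
Local Open Scope classical_set_scope.
Local Open Scope ring_scope.

(** The bound [b ^+ 2] depends on the support radius, so the identity of C_c(G) need not extend to a
    map between the completions. The K-groups are therefore compared through a relation [Q] between
    two algebras, of which only two analytic properties are used: density, and the fact that
    [mnorm U < rho] on one side yields [mnorm (U' ^+ m) <= rho ^+ m] for some [m > 0] on the other.
    The value 1/2 of [rho] transfers invertibility, the value 1/8 the convergence of Newton's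
    iteration, which stands in for holomorphic functional calculus. Its limits may leave C_c(G), so
    an idempotent is recorded by a starting point over [Q], and its class on the other side must be
    shown independent of that point. For this a Murray-von Neumann equivalence is turned into
    conjugation by a product of elementary matrices, which keeps an explicit inverse when its
    entries are approximated over [Q] and so is available in both algebras at once. For both
    K-groups the last step is a connectedness argument along [0, 1]. *)

(** * Newton iteration towards idempotents *)

(* The cubic [3 a^2 - 2 a^3]. *)
Definition newton (E : pzRingType) (a : E) : E := a - (a *+ 2 - 1) * (a * a - a).

(* Everything here lives in the commutative subring generated by [a], so the
   identity is checked in [{poly int}] and evaluated at [a]. *)
Fact newton_defect_nz (E : nzRingType) (a : E) : let x := a * a - a in
  newton a * newton a - newton a = x * x * (x *+ 4 - 3%:R).
Proof.
have ca : commr_rmorph (intr : int -> E) a by move=> z; exact: commr_int.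
pose ev : {rmorphism {poly int} -> E} := horner_morph ca.
have evX : ev 'X = a by exact: horner_morphX.
pose xi : {poly int} := 'X * 'X - 'X.
have : newton 'X * newton 'X - newton 'X = xi * xi * (xi *+ 4 - 3%:R).
  by rewrite /newton /xi; ring.
move=> /(congr1 ev); rewrite /newton /xi.
by rewrite !(rmorphM, rmorphB, rmorphMn, rmorph1, rmorph_nat) /= evX.
Qed.

(** Matrices of size 0 form the zero ring, where [1 = 0]; this case, excluded by [nzRingType], is
    treated apart. *)
Lemma newton_defect (E : pzRingType) (a : E) : let x := a * a - a in
  newton a * newton a - newton a = x * x * (x *+ 4 - 3%:R).
Proof.
have [E0|E1] := eqVneq (1 : E) 0.
  have e0 (b : E) : b = 0 by rewrite -[b]mul1r E0 mul0r.
  by move=> x; rewrite [LHS]e0 [RHS]e0.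
pose E' : nzRingType := HB.pack E (GRing.PzSemiRing_isNonZero.Build E E1).
exact: (@newton_defect_nz E' a).
Qed.

Section CompleteNorm.
Variables (R : realType) (E : pzRingType).

Definition ncvg (N : E -> R) (u : nat -> E) (e : E) : Prop :=
  forall eps, 0 < eps -> exists k, forall i, (k <= i)%N -> N (u i - e) < eps.

(** [N 1] is not normalised: for the entrywise norm of n by n matrices used below it equals n. *)
Record complete_norm (N : E -> R) : Prop := CompleteNorm {
  cnorm_ge0 : forall x, 0 <= N x ;
  cnorm_eq0 : forall x, N x = 0 -> x = 0 ;
  cnorm0 : N 0 = 0 ;
  cnormN : forall x, N (- x) = N x ;
  cnormD : forall x y, N (x + y) <= N x + N y ;
  cnormM : forall x y, N (x * y) <= N x * N y ;
  cnorm_complete : forall u : nat -> E,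
    (forall eps, 0 < eps ->
       exists k, forall i j, (k <= i)%N -> (k <= j)%N -> N (u i - u j) < eps) ->
    exists e, ncvg N u e
}.

Variable N : E -> R.
Hypothesis cN : complete_norm N.
Implicit Types a b d e f x y z : E.

Let N0 := cnorm_ge0 cN.

Lemma cnorm_sub x y : N (x - y) = N (y - x).
Proof. by rewrite -(cnormN cN) opprB. Qed.

Lemma cnormB x y : N (x - y) <= N x + N y.
Proof. by rewrite -(cnormN cN y) (cnormD cN). Qed.

Lemma cnorm_tri y x z : N (x - z) <= N (x - y) + N (y - z).
Proof. by rewrite -[x - z](subrKA y) (cnormD cN). Qed.

Lemma cnormMn x n : N (x *+ n) <= N x *+ n.
Proof.
elim: n => [|n IHn]; first by rewrite !mulr0n (cnorm0 cN).
by rewrite !mulrS (le_trans (cnormD cN _ _)) ?lerD2l.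
Qed.

Lemma cnormX x n : (0 < n)%N -> N (x ^+ n) <= N x ^+ n.
Proof.
case: n => // n _; elim: n => [|n IHn]; first by rewrite !expr1.
by rewrite exprS [leRHS]exprS (le_trans (cnormM cN _ _)) ?ler_wpM2l.
Qed.

Lemma cnorm_eps x : (forall eps, 0 < eps -> N x <= eps) -> x = 0.
Proof.
move=> xe; apply: (cnorm_eq0 cN); apply/eqP; rewrite eq_le N0 andbT.
by apply/ler_addgt0Pl => eps /xe; rewrite addr0.
Qed.

Lemma ncvg_unique u e f : ncvg N u e -> ncvg N u f -> e = f.
Proof.
move=> ue uf; apply/eqP; rewrite -subr_eq0; apply/eqP/cnorm_eps => eps eps0.
have [k ke] := ue _ (divr_gt0 eps0 (ltr0Sn _ 1)).
have [l lf] := uf _ (divr_gt0 eps0 (ltr0Sn _ 1)).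
have {}ke := ke _ (leq_maxl k l); have {}lf := lf _ (leq_maxr k l).
rewrite (le_trans (cnorm_tri (u (maxn k l)) e f)) // cnorm_sub.
by rewrite [leRHS]splitr ltW // ltrD.
Qed.

Lemma ncvg_shift m u e : ncvg N (fun k => u (k + m)%N) e -> ncvg N u e.
Proof.
move=> ue eps /ue[k ke]; exists (k + m)%N => i ki.
by have := ke (i - m)%N; rewrite subnK ?(leq_trans (leq_addl k m)) // => -> //;
  rewrite leq_subRL ?(leq_trans (leq_addl k m)) // addnC.
Qed.

Lemma small_expr (q eps : R) : 0 <= q < 1 -> 0 < eps -> exists k, q ^+ k < eps.
Proof.
move=> /andP[q0 q1] eps0.
have /cvgrPdist_lt/(_ _ eps0)[k _ kP] : (fun k => q ^+ k) @ \oo --> (0 : R).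
  by apply: cvg_expr; rewrite ger0_norm.
exists k; have := kP k (leqnn k).
by rewrite /= sub0r normrN ger0_norm // exprn_ge0.
Qed.

Lemma geometric_cvg (u : nat -> E) (c q : R) : 0 <= q < 1 -> 0 <= c ->
  (forall k, N (u k.+1 - u k) <= c * q ^+ k) ->
  exists e, ncvg N u e /\ N (e - u 0) <= c / (1 - q).
Proof.
move=> /andP[q0 q1] c0 uq; have q1' : 0 < 1 - q by rewrite subr_gt0.
pose D := c / (1 - q).
have D0 : 0 <= D by rewrite divr_ge0 // ltW.
have uD k j : N (u (k + j)%N - u k) <= D * q ^+ k.
  (* The factor [1 - q ^+ j] makes the bound an exact geometric sum, so that the induction on [j]
     closes. *)
  suff : N (u (k + j)%N - u k) <= D * q ^+ k * (1 - q ^+ j).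
    move=> /le_trans; apply; rewrite ler_piMr ?(mulr_ge0 D0 (exprn_ge0 k q0)) //.
    by rewrite gerBl exprn_ge0.
  elim: j => [|j IHj]; first by rewrite addn0 !subrr mulr0 (cnorm0 cN).
  rewrite addnS (le_trans (cnorm_tri (u (k + j)%N) _ _)) //.
  rewrite (le_trans (lerD (uq _) IHj)) // exprD exprS.
  have -> : c = D * (1 - q) by rewrite /D divfK // gt_eqF.
  by rewrite le_eqVlt; apply/orP; left; apply/eqP; ring.
have uC k i j : (k <= i)%N -> (k <= j)%N -> N (u i - u j) <= 2 * (D * q ^+ k).
  move=> ki kj; rewrite (le_trans (cnorm_tri (u k) _ _)) //.
  rewrite mulr_natl mulr2n lerD // ?(cnorm_sub (u k)).
    by have := uD k (i - k)%N; rewrite subnKC.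
  by have := uD k (j - k)%N; rewrite subnKC.
have [eps eps0|e ue] := cnorm_complete cN (u := u).
  have eD : 0 < eps / (2 * (D + 1)) by rewrite divr_gt0 // mulr_gt0 // ltr_wpDl.
  have [|k ke] := small_expr (q := q) _ eD; first by rewrite q0.
  exists k => i j ki kj; rewrite (le_lt_trans (uC k i j ki kj)) //.
  move: ke; rewrite ltr_pdivlMr ?mulr_gt0 ?ltr_wpDl // => ke.
  by have qk := exprn_ge0 k q0; apply: le_lt_trans ke; nra.
exists e; split=> //; apply/ler_addgt0Pl => eps /ue[k /(_ k (leqnn k)) ke].
rewrite (le_trans (cnorm_tri (u k) _ _)) // lerD //.
  by rewrite cnorm_sub ltW.
by have := uD 0 k; rewrite add0n expr0 mulr1.
Qed.

Lemma geo_suml x n : (1 - x) * \sum_(i < n) x ^+ i = 1 - x ^+ n.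
Proof.
elim: n => [|n IHn]; first by rewrite big_ord0 mulr0 expr0 subrr.
by rewrite big_ord_recr mulrDr IHn mulrBl mul1r -exprS addrA subrK.
Qed.

Lemma geo_sumr x n : (\sum_(i < n) x ^+ i) * (1 - x) = 1 - x ^+ n.
Proof.
elim: n => [|n IHn]; first by rewrite big_ord0 mul0r expr0 subrr.
by rewrite big_ord_recr mulrDl IHn mulrBr mulr1 -exprSr addrA subrK.
Qed.

Lemma neumann x : N x < 1 -> exists y, (1 - x) * y = 1 /\ y * (1 - x) = 1.
Proof.
move=> x1; pose u n : E := \sum_(i < n) x ^+ i.
have uS n : u n.+1 = u n + x ^+ n by rewrite /u big_ord_recr.
have gu n : (1 - x) * u n = 1 - x ^+ n by exact: geo_suml.
have ug n : u n * (1 - x) = 1 - x ^+ n by exact: geo_sumr.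
have q01 : 0 <= N x < 1 by rewrite N0.
(* The constant [N 1 + 1] covers the first increment, which is 1, as well as the later ones, which
   need a factor at least 1. *)
have [||y [uy _]] := @geometric_cvg u (N 1 + 1) (N x) q01.
- by rewrite addr_ge0.
- move=> [|k]; first by rewrite uS addrC addKr !expr0 mulr1 lerDl.
  rewrite uS addrC addKr (le_trans (cnormX _ (ltn0Sn k))) //.
  by rewrite ler_peMl ?exprn_ge0 // lerDr.
(* Passage to the limit shared by both sides: [v n] tends to 1 because [x ^+ n] tends to 0, and to
   [z] because [u n] tends to [y]. *)
have lim1 (v : nat -> E) z c : 0 <= c -> (forall n, v n = 1 - x ^+ n) ->
    (forall n, N (v n - z) <= c * N (u n - y)) -> z = 1.
  move=> c0 vE vz; apply/eqP; rewrite -subr_eq0; apply/eqP/cnorm_eps => eps eps0.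
  have e2 : 0 < eps / 2 by rewrite divr_gt0.
  have [k1 k1P] := small_expr q01 e2.
  have [k2 k2P] := uy _ (divr_gt0 e2 (ltr_wpDl c0 ltr01)).
  pose k := (maxn k1 k2).+1.
  rewrite (le_trans (cnorm_tri (v k) _ _)) // [leRHS]splitr lerD //.
    rewrite cnorm_sub (le_trans (vz k)) //.
    have := k2P k; rewrite /k leqW ?leq_maxr // => /(_ isT).
    rewrite ltr_pdivlMr ?ltr_wpDl // => /ltW; apply: le_trans.
    by rewrite mulrC ler_wpM2l // lerDl.
  rewrite vE addrAC subrr sub0r (cnormN cN) (le_trans (cnormX _ _)) //.
  rewrite (le_trans _ (ltW k1P)) // ler_wiXn2l ?N0 ?ltW //.
  by rewrite leqW // leq_maxl.
exists y; split.
  apply: (lim1 (fun n => (1 - x) * u n) _ (N (1 - x)) (N0 _) gu) => n.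
  by rewrite -mulrBr (cnormM cN).
apply: (lim1 (fun n => u n * (1 - x)) _ (N (1 - x)) (N0 _) ug) => n.
by rewrite -mulrBl mulrC (cnormM cN).
Qed.

(** [1 - x] is a left and a right factor of the invertible [1 - x ^+ m]; the two one-sided inverses
    obtained from this agree. *)
Lemma spectral_neumann x m : N (x ^+ m) < 1 ->
  exists y, (1 - x) * y = 1 /\ y * (1 - x) = 1.
Proof.
move=> /neumann[y [gy yg]]; pose s : E := \sum_(i < m) x ^+ i.
have ys : (y * s) * (1 - x) = 1 by rewrite -mulrA geo_sumr.
have sy : (1 - x) * (s * y) = 1 by rewrite mulrA geo_suml.
have : y * s * ((1 - x) * (s * y)) = y * s by rewrite sy mulr1.
by rewrite mulrA ys mul1r => sys; exists (s * y); split=> //; rewrite sys.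
Qed.

Definition defect (a : E) : E := a * a - a.

Lemma newton_defect_le a :
  N (defect (newton a)) <= N (defect a) ^+ 2 * (4 * N (defect a) + 3).
Proof.
rewrite /defect newton_defect -/(defect a); set x := defect a.
have -> : x * x * (x *+ 4 - 3%:R) = (x * x * x) *+ 4 - (x * x) *+ 3.
  by rewrite mulrBr mulrnAr mulr_natr.
have x2 := cnormM cN x x.
have x3 : N (x * x * x) <= N x * N x * N x.
  by rewrite (le_trans (cnormM cN _ _)) // ler_wpM2r.
have h1 := cnormB ((x * x * x) *+ 4) ((x * x) *+ 3).
have h2 := cnormMn (x * x * x) 4; have h3 := cnormMn (x * x) 3.
have -> : N x ^+ 2 * (4 * N x + 3) = (N x * N x * N x) *+ 4 + (N x * N x) *+ 3.
  by ring.
by apply: (le_trans h1); apply: lerD; [apply: (le_trans h2)|apply: (le_trans h3)];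
  rewrite ler_pMn2r.
Qed.

Lemma newton_step_le a : N (newton a - a) <= (2 * N a + 1) * N (defect a).
Proof.
rewrite /newton -/(defect a) addrAC subrr sub0r (cnormN cN).
have -> : (a *+ 2 - 1) * defect a = (a * defect a) *+ 2 - defect a.
  by rewrite mulrBl mul1r mulrnAl.
rewrite (le_trans (cnormB _ _)) // mulrDl mul1r lerD2r.
apply: (le_trans (cnormMn _ _)).
by have := cnormM cN a (defect a); lra.
Qed.

Lemma defect_near b c :
  N (defect c - defect b) <= N (c - b) * (2 * N b + N (c - b) + 1).
Proof.
have [w ->] : exists w, c = b + w by exists (c - b); rewrite addrC subrK.
rewrite [b + w - b]addrAC subrr add0r.
have -> : defect (b + w) - defect b = b * w + w * b + w * w - w.
  rewrite /defect mulrDl !mulrDr opprB opprD !addrA.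
  rewrite [LHS](ACl ((2*3*4*6)*(1*8)*(5*7)))/= subrr addr0 addNr addr0.
  by [].
have hbw := cnormM cN b w; have hwb := cnormM cN w b.
have hww := cnormM cN w w.
have := cnormB (b * w + w * b + w * w) w.
have := cnormD cN (b * w + w * b) (w * w); have := cnormD cN (b * w) (w * b).
by move=> h1 h2 h3; lra.
Qed.

(** The defect is continuous by [defect_near], so it vanishes at the limit. *)
Lemma ncvg_idem u e : ncvg N u e ->
  (forall eps, 0 < eps -> exists k, N (defect (u k)) < eps /\
     forall i, (k <= i)%N -> N (defect (u i)) < eps) -> e * e = e.
Proof.
move=> ue ud; apply/eqP; rewrite -subr_eq0; apply/eqP/cnorm_eps => eps eps0.
have [k [_ ke]] := ud _ (divr_gt0 eps0 (ltr0Sn _ 1)).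
have c0 : 0 < 2 * N e + 2 by rewrite ltr_wpDl ?mulr_ge0.
have d0 : 0 < Num.min 1 (eps / 2 / (2 * N e + 2)).
  by rewrite lt_min ltr01 !divr_gt0.
have [l le] := ue _ d0.
have {}ke := ke _ (leq_maxl k l); have {}le := le _ (leq_maxr k l).
set i := maxn k l in ke le; move: le; rewrite lt_min => /andP[l1].
rewrite ltr_pdivlMr // => l2.
have h := defect_near e (u i).
have t := cnorm_tri (defect (u i)) (defect e) 0.
rewrite !subr0 cnorm_sub in t.
have w0 := N0 (u i - e); have e0 := N0 e.
rewrite -/(defect e); apply: (le_trans t).
have : N (u i - e) * (2 * N e + N (u i - e) + 1) <= N (u i - e) * (2 * N e + 2).
  by rewrite ler_wpM2l //; lra.
by move=> h'; lra.
Qed.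

Lemma half_expr01 k : 0 <= 2^-1 ^+ k :> R /\ 2^-1 ^+ k <= 1 :> R.
Proof. by split; [apply: exprn_ge0|apply: exprn_ile1]; lra. Qed.

(** Origin of 1/8: if [y <= 8^-1] then [y * (4 * y + 3) <= 2^-1], so each step at least halves the
    defect and the bound persists. *)
Lemma iter_newton_defect a k : N (defect a) <= 8^-1 ->
  N (defect (iter k (@newton E) a)) <= N (defect a) * 2^-1 ^+ k.
Proof.
move=> a8; elim: k => [|k IHk]; first by rewrite expr0 mulr1.
rewrite iterS (le_trans (newton_defect_le _)) //.
move: IHk; rewrite [2^-1 ^+ _.+1]exprS; set y := N _; set X := N _; set q := 2^-1 ^+ k => IHk.
have y0 : 0 <= y by exact: N0.
have X0 : 0 <= X by exact: N0.
have [q0 q1] : 0 <= q /\ q <= 1 by exact: half_expr01.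
have y8 : y <= 8^-1 by rewrite (le_trans IHk) // (le_trans _ a8) // ler_piMr.
have : y ^+ 2 * (4 * y + 3) <= y * 2^-1.
  have -> : y ^+ 2 * (4 * y + 3) = y * (y * (4 * y + 3)) by ring.
  by rewrite ler_wpM2l //; nra.
by move=> /le_trans; apply; lra.
Qed.

Lemma newton_cvg a : N (defect a) <= 8^-1 ->
  exists e, [/\ ncvg N (fun k => iter k (@newton E) a) e, e * e = e &
    N (e - a) <= 4 * (2 * N a + 1) * N (defect a)].
Proof.
move=> a8; pose u k := iter k (@newton E) a.
have dk k : N (defect (u k)) <= N (defect a) * 2^-1 ^+ k.
  exact: iter_newton_defect.
have X0 := N0 (defect a); have Na0 := N0 a.
have q0 k : 0 <= 2^-1 ^+ k :> R by have [] := half_expr01 k.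
have q1 k : 2^-1 ^+ k <= 1 :> R by have [] := half_expr01 k.
(* The iterates stay bounded: with [q = 2^-1 ^+ k], a step multiplies the left side by at most
   [1 + 4^-1 * q], and [(2 - q) * (1 + 4^-1 * q) <= 2 - 2^-1 * q]. *)
have ck k : 2 * N (u k) + 1 <= (2 * N a + 1) * (2 - 2^-1 ^+ k).
  elim: k => [|k IHk]; first by rewrite /u /= expr0; lra.
  have := newton_step_le (u k); have := cnormD cN (newton (u k) - u k) (u k).
  rewrite subrK -[u k.+1]/(newton (u k)) [2^-1 ^+ _.+1]exprS => h1 h2.
  have h3 := le_trans h1 (lerD h2 (lexx _)).
  move: (dk k) (q0 k) (q1 k) (N0 (defect (u k))) (N0 (u k)) IHk h3.
  set d := N (defect (u k)); set q := 2^-1 ^+ k; set v := N (u k).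
  move=> hd hq hq1 d0 v0 IHk h3.
  have dq : d <= 8^-1 * q by rewrite (le_trans hd) // ler_wpM2r.
  have : 2 * N (newton (u k)) + 1 <= (2 * v + 1) * (1 + 2 * d) by lra.
  move=> /le_trans; apply.
  apply: (@le_trans _ _ ((2 * N a + 1) * (2 - q) * (1 + 4^-1 * q))).
    by rewrite ler_pM //; lra.
  by rewrite -mulrA ler_wpM2l //; [lra|nra].
have h01 : 0 <= (2^-1 : R) < 1 by lra.
have [||e [ue ea]] := @geometric_cvg u (2 * (2 * N a + 1) * N (defect a)) 2^-1 h01.
- by rewrite !mulr_ge0 // addr_ge0 // mulr_ge0.
- move=> k; rewrite (le_trans (newton_step_le (u k))) //.
  rewrite -mulrA ler_pM //; first by rewrite addr_ge0 // mulr_ge0.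
  by have := ck k; have := q0 k; nra.
have -> : 4 * (2 * N a + 1) * N (defect a) =
    2 * (2 * N a + 1) * N (defect a) / (1 - 2^-1) by field.
exists e; split=> //.
apply: (ncvg_idem ue) => eps eps0.
have X1 : 0 < N (defect a) + 1 by rewrite ltr_wpDl.
have [k] := small_expr h01 (divr_gt0 eps0 X1); rewrite ltr_pdivlMr // => ke.
suff h i : (k <= i)%N -> N (defect (u i)) < eps by exists k; split; rewrite ?h.
move=> ki; rewrite (le_lt_trans (dk i)) // (le_lt_trans _ ke) // mulrC.
rewrite ler_pM // ?lerDl // ler_wiXn2l // ?invr_ge0 // invf_le1 //.
by rewrite ler1n.
Qed.

Lemma iter_newton_iter i k a :
  iter i (@newton E) (iter k (@newton E) a) = iter (i + k) (@newton E) a.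
Proof. by rewrite iterD. Qed.

(* The seminorm [M] below is such that multiplication by the defect is a
   contraction for it, although the norm of the defect itself may be large. *)
Lemma newton_cvg_spectral a m : (0 < m)%N ->
    N (defect a ^+ m) <= 8^-1 ^+ m ->
  exists e, ncvg N (fun k => iter k (@newton E) a) e /\ e * e = e.
Proof.
move=> m0 am; pose u k := iter k (@newton E) a; pose x := defect a.
pose t z j : R := 8 ^+ j * N (x ^+ j * z).
pose M z : R := \sum_(j < m) t z j.
have t0 z j : 0 <= t z j by rewrite mulr_ge0 ?exprn_ge0.
have M0 z : 0 <= M z by apply: sumr_ge0 => j _.
have NM z : N z <= M z.
  rewrite /M; case: m m0 {am M M0} => // m _.
  rewrite big_ord_recl /t expr0 mul1r expr0 mul1r lerDl.
  by apply: sumr_ge0 => j _; exact: t0.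
have MB y z : M (y - z) <= M y + M z.
  rewrite /M -big_split /=; apply: ler_sum => j _.
  by rewrite /t -mulrDr ler_wpM2l ?exprn_ge0 // mulrBr cnormB.
have MMn z n : M (z *+ n) <= M z *+ n.
  rewrite /M -sumrMnl; apply: ler_sum => j _.
  rewrite /t -mulrnAr ler_wpM2l ?exprn_ge0 //.
  by rewrite mulrnAr cnormMn.
(* The sum for [x * z] is the one for [z] shifted by one index and divided by 8; the new last term
   [8 ^+ m * N (x ^+ m * z)] is at most the lost first term [N z]. *)
have Mx z : M (x * z) <= 8^-1 * M z.
  have -> : M (x * z) = 8^-1 * \sum_(j < m) t z j.+1.
    rewrite /M mulr_sumr; apply: eq_bigr => j _.
    rewrite /t [x ^+ j * _]mulrA -exprSr [8 ^+ j.+1]exprS !mulrA.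
    by rewrite mulVf ?mul1r.
  rewrite ler_wpM2l ?invr_ge0 // -(lerD2l (t z 0%N)).
  rewrite -(big_ord_recl m (t z)) big_ord_recr /= addrC lerD2r /t.
  rewrite expr0 mul1r expr0 mul1r.
  apply: (@le_trans _ _ (8 ^+ m * (8^-1 ^+ m * N z))).
    rewrite ler_wpM2l ?exprn_ge0 // (le_trans (cnormM cN _ _)) //.
    by rewrite ler_wpM2r.
  by rewrite mulrA -exprMn mulfV ?pnatr_eq0 // expr1n mul1r.
(* The next defect is [d * d * (d *+ 4 - 3%:R)]. Its factors contribute at most [8^-1 * q],
   [8^-1 * q] and 4, in total at most half of [8^-1 * q]. *)
have Mk k z : M (defect (u k) * z) <= 8^-1 * 2^-1 ^+ k * M z.
  elim: k z => [|k IHk] z; first by rewrite expr0 mulr1; exact: Mx.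
  rewrite /u iterS -/(u k) {1}/defect newton_defect -/(defect (u k)).
  set d := defect (u k) in IHk *; have [q0 q1] := half_expr01 k.
  set q := 2^-1 ^+ k in IHk q0 q1 *.
  rewrite -!mulrA (le_trans (IHk _)) // exprS -/q.
  have -> : (d *+ 4 - 3%:R) * z = (d * z) *+ 4 - z *+ 3.
    by rewrite mulrBl mulr_natl mulrnAl.
  have h1 := IHk ((d * z) *+ 4 - z *+ 3).
  have h2 := MB ((d * z) *+ 4) (z *+ 3).
  have h3 := MMn (d * z) 4%N; have h4 := MMn z 3%N; have h5 := IHk z.
  have h6 : M (d * z *+ 4 - z *+ 3) <= 4 * M z.
    apply: (le_trans h2); apply: (le_trans (lerD h3 h4)).
    have : 8^-1 * q * M z <= 8^-1 * M z by rewrite ler_wpM2r // ler_piMr; lra.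
    by have := M0 z; lra.
  have := M0 z; move: h1 h6; set w' := M (d * _); set w := M (_ - _); set v := M z.
  move=> h1 h6 v0.
  have h7 : w' <= 2^-1 * q * v by have := ler_wpM2l q0 h6; lra.
  have w'0 : 0 <= w' by exact: M0.
  have : q * w' <= w' by rewrite ler_piMl.
  lra.
have h01 : 0 <= (2^-1 : R) < 1 by lra.
have M1 : 0 < M 1 + 1 by rewrite ltr_wpDl.
(* [k] is such that the estimate at [z = 1] brings the plain norm of the defect below 1/8;
   [newton_cvg] then applies from [u k] on. *)
have [k] := small_expr h01 (divr_gt0 ltr01 M1); rewrite ltr_pdivlMr // => kM.
have [|e [ue ee _]] := @newton_cvg (u k).
  have := Mk k 1; have := NM (defect (u k) * 1); rewrite mulr1.
  by have [q0 q1] := half_expr01 k; have := M0 1; lra.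
exists e; split=> //; apply: (@ncvg_shift k) => eps /ue[l lP]; exists l => i il.
by have := lP i il; rewrite iter_newton_iter.
Qed.

Definition sim (e f : E) : Prop :=
  exists z w, [/\ z * w = 1, w * z = 1 & z * e = f * z].

Lemma sim_refl e : sim e e.
Proof. by exists 1, 1; rewrite !mulr1 mul1r. Qed.

Lemma sim_sym e f : sim e f -> sim f e.
Proof.
move=> [z [w [zw wz zef]]]; exists w, z; split=> //.
by rewrite -[w * f]mulr1 -zw -mulrA (mulrA f) -zef !mulrA wz mul1r.
Qed.

Lemma sim_trans f e g : sim e f -> sim f g -> sim e g.
Proof.
move=> [z [w [zw wz zef]]] [z' [w' [zw' wz' zfg]]]; exists (z' * z), (w * w').
split.
- by rewrite mulrA -(mulrA z') zw mulr1.
- by rewrite mulrA -(mulrA w) wz' mulr1.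
- by rewrite -mulrA zef mulrA zfg mulrA.
Qed.

(** The classical intertwiner [z = e * f + (1 - e) * (1 - f)] satisfies [z * f = e * f = e * z] and
    [1 - z = (e *+ 2 - 1) * (e - f)], so it is invertible by Neumann's series. *)
Lemma sim_near e f : e * e = e -> f * f = f ->
  N (e *+ 2 - 1) * N (e - f) < 1 -> sim e f.
Proof.
move=> ee ff small; apply: sim_sym.
pose z := e * f + (1 - e) * (1 - f).
have zE : 1 - z = (e *+ 2 - 1) * (e - f).
  have -> : (e *+ 2 - 1) * (e - f) = e + (f - (e * f) *+ 2).
    by rewrite mulrBr !mulrBl !mul1r !mulrnAl ee [e *+ 2]mulr2n addrK opprB.
  rewrite /z mulrBl mul1r mulrBr mulr1 mulr2n !opprD !opprK !addrA.
  by rewrite [LHS](ACl ((1*3)*5*4*2*6))/= subrr add0r.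
have [|w [zw wz]] := @neumann (1 - z).
  by rewrite zE (le_lt_trans (cnormM cN _ _)).
rewrite subKr in zw wz; exists z, w; split=> //.
transitivity (e * f).
  by rewrite /z mulrDl -mulrA ff -mulrA [(1 - f) * f]mulrBl mul1r ff subrr mulr0 addr0.
by rewrite /z mulrDr mulrA ee mulrA [e * (1 - e)]mulrBr mulr1 ee subrr mul0r addr0.
Qed.

Lemma defect_small e : e * e = e ->
  exists eta, 0 < eta /\ forall b, N (b - e) < eta -> N (defect b) < 8^-1.
Proof.
move=> ee; have e0 := N0 e.
have c0 : 0 < 2 * N e + 2 by lra.
exists (8^-1 / (2 * N e + 2)); split; first by rewrite divr_gt0 ?invr_gt0.
move=> b; rewrite ltr_pdivlMr // => be.
have b0 := N0 (b - e).
have b1 : N (b - e) <= 1 by nra.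
have := defect_near e b; rewrite {2}/defect ee subrr subr0 => /le_lt_trans; apply.
apply: le_lt_trans be; rewrite ler_wpM2l //; lra.
Qed.

(** The defect of [b], and with it the distance from [b] to its Newton limit, is bounded by a
    multiple of [N (b - e)]; the limit is thus close enough to [e] for [sim_near]. *)
Lemma newton_stable e : e * e = e ->
  exists eta, 0 < eta /\ forall b, N (b - e) < eta ->
    exists f, [/\ ncvg N (fun k => iter k (@newton E) b) f, f * f = f & sim e f].
Proof.
move=> ee; have e0 := N0 e; have o0 := N0 1.
(* [c] bounds at once [N (e *+ 2 - 1)], [2 * N b + 1] and the Lipschitz factor of the defect; the
   product in [sim_near] is then at most [9 * c ^+ 3 * N (b - e)]. *)
pose c := 2 * N e + N 1 + 3.
have c1 : 3 <= c by rewrite /c; lra.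
have c3 : 0 < 9 * c ^+ 3 by rewrite mulr_gt0 // exprn_gt0 //; lra.
have [eta1 [eta10 eta1P]] := defect_small ee.
exists (Num.min eta1 (Num.min 1 (9 * c ^+ 3)^-1)).
split; first by rewrite !lt_min eta10 ltr01 invr_gt0.
move=> b; rewrite !lt_min => /and3P[/eta1P/ltW b8 b1 bc].
have [f [bf ff fb]] := newton_cvg b8; exists f; split=> //.
apply: sim_near => //; set w := N (b - e) in b1 bc.
have w0 : 0 <= w by exact: N0.
have dw : N (defect b) <= w * c.
  have := defect_near e b; rewrite {2}/defect ee subrr subr0 => /le_trans; apply.
  by rewrite ler_wpM2l // /c -/w; lra.
have bw : N b <= N e + w by have := cnormD cN (b - e) e; rewrite subrK -/w; lra.
have h1 : N (e - f) <= w + 4 * (2 * N b + 1) * (w * c).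
  rewrite (le_trans (cnorm_tri b e f)) // lerD //.
    by rewrite cnorm_sub.
  rewrite cnorm_sub (le_trans fb) // ler_wpM2l //.
  by have := N0 b; lra.
have h2 : N (e *+ 2 - 1) <= c.
  rewrite (le_trans (cnormB _ _)) // (le_trans (lerD (cnormMn _ _) (lexx _))) //.
  by rewrite /c; lra.
have h3 : w + 4 * (2 * N b + 1) * (w * c) <= 9 * c ^+ 2 * w.
  have -> : w + 4 * (2 * N b + 1) * (w * c) = (1 + 4 * (2 * N b + 1) * c) * w.
    by ring.
  rewrite ler_wpM2r //.
  apply: (@le_trans _ _ (1 + 8 * c * c)); last by nra.
  rewrite lerD2l ler_wpM2r //; [lra|rewrite /c; lra].
apply: (@le_lt_trans _ _ (c * (9 * c ^+ 2 * w))).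
  by rewrite ler_pM // (le_trans h1).
move: bc; rewrite -[_^-1]mul1r ltr_pdivlMr // => bc.
apply: le_lt_trans bc; rewrite le_eqVlt; apply/orP; left; apply/eqP; ring.
Qed.

Lemma mul_near a b eps : 0 < eps -> exists delta, 0 < delta /\
  forall c d, N (c - a) < delta -> N (d - b) < delta -> N (c * d - a * b) < eps.
Proof.
move=> eps0; have a0 := N0 a; have b0 := N0 b.
have K0 : 0 < N a + N b + 1 by lra.
pose delta := Num.min 1 (eps / 2 / (N a + N b + 1)).
have delta0 : 0 < delta by rewrite lt_min ltr01 !divr_gt0.
have delta1 : delta <= 1 by rewrite ge_min lexx.
have deltaK : delta * (N a + N b + 1) <= eps / 2.
  by rewrite -ler_pdivlMr // ge_min lexx orbT.
exists delta; split=> // c d /ltW ca /ltW db.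
have -> : c * d - a * b = (c - a) * d + a * (d - b).
  by rewrite mulrBl mulrBr addrA subrK.
have h1 := cnormD cN ((c - a) * d) (a * (d - b)).
have h2 := cnormM cN (c - a) d; have h3 := cnormM cN a (d - b).
have h4 : N d <= N b + 1 by have := cnormD cN (d - b) b; rewrite subrK; lra.
have h5 : N (c - a) * N d <= delta * (N b + 1) by rewrite ler_pM.
have h6 : N a * N (d - b) <= N a * delta by rewrite ler_wpM2l.
by lra.
Qed.

Lemma newton_near a eps : 0 < eps -> exists delta, 0 < delta /\
  forall b, N (b - a) < delta -> N (newton b - newton a) < eps.
Proof.
move=> eps0; have e3 : 0 < eps / 2 by rewrite divr_gt0.
have [d1 [d10 d1P]] := mul_near (a *+ 2 - 1) (defect a) e3.
have [d2 [d20 d2P]] := mul_near a a (divr_gt0 d10 (ltr0Sn R 1)).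
pose delta := Num.min d2 (Num.min (d1 / 2) (eps / 2)).
exists delta; rewrite !lt_min d20 e3 divr_gt0 //; split=> // b.
rewrite !lt_min => /and3P[b2 b1 be]; rewrite /newton -!/(defect _).
have -> : b - (b *+ 2 - 1) * defect b - (a - (a *+ 2 - 1) * defect a) =
    (b - a) - ((b *+ 2 - 1) * defect b - (a *+ 2 - 1) * defect a).
  by rewrite !opprD !opprK addrACA.
rewrite (le_lt_trans (cnormB _ _)) // [ltRHS]splitr ltrD //; apply: d1P.
  have -> : b *+ 2 - 1 - (a *+ 2 - 1) = (b - a) *+ 2.
    by rewrite mulrnBl opprB addrA subrK.
  by have := cnormMn (b - a) 2; lra.
have -> : defect b - defect a = (b * b - a * a) - (b - a).
  by rewrite /defect !opprD !opprK !addrA [LHS](ACl (1*3*2*4))/=.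
by have := cnormB (b * b - a * a) (b - a); have := d2P _ _ b2 b2; lra.
Qed.

Lemma iter_newton_near k a eps : 0 < eps -> exists delta, 0 < delta /\
  forall b, N (b - a) < delta ->
    N (iter k (@newton E) b - iter k (@newton E) a) < eps.
Proof.
elim: k eps => [|k IHk] eps eps0; first by exists eps.
have [d [d0 dP]] := newton_near (iter k (@newton E) a) eps0.
have [d' [d'0 d'P]] := IHk _ d0.
by exists d'; split=> // b /d'P/dP.
Qed.

(** Finitely many steps, continuous in the starting point, lead near [e], where [newton_stable]
    takes over. So convergence to an idempotent is an open condition, and the similarity class of
    the limit is locally constant. *)
Lemma newton_limit_near a e : ncvg N (fun k => iter k (@newton E) a) e ->
    e * e = e ->
  exists delta, 0 < delta /\ forall b, N (b - a) < delta ->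
    exists f, [/\ ncvg N (fun k => iter k (@newton E) b) f, f * f = f & sim e f].
Proof.
move=> ae ee; have [eta [eta0 etaP]] := newton_stable ee.
have eta2 : 0 < eta / 2 by rewrite divr_gt0.
have [k kP] := ae _ eta2; have [d [d0 dP]] := iter_newton_near k a eta2.
exists d; split=> // b /dP bk.
have [|f [bf ff ef]] := etaP (iter k (@newton E) b).
  rewrite (le_lt_trans (cnorm_tri (iter k (@newton E) a) _ _)) // [ltRHS]splitr.
  by rewrite ltrD // kP.
exists f; split=> //; apply: (@ncvg_shift k) => eps /bf[l lP]; exists l => i il.
by have := lP i il; rewrite iter_newton_iter.
Qed.

End CompleteNorm.

(** * Matrices over the unitization *)

Lemma filter_seq (I : Type) (F : set_system I) (FF : Filter F) (T : eqType)
    (s : seq T) (P : T -> set I) :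
  (forall x, x \in s -> F (P x)) -> F [set i | forall x, x \in s -> P x i].
Proof.
elim: s => [|x s IHs] sP; first exact: filterE.
have Fx : F (P x) by apply: sP; rewrite mem_head.
have Fs : F [set i | forall y, y \in s -> P y i].
  by apply: IHs => y ys; apply: sP; rewrite inE ys orbT.
by apply: filterS2 Fx Fs => i xi si y; rewrite inE => /predU1P[-> //|/si].
Qed.

Section RealNorm.
Variables (R : realType) (V : normedModType R[i]).
Implicit Types v w : V.

(** Norms of modules over R[i] take their values in R[i]; these are nonnegative reals, so the real
    part loses nothing. *)
Definition rnorm (v : V) : R := complex.Re `|v|.

Lemma rnormE v : `|v| = (rnorm v)%:C%C.
Proof.
have : 0 <= `|v| by exact: normr_ge0.
by rewrite lecE /= /rnorm => /andP[/eqP im0 _]; case: `|v| im0 => a b /= ->.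
Qed.

Lemma rnorm_ge0 v : 0 <= rnorm v.
Proof. by have := normr_ge0 v; rewrite lecE => /andP[]. Qed.

Lemma rnorm0 : rnorm (0 : V) = 0.
Proof. by rewrite /rnorm normr0. Qed.

Lemma rnorm_eq0 v : rnorm v = 0 -> v = 0.
Proof. by move=> v0; apply/eqP; rewrite -normr_eq0 rnormE v0. Qed.

Lemma rnormN v : rnorm (- v) = rnorm v.
Proof. by rewrite /rnorm normrN. Qed.

Lemma rnormD v w : rnorm (v + w) <= rnorm v + rnorm w.
Proof. by rewrite -lecR rmorphD /= -!rnormE ler_normD. Qed.

Lemma rnormZ (a : R[i]) v : rnorm (a *: v) = complex.Re `|a| * rnorm v.
Proof.
rewrite /rnorm normrZ (rnormE v); case: `|a| => x y /=.
by rewrite mulr0 subr0.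
Qed.

Lemma cvg_rnorm T (F : set_system T) (FF : Filter F) (f : T -> V) v :
  f @ F --> v <-> forall eps : R, 0 < eps -> \forall t \near F, rnorm (f t - v) < eps.
Proof.
split=> [/cvgrPdist_lt fv eps eps0|fv].
  have e0 : 0 < eps%:C%C :> R[i] by rewrite ltcR.
  apply: filterS (fv _ e0) => t.
  by rewrite distrC rnormE ltcR.
apply/cvgrPdist_lt => eps; rewrite ltcE /= => /andP[/eqP im0 re0].
have -> : eps = (complex.Re eps)%:C%C by case: eps im0 {re0} => a b /= ->.
apply: filterS (fv _ re0) => t.
by rewrite distrC rnormE ltcR.
Qed.

End RealNorm.

Lemma cauchy_seq_cvg (R : realType) (V : completeNormedModType R[i]) (u : nat -> V) :
  (forall eps, 0 < eps -> exists k, forall i j, (k <= i)%N -> (k <= j)%N ->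
     rnorm (u i - u j) < eps) ->
  exists v : V, u @ \oo --> v.
Proof.
move=> uC; suff /cauchy_cvg : cauchy (u @ \oo) by move=> uv; exists (lim (u @ \oo)).
apply: cauchy_exP => eps; rewrite ltcE /= => /andP[/eqP im0 re0].
have [k kP] := uC _ re0; exists (u k).
suff : \forall n \near \oo, ball (u k) eps (u n) by [].
exists k => // n /= kn; rewrite -ball_normE /ball_ /=.
have -> : eps = (complex.Re eps)%:C%C by case: eps im0 {re0 kP} => a b /= ->.
by rewrite rnormE ltcR; apply: kP.
Qed.

Lemma cauchy_seq_cvgr (R : realType) (u : nat -> R) :
  (forall eps, 0 < eps -> exists k, forall i j, (k <= i)%N -> (k <= j)%N ->
     `|u i - u j| < eps) ->
  exists v : R, u @ \oo --> v.
Proof.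
move=> uC; suff /cauchy_cvg : cauchy (u @ \oo) by move=> uv; exists (lim (u @ \oo)).
apply: cauchy_exP => eps eps0.
have [k kP] := uC _ eps0; exists (u k).
suff : \forall n \near \oo, ball (u k) eps (u n) by [].
by exists k => // n /= kn; rewrite -ball_normE /ball_ /=; apply: kP.
Qed.

Section ComplexNorm.
Variable R : realType.
Implicit Types z w : R[i].

Lemma norm_Re_le z : `|complex.Re z| <= rnorm z.
Proof. by rewrite -lecR -rnormE normc_ge_Re. Qed.

Lemma norm_Im_le z : `|complex.Im z| <= rnorm z.
Proof.
case: z => a b /=; rewrite /rnorm normc_def /=.
by rewrite -[leLHS]sqrtr_sqr ler_sqrt ?lerDr ?addr_ge0 ?sqr_ge0 // real_normK ?num_real.
Qed.

Lemma rnorm_le_ReIm z : rnorm z <= `|complex.Re z| + `|complex.Im z|.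
Proof.
case: z => a b /=; rewrite /rnorm normc_def /= -[leRHS]ger0_norm ?addr_ge0 //.
rewrite -sqrtr_sqr ler_sqrt ?sqr_ge0 // sqrrD !real_normK ?num_real //.
by have := mulr_ge0 (normr_ge0 a) (normr_ge0 b); lra.
Qed.

Lemma cauchy_seq_cvgC (u : nat -> R[i]) :
  (forall eps, 0 < eps -> exists k, forall i j, (k <= i)%N -> (k <= j)%N ->
     rnorm (u i - u j) < eps) ->
  exists v : R[i], u @ \oo --> v.
Proof.
move=> uC.
have [eps eps0|a aP] := @cauchy_seq_cvgr R (fun n => complex.Re (u n)).
  have [k kP] := uC _ eps0; exists k => i j ki kj.
  have := norm_Re_le (u i - u j); rewrite raddfB => /le_lt_trans; apply; exact: kP.
have [eps eps0|b bP] := @cauchy_seq_cvgr R (fun n => complex.Im (u n)).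
  have [k kP] := uC _ eps0; exists k => i j ki kj.
  have := norm_Im_le (u i - u j); rewrite raddfB => /le_lt_trans; apply; exact: kP.
exists (a +i* b)%C; apply/cvg_rnorm => eps eps0.
have e2 : 0 < eps / 2 by rewrite divr_gt0.
move/cvgrPdist_lt : aP => /(_ _ e2) aP; move/cvgrPdist_lt : bP => /(_ _ e2) bP.
apply: filterS2 aP bP => n an bn.
rewrite (le_lt_trans (rnorm_le_ReIm _)) // [ltRHS]splitr !raddfB /= ltrD //.
  by rewrite distrC.
by rewrite distrC.
Qed.

End ComplexNorm.

Section UnitizationNorm.
Variables (R : realType) (A : banachAlgType R).
Local Notation S := (unitization A).
Implicit Types x y : S.

(** The sum is submultiplicative on the unitization, which the maximum of the two norms need not
    be. *)
Definition unorm x : R := rnorm x.1 + rnorm x.2.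

Lemma unorm_ge0 x : 0 <= unorm x.
Proof. by rewrite addr_ge0 // rnorm_ge0. Qed.

Lemma unorm0 : unorm 0 = 0.
Proof. by rewrite /unorm !rnorm0 addr0. Qed.

Lemma unorm_eq0 x : unorm x = 0 -> x = 0.
Proof.
case: x => a s /eqP; rewrite paddr_eq0 ?rnorm_ge0 // => /andP[/eqP/rnorm_eq0/= -> /eqP/rnorm_eq0/= ->].
by [].
Qed.

Lemma unormN x : unorm (- x) = unorm x.
Proof. by rewrite /unorm !rnormN. Qed.

Lemma unormD x y : unorm (x + y) <= unorm x + unorm y.
Proof.
have h1 := rnormD x.1 y.1; have h2 := rnormD x.2 y.2.
by rewrite /unorm /=; lra.
Qed.

Lemma rnorm_bmul (a b : A) : rnorm (bmul a b) <= rnorm a * rnorm b.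
Proof. by rewrite -lecR rmorphM /= -!rnormE ler_norm_bmul. Qed.

Lemma rnormM (s t : R[i]) : rnorm (s * t) = rnorm s * rnorm t.
Proof. exact: (@rnormZ R R[i] s t). Qed.

Lemma unormM x y : unorm (x * y) <= unorm x * unorm y.
Proof.
case: x y => [a s] [b t]; rewrite /unorm /=.
have h1 := rnorm_bmul a b; have h2 := rnormZ s b; have h3 := rnormZ t a.
have h4 := rnormM s t.
have h5 := rnormD (bmul a b + s *: b) (t *: a); have h6 := rnormD (bmul a b) (s *: b).
have : rnorm (bmul a b + s *: b + t *: a) <=
    rnorm a * rnorm b + rnorm s * rnorm b + rnorm t * rnorm a.
  by move: h2 h3; rewrite -/(rnorm s) -/(rnorm t) => h2 h3; lra.
by rewrite h4; lra.
Qed.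

End UnitizationNorm.

Section MatrixNorm.
Variables (R : realType) (A : banachAlgType R).
Local Notation S := (unitization A).

Definition mnorm m n (U : 'M[S]_(m, n)) : R := \sum_i \sum_j unorm (U i j).

Lemma mnorm_ge0 m n (U : 'M[S]_(m, n)) : 0 <= mnorm U.
Proof. by apply: sumr_ge0 => i _; apply: sumr_ge0 => j _; exact: unorm_ge0. Qed.

Lemma unorm_le_mnorm m n (U : 'M[S]_(m, n)) i j : unorm (U i j) <= mnorm U.
Proof.
rewrite /mnorm (bigD1 i) //= (bigD1 j) //= -addrA lerDl addr_ge0 //.
  by apply: sumr_ge0 => k _; exact: unorm_ge0.
by apply: sumr_ge0 => k _; apply: sumr_ge0 => l _; exact: unorm_ge0.
Qed.

Lemma mnorm0 m n : mnorm (0 : 'M[S]_(m, n)) = 0.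
Proof.
by rewrite /mnorm big1 // => i _; rewrite big1 // => j _; rewrite mxE unorm0.
Qed.

Lemma mnorm_eq0 m n (U : 'M[S]_(m, n)) : mnorm U = 0 -> U = 0.
Proof.
move=> U0; apply/matrixP => i j; rewrite mxE; apply: unorm_eq0.
by apply/eqP; rewrite eq_le unorm_ge0 andbT -U0 unorm_le_mnorm.
Qed.

Lemma mnormN m n (U : 'M[S]_(m, n)) : mnorm (- U) = mnorm U.
Proof.
by apply: eq_bigr => i _; apply: eq_bigr => j _; rewrite mxE unormN.
Qed.

Lemma mnormD m n (U V : 'M[S]_(m, n)) : mnorm (U + V) <= mnorm U + mnorm V.
Proof.
rewrite /mnorm -big_split; apply: ler_sum => i _.
by rewrite -big_split; apply: ler_sum => j _; rewrite mxE unormD.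
Qed.

Lemma unorm_sum (I : Type) (r : seq I) (P : pred I) (F : I -> S) :
  unorm (\sum_(i <- r | P i) F i) <= \sum_(i <- r | P i) unorm (F i).
Proof.
elim/big_rec2: _ => [|i x y _ xy]; first by rewrite unorm0.
by rewrite (le_trans (unormD _ _)) // lerD2l.
Qed.

Lemma mnormM m n p (U : 'M[S]_(m, n)) (V : 'M[S]_(n, p)) :
  mnorm (U *m V) <= mnorm U * mnorm V.
Proof.
rewrite {2}/mnorm mulr_suml; apply: ler_sum => i _.
apply: (@le_trans _ _ (\sum_j \sum_k unorm (U i k) * unorm (V k j))).
  apply: ler_sum => j _; rewrite mxE (le_trans (unorm_sum _ _ _)) //.
  by apply: ler_sum => k _; exact: unormM.
rewrite exchange_big mulr_suml; apply: ler_sum => k _ /=.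
rewrite -mulr_sumr ler_wpM2l ?unorm_ge0 //.
rewrite /mnorm [leRHS](bigD1 k) //= lerDl.
by apply: sumr_ge0 => l _; apply: sumr_ge0 => j _; exact: unorm_ge0.
Qed.

Lemma cvg_mnorm T (F : set_system T) (FF : Filter F) m n
    (f : T -> 'M[S]_(m, n)) (U : 'M[S]_(m, n)) :
  f @ F --> U <-> forall eps : R, 0 < eps -> \forall t \near F, mnorm (f t - U) < eps.
Proof.
split=> [/cvg_mxE fU eps eps0|fU].
  (* The successor keeps [K] positive for empty matrices and makes the final inequality strict. *)
  pose K : R := (m * n).+1%:R.
  have eK : 0 < eps / K / 2 by rewrite !divr_gt0.
  have : \forall t \near F, forall i j, unorm (f t i j - U i j) < eps / K.
    have fij i j : \forall t \near F, unorm (f t i j - U i j) < eps / K.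
      have /cvg_unitization[/cvg_rnorm/(_ _ eK) f1 /cvg_rnorm/(_ _ eK) f2] := fU i j.
      by apply: filterS2 f1 f2 => t t1 t2; rewrite [ltRHS]splitr ltrD.
    have fall : \forall t \near F, forall ij : 'I_m * 'I_n, ij \in enum {: 'I_m * 'I_n} ->
        unorm (f t ij.1 ij.2 - U ij.1 ij.2) < eps / K.
      by apply: filter_seq => -[i j] _; exact: fij.
    by apply: filterS fall => t ft i j; apply: (ft (i, j)); rewrite mem_enum.
  apply: filterS => t tP.
  apply: (@le_lt_trans _ _ (\sum_(i < m) \sum_(j < n) eps / K)).
    by apply: ler_sum => i _; apply: ler_sum => j _; rewrite !mxE ltW.
  rewrite !sumr_const !card_ord -mulrnA -mulr_natl mulrA ltr_pdivrMr //.
  by rewrite mulrC ltr_pM2l // ltr_nat mulnC.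
apply/cvg_mxE => i j; apply/cvg_unitization.
have fij eps : 0 < eps -> \forall t \near F, unorm (f t i j - U i j) < eps.
  move=> /fU; apply: filterS => t; apply: le_lt_trans.
  by have := unorm_le_mnorm (f t - U) i j; rewrite !mxE.
by split; apply/cvg_rnorm => eps /fij; apply: filterS => t; apply: le_lt_trans;
  rewrite /unorm ?lerDl ?lerDr rnorm_ge0.
Qed.

Lemma mnorm_complete_norm n : complete_norm (@mnorm n n).
Proof.
split.
- exact: mnorm_ge0.
- exact: mnorm_eq0.
- exact: mnorm0.
- exact: mnormN.
- exact: mnormD.
- exact: mnormM.
move=> u uC.
have uij i j : exists e : S, (fun k => u k i j) @ \oo --> e.
  have [eps eps0|a aP] := @cauchy_seq_cvg R A (fun k => (u k i j).1).
    have [k kP] := uC _ eps0; exists k => i' j' ki kj.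
    apply: le_lt_trans (kP _ _ ki kj); apply: le_trans (unorm_le_mnorm _ i j).
    by rewrite !mxE /unorm lerDl rnorm_ge0.
  have [eps eps0|s sP] := @cauchy_seq_cvgC R (fun k => (u k i j).2).
    have [k kP] := uC _ eps0; exists k => i' j' ki kj.
    apply: le_lt_trans (kP _ _ ki kj); apply: le_trans (unorm_le_mnorm _ i j).
    by rewrite !mxE /unorm lerDr rnorm_ge0.
  by exists (a, s); apply/cvg_unitization.
pose e : 'M[S]_n := \matrix_(i, j) sval (cid (uij i j)).
exists e => eps eps0.
have /cvg_mnorm/(_ _ eps0)[k _ kP] : u @ \oo --> e.
  by apply/cvg_mxE => i j; rewrite mxE; exact: svalP (cid (uij i j)).
by exists k => i ki; apply: kP.
Qed.

End MatrixNorm.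

(** The points where [P] holds and those where it fails form two relatively open sets, and [0, 1] is
    connected. *)
Lemma segment_ind (R : realType) (P : R -> Prop) :
  (forall t, 0 <= t <= 1 -> exists d, 0 < d /\
     forall s, 0 <= s <= 1 -> `|s - t| < d -> P s <-> P t) -> P 0 -> P 1.
Proof.
move=> Ploc P0.
pose O (Q : R -> Prop) : set R := \bigcup_(i in [set td : R * R | 0 <= td.1 <= 1 /\
  Q td.1 /\ forall s, 0 <= s <= 1 -> `|s - td.1| < td.2 -> P s <-> P td.1])
  ball i.1 i.2.
have Oo Q : open (O Q) by apply: bigcup_open => i _; exact: ball_open.
have OP Q t : 0 <= t <= 1 -> Q t -> O Q t.
  move=> t01 Qt; have [d [d0 dP]] := Ploc _ t01.
  by exists (t, d) => //=; exact: ballxx.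
have OQ t : 0 <= t <= 1 -> O P t -> P t.
  move=> t01 [[s d] /= [s01 [Ps sP]]]; rewrite -ball_normE /ball_ /= distrC => sd.
  exact/(sP _ t01 sd).
have OQ' t : 0 <= t <= 1 -> O (fun t => ~ P t) t -> ~ P t.
  move=> t01 [[s d] /= [s01 [Ps sP]]]; rewrite -ball_normE /ball_ /= distrC => sd.
  by move=> Pt; apply: Ps; exact/(sP _ t01 sd).
have : [set t : R | 0 <= t <= 1 /\ P t] = `[0, 1]%classic.
  apply: segment_connected.
  - by exists 0; rewrite /= lexx ler01.
  - exists (O P) => //; apply/seteqP; split=> t /=; rewrite in_itv /=.
      by move=> [t01 Pt]; split=> //; exact: OP.
    by move=> [t01 Ot]; split=> //; exact: OQ.
  - exists (~` O (fun t => ~ P t)); first exact: open_closedC.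
    apply/seteqP; split=> t /=; rewrite in_itv /=.
      by move=> [t01 Pt]; split=> // /(OQ' _ t01).
    move=> [t01 Ot]; split=> //; apply: contrapT => Pt.
    exact/Ot/OP.
move=> /seteqP[_ /(_ 1)] /=; rewrite in_itv /= lexx ler01.
by move=> /(_ isT)[].
Qed.

(** * Segments of matrices and openness of the general linear group *)

Section MatrixSegment.
Variables (R : realType) (A : banachAlgType R).
Local Notation S := (unitization A).

(** Matrices over the unitization are scaled by its elements, so a real number enters as a multiple
    of the adjoined unit. *)
Definition uscal (t : R) : S := (0, t%:C%C).

Lemma bmul0x (y : A) : bmul 0 y = 0.
Proof. by rewrite -(scale0r (0 : A)) bmulZl !scale0r. Qed.

Lemma uscalE (t : R) (x : S) : uscal t * x = (t%:C%C *: x.1, t%:C%C * x.2).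
Proof.
by case: x => a s; congr (_, _); rewrite /= bmul0x scaler0 add0r addr0.
Qed.

Lemma uscalN1 (x : S) : uscal (-1) * x = - x.
Proof. by rewrite uscalE rmorphN rmorph1 scaleN1r mulN1r; case: x. Qed.

Lemma rnorm_real (t : R) : rnorm (t%:C%C : R[i]) = `|t|.
Proof.
by rewrite /rnorm normc_def /= expr0n /= addr0 sqrtr_sqr.
Qed.

Lemma unorm_scal t x : unorm (uscal t * x) = `|t| * unorm x.
Proof.
by rewrite uscalE /unorm /= rnormZ rnormM -/(rnorm _) rnorm_real mulrDr.
Qed.

Definition mseg m n (U V : 'M[S]_(m, n)) (t : R) : 'M[S]_(m, n) :=
  U + uscal t *: (V - U).

Lemma mnorm_scal m n t (U : 'M[S]_(m, n)) : mnorm (uscal t *: U) = `|t| * mnorm U.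
Proof.
rewrite /mnorm mulr_sumr; apply: eq_bigr => i _.
by rewrite mulr_sumr; apply: eq_bigr => j _; rewrite mxE unorm_scal.
Qed.

Lemma uscalB s t : uscal (s - t) = uscal s - uscal t.
Proof. by rewrite /uscal rmorphB; congr (_, _); rewrite subr0. Qed.

Lemma mseg0 m n (U V : 'M[S]_(m, n)) : mseg U V 0 = U.
Proof. by rewrite /mseg (_ : uscal 0 = 0) // scale0r addr0. Qed.

Lemma mseg1 m n (U V : 'M[S]_(m, n)) : mseg U V 1 = V.
Proof. by rewrite /mseg (_ : uscal 1 = 1) // scale1r addrC subrK. Qed.

Lemma mseg_near m n (U V W : 'M[S]_(m, n)) eps t : 0 <= t <= 1 ->
  mnorm (U - W) < eps -> mnorm (V - W) < eps -> mnorm (mseg U V t - W) < eps.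
Proof.
move=> /andP[t0 t1] UW VW.
have -> : mseg U V t - W = uscal (1 - t) *: (U - W) + uscal t *: (V - W).
  rewrite uscalB scalerBl (_ : uscal 1 = 1) // scale1r /mseg.
  rewrite !scalerBr !opprB !addrA.
  by rewrite [RHS](ACl ((3*6)*1*5*4*2))/= subrr add0r.
rewrite (le_lt_trans (mnormD _ _)) // !mnorm_scal !ger0_norm ?subr_ge0 //.
have [->|tn0] := eqVneq t 0; first by rewrite subr0 mul1r mul0r addr0.
have tp : 0 < t by rewrite lt_def tn0.
have : t * mnorm (V - W) < t * eps by rewrite ltr_pM2l.
have : (1 - t) * mnorm (U - W) <= (1 - t) * eps by rewrite ler_wpM2l ?subr_ge0 // ltW.
lra.
Qed.

Lemma mseg_lip m n (U V : 'M[S]_(m, n)) s t :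
  mnorm (mseg U V s - mseg U V t) = `|s - t| * mnorm (V - U).
Proof.
by rewrite /mseg opprD addrACA subrr add0r -scalerBl -uscalB mnorm_scal.
Qed.

Lemma mseg_continuous_at m n (U V : 'M[S]_(m, n)) t eps : 0 < eps ->
  exists d, 0 < d /\ forall s, `|s - t| < d -> mnorm (mseg U V s - mseg U V t) < eps.
Proof.
move=> eps0; have K0 : 0 < mnorm (V - U) + 1 by rewrite ltr_wpDl ?mnorm_ge0.
exists (eps / (mnorm (V - U) + 1)); split=> [|s]; first by rewrite divr_gt0.
rewrite ltr_pdivlMr // mseg_lip; apply: le_lt_trans.
by rewrite ler_wpM2l // lerDl.
Qed.

Lemma mseg_continuous m n (U V : 'M[S]_(m, n)) (D : set R) :
  {within D, continuous (mseg U V)}.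
Proof.
apply: continuous_subspaceT => t; apply/cvg_mnorm => eps eps0.
have [d [d0 dP]] := mseg_continuous_at U V t eps0.
near=> s; apply: dP; near: s.
by have /cvgrPdist_lt/(_ _ d0) : id @ t --> t by []; apply: filterS => s; rewrite distrC.
Unshelve. all: by end_near. Qed.

Lemma path_continuous_at n (g : R -> 'M[S]_n) t eps :
  {within `[0, 1], continuous g} -> 0 <= t <= 1 -> 0 < eps ->
  exists d, 0 < d /\ forall s, 0 <= s <= 1 -> `|s - t| < d ->
    mnorm (g s - g t) < eps.
Proof.
move=> /subspace_continuousP gc t01 eps0.
have t01' : `[0, 1]%classic t by rewrite /= in_itv.
have /cvg_mnorm/(_ _ eps0) := gc t t01'.
rewrite /within /= => /nbhs_ballP[d d0 dP]; exists d; split=> // s s01 st.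
apply: dP; last by rewrite in_itv.
by rewrite -ball_normE /ball_ /= distrC.
Qed.

Lemma map_mseg m n (U V : 'M[S]_(m, n)) (B : 'M[R[i]]_(m, n)) t :
  map_mx (@scalar_part R A) U = B -> map_mx (@scalar_part R A) V = B ->
  map_mx (@scalar_part R A) (mseg U V t) = B.
Proof. by move=> UB VB; rewrite /mseg map_mxD map_mxZ map_mxB UB VB subrr scaler0 addr0. Qed.

(** [d = g *m (1 - h *m (g - d))], and the second factor is invertible by Neumann's series once [d]
    is close to [g]. *)
Lemma gl_open n (g h : 'M[S]_n) : g *m h = 1%:M -> h *m g = 1%:M ->
  exists eps, 0 < eps /\ forall d, mnorm (d - g) < eps ->
    exists k, d *m k = 1%:M /\ k *m d = 1%:M.
Proof.
move=> gh hg; have K0 : 0 < mnorm h + 1 by rewrite ltr_wpDl ?mnorm_ge0.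
exists (mnorm h + 1)^-1; rewrite invr_gt0; split=> // d dg.
have [|v [xv vx]] := @neumann R _ _ (mnorm_complete_norm A n) (h *m (g - d)).
  rewrite (le_lt_trans (mnormM _ _)) //.
  rewrite -opprB mnormN -[ltRHS](mulfV (lt0r_neq0 K0)).
  rewrite (le_lt_trans (ler_wpM2l (mnorm_ge0 h) (ltW dg))) //.
  by rewrite ltr_pM2r ?invr_gt0 // ltrDl.
have dE : d = g *m (1 - h *m (g - d)).
  by rewrite mulmxBr mulmx1 mulmxA gh mul1mx subKr.
exists (v *m h); split.
  by rewrite dE -mulmxA (mulmxA _ v) [_ *m v]xv mul1mx.
transitivity (v *m h *m (g *m (1 - h *m (g - d)))); first by rewrite -dE.
by rewrite -mulmxA (mulmxA h) hg mul1mx [v *m _]vx.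
Qed.

Lemma mseg_homotopic n (g h : 'M[S]_n) :
  (forall t, 0 <= t <= 1 -> in_gl (mseg g h t)) -> homotopic g h.
Proof.
move=> ghP; exists (mseg g h); split=> //; [exact: mseg_continuous|exact: mseg0|
  exact: mseg1].
Qed.

End MatrixSegment.

(** * Pairs of algebras with a common dense subalgebra *)

Section PairedAlgebras.
Variables (R : realType) (A A' : banachAlgType R) (Q : A -> A' -> Prop).
Local Notation S := (unitization A).
Local Notation S' := (unitization A').

Definition upair (x : S) (x' : S') : Prop := Q x.1 x'.1 /\ x.2 = x'.2.

Definition mpair m n (U : 'M[S]_(m, n)) (U' : 'M[S']_(m, n)) : Prop :=
  forall i j, upair (U i j) (U' i j).

Record subalgebra_pair : Prop := SubalgebraPair {
  pair0 : Q 0 0 ;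
  pairD : forall x y x' y', Q x x' -> Q y y' -> Q (x + y) (x' + y') ;
  pairZ : forall (a : R[i]) x x', Q x x' -> Q (a *: x) (a *: x') ;
  pairM : forall x y x' y', Q x x' -> Q y y' -> Q (bmul x y) (bmul x' y')
}.

Hypothesis sQ : subalgebra_pair.

Lemma upair0 : upair 0 0.
Proof. by split=> //; exact: (pair0 sQ). Qed.

Lemma upair1 : upair 1 1.
Proof. by split=> //; exact: (pair0 sQ). Qed.

Lemma upairD x y x' y' : upair x x' -> upair y y' -> upair (x + y) (x' + y').
Proof.
by move=> [xx' sx] [yy' sy]; split; [exact: (pairD sQ)|rewrite /= sx sy].
Qed.

Lemma upairM x y x' y' : upair x x' -> upair y y' -> upair (x * y) (x' * y').
Proof.
case: x y x' y' => [a s] [b t] [a' s'] [b' t'] [/= aa' ->] [/= bb' ->].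
split=> //=; apply: (pairD sQ); last exact: (pairZ sQ).
by apply: (pairD sQ); [exact: (pairM sQ)|exact: (pairZ sQ)].
Qed.

Lemma upair_scal t : upair (uscal A t) (uscal A' t).
Proof. by split=> //; exact: (pair0 sQ). Qed.

Lemma upairN x x' : upair x x' -> upair (- x) (- x').
Proof.
by move=> xx'; rewrite -!uscalN1; apply: upairM => //; exact: upair_scal.
Qed.

Lemma mpair0 m n : mpair (0 : 'M[S]_(m, n)) 0.
Proof. by move=> i j; rewrite !mxE; exact: upair0. Qed.

Lemma mpair1 n : mpair (1%:M : 'M[S]_n) 1%:M.
Proof. by move=> i j; rewrite !mxE; case: eqP => _; [exact: upair1|exact: upair0]. Qed.

Lemma mpairD m n (U V : 'M[S]_(m, n)) U' V' :
  mpair U U' -> mpair V V' -> mpair (U + V) (U' + V').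
Proof. by move=> UU' VV' i j; rewrite !mxE; exact: upairD. Qed.

Lemma mpairN m n (U : 'M[S]_(m, n)) U' : mpair U U' -> mpair (- U) (- U').
Proof. by move=> UU' i j; rewrite !mxE; exact: upairN. Qed.

Lemma mpairB m n (U V : 'M[S]_(m, n)) U' V' :
  mpair U U' -> mpair V V' -> mpair (U - V) (U' - V').
Proof. by move=> UU' VV'; apply: mpairD => //; exact: mpairN. Qed.

Lemma mpair_scal m n t (U : 'M[S]_(m, n)) U' :
  mpair U U' -> mpair (uscal A t *: U) (uscal A' t *: U').
Proof. by move=> UU' i j; rewrite !mxE; apply: upairM => //; exact: upair_scal. Qed.

Lemma mpair_seg m n (U V : 'M[S]_(m, n)) U' V' t :
  mpair U U' -> mpair V V' -> mpair (mseg U V t) (mseg U' V' t).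
Proof.
by move=> UU' VV'; apply: mpairD => //; apply: mpair_scal; exact: mpairB.
Qed.

Lemma mpairM m n p (U : 'M[S]_(m, n)) (V : 'M[S]_(n, p)) U' V' :
  mpair U U' -> mpair V V' -> mpair (U *m V) (U' *m V').
Proof.
move=> UU' VV' i j; rewrite !mxE.
elim/big_rec2: _ => [|k x x' _ xx']; first exact: upair0.
by apply: upairD => //; exact: upairM.
Qed.

Lemma mpairMn m n (U : 'M[S]_(m, n)) U' k : mpair U U' -> mpair (U *+ k) (U' *+ k).
Proof.
move=> UU'; elim: k => [|k IHk]; first by rewrite !mulr0n; exact: mpair0.
by rewrite !mulrS; exact: mpairD.
Qed.

Lemma mpair_block m n p q (U1 : 'M[S]_(m, n)) (U2 : 'M[S]_(m, q)) (U3 : 'M[S]_(p, n))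
    (U4 : 'M[S]_(p, q)) U1' U2' U3' U4' :
  mpair U1 U1' -> mpair U2 U2' -> mpair U3 U3' -> mpair U4 U4' ->
  mpair (block_mx U1 U2 U3 U4) (block_mx U1' U2' U3' U4').
Proof.
move=> h1 h2 h3 h4 i j.
by case: (split_ordP i) => i' ->; case: (split_ordP j) => j' ->;
  rewrite ?block_mxEul ?block_mxEur ?block_mxEdl ?block_mxEdr.
Qed.

Lemma mpair_pad n N (U : 'M[S]_n) U' : mpair U U' -> mpair (pad N U) (pad N U').
Proof.
move=> UU' i j; rewrite !mxE; case: insub => [i'|]; last first.
  by case: eqP => _; [exact: upair1|exact: upair0].
case: insub => [j'|]; first exact: UU'.
by case: eqP => _; [exact: upair1|exact: upair0].
Qed.

Lemma mpair_newton n (U : 'M[S]_n) U' k : mpair U U' ->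
  mpair (iter k (@newton _) U) (iter k (@newton _) U').
Proof.
move=> UU'; elim: k => //= k IHk.
apply: mpairB => //; apply: mpairM; first by apply: mpairB; [exact: mpairMn|exact: mpair1].
by apply: mpairB => //; exact: mpairM.
Qed.

Lemma mpair_defect n (U : 'M[S]_n) U' : mpair U U' -> mpair (defect U) (defect U').
Proof. by move=> UU'; apply: mpairB => //; exact: mpairM. Qed.

Lemma mpair_scalar m n (U : 'M[S]_(m, n)) U' : mpair U U' ->
  map_mx (@scalar_part R A) U = map_mx (@scalar_part R A') U'.
Proof. by move=> UU'; apply/matrixP => i j; rewrite !mxE; have [] := UU' i j. Qed.

(** The second field is a usable form of the inequality between spectral radii. Both fields are
    one-sided; the other direction is the same statement for the flipped relation. *)
Record spectral_pair : Prop := SpectralPair {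
  pair_dense : forall (a : A) eps, 0 < eps -> exists b b', Q b b' /\ rnorm (b - a) < eps ;
  pair_spectral : forall n (U : 'M[S]_n) (U' : 'M[S']_n), mpair U U' ->
    forall rho, 0 < rho -> mnorm U < rho ->
    exists m, (0 < m)%N /\ mnorm (U' ^+ m) <= rho ^+ m
}.

Hypothesis spQ : spectral_pair.

Lemma mpair_dense m n (U : 'M[S]_(m, n)) eps : 0 < eps -> exists V V',
  [/\ mpair V V', map_mx (@scalar_part R A) V = map_mx (@scalar_part R A) U &
      mnorm (V - U) < eps].
Proof.
move=> eps0; pose K : R := (m * n).+1%:R.
have eK : 0 < eps / K by rewrite divr_gt0.
pose P i j := pair_dense spQ (U i j).1 eK.
pose b i j := sval (cid (P i j)); pose b' i j := sval (cid (svalP (cid (P i j)))).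
have bP i j : Q (b i j) (b' i j) /\ rnorm (b i j - (U i j).1) < eps / K.
  exact: svalP (cid (svalP (cid (P i j)))).
exists (\matrix_(i, j) (b i j, (U i j).2)), (\matrix_(i, j) (b' i j, (U i j).2)).
split.
- by move=> i j; rewrite !mxE; split=> //=; have [] := bP i j.
- by apply/matrixP => i j; rewrite !mxE.
apply: (@le_lt_trans _ _ (\sum_(i < m) \sum_(j < n) eps / K)).
  apply: ler_sum => i _; apply: ler_sum => j _; rewrite !mxE /unorm /= subrr.
  by rewrite rnorm0 addr0 ltW //; have [] := bP i j.
rewrite !sumr_const !card_ord -mulrnA -mulr_natl mulrA ltr_pdivrMr //.
by rewrite mulrC ltr_pM2l // ltr_nat mulnC.
Qed.

(** The inverse [h] is approximated by some [V] over [Q], so [1 - U *m V] and [1 - V *m U] have norm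
    below 1/2. Some power of each partner then has norm below 1, so [U' *m V'] and [V' *m U'] are
    invertible, and [U'] has inverses on both sides. *)
Lemma mpair_invertible n (U : 'M[S]_n) U' : mpair U U' ->
  (exists h, U *m h = 1%:M /\ h *m U = 1%:M) ->
  exists h, U' *m h = 1%:M /\ h *m U' = 1%:M.
Proof.
move=> UU' [h [Uh hU]].
have e0 : 0 < 2^-1 / (mnorm U + 1) by rewrite divr_gt0 ?invr_gt0 // ltr_wpDl ?mnorm_ge0.
have [V [V' [VV' _]]] := mpair_dense h e0.
rewrite ltr_pdivlMr ?ltr_wpDl ?mnorm_ge0 // => Vh.
have small (W : 'M[S]_n) : mnorm W <= mnorm U * mnorm (V - h) -> mnorm W < 2^-1.
  move=> /le_lt_trans; apply; apply: le_lt_trans Vh.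
  by rewrite mulrC ler_wpM2l ?mnorm_ge0 // lerDl.
have inv k (W : 'M[S]_k) (W' : 'M[S']_k) : mpair W W' -> mnorm (1 - W) < 2^-1 ->
    exists l, W' *m l = 1%:M /\ l *m W' = 1%:M.
  move=> WW' W2; have WW1 := mpairB (@mpair1 k) WW'.
  have [|m [m0 mP]] := pair_spectral spQ WW1 _ W2; first by rewrite invr_gt0.
  have [|l [h1 h2]] := @spectral_neumann R _ _ (mnorm_complete_norm A' k) (1 - W') m.
    by apply: (le_lt_trans mP); rewrite exprn_ilt1 ?invr_ge0 -?lt0n // invf_lt1 // ltr1n.
  by rewrite subKr in h1 h2; exists l.
have [k [k1 k2]] : exists k, (U' *m V') *m k = 1%:M /\ k *m (U' *m V') = 1%:M.
  apply: (inv n (U *m V)); first exact: mpairM.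
  apply: small; have -> : 1 - U *m V = U *m (h - V) by rewrite mulmxBr Uh.
  by rewrite (le_trans (mnormM _ _)) // -opprB mnormN.
have [l [l1 l2]] : exists k, (V' *m U') *m k = 1%:M /\ k *m (V' *m U') = 1%:M.
  apply: (inv n (V *m U)); first exact: mpairM.
  apply: small; have -> : 1 - V *m U = (h - V) *m U by rewrite mulmxBl hU.
  by rewrite mulrC (le_trans (mnormM _ _)) // -opprB mnormN.
exists (V' *m k); rewrite mulmxA; split=> //.
have -> : V' *m k = l *m V'.
  by rewrite -[V' *m k]mul1mx -l2 -!mulmxA (mulmxA U') k1 mulmx1.
by rewrite -mulmxA.
Qed.

Lemma mpair_in_gl n (U : 'M[S]_n) U' : mpair U U' -> in_gl U -> in_gl U'.
Proof.
move=> UU' [U1 /(mpair_invertible UU') U'h]; split=> //.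
by rewrite -(mpair_scalar UU').
Qed.

(** The segment from [U] to [V] stays in a ball of invertible matrices; its partner is the segment
    from [U'] to [V'], which [mpair_in_gl] keeps in GL. *)
Lemma mpair_homotopic_ball n (g : 'M[S]_n) : in_gl g -> exists r, 0 < r /\
  forall U U' V V', mpair U U' -> mpair V V' ->
    map_mx (@scalar_part R A) U = 1%:M -> map_mx (@scalar_part R A) V = 1%:M ->
    mnorm (U - g) < r -> mnorm (V - g) < r -> homotopic U' V'.
Proof.
move=> [g1 [h [gh hg]]]; have [r [r0 rP]] := gl_open gh hg.
exists r; split=> // U U' V V' UU' VV' U1 V1 Ug Vg.
apply: mseg_homotopic => t t01; apply: (mpair_in_gl (mpair_seg t UU' VV')).
by split; [exact: map_mseg|exact/rP/mseg_near].
Qed.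

(* The path need not lie over [Q]; it is followed from one ball contained in the
   general linear group to the next, through segments over [Q]. *)
Lemma mpair_homotopic n (g h : 'M[S]_n) g' h' :
  mpair g g' -> mpair h h' -> homotopic g h -> homotopic g' h'.
Proof.
move=> gg' hh' gh; have [[g1 _] [h1 _]] := homotopic_gl gh.
have [c [cc c0 c1 cP]] := gh.
(* This property of [t] is locally constant, because any two matrices over [Q] near the same point
   of the path have homotopic partners. *)
pose good t := exists eps, 0 < eps /\ forall U U', mpair U U' ->
  map_mx (@scalar_part R A) U = 1%:M -> mnorm (U - c t) < eps -> homotopic g' U'.
have : good 1.
  apply: (@segment_ind R good) => [t t01|]; last first.
    have [|r [r0 rP]] := @mpair_homotopic_ball _ (c 0).
      by apply: cP; rewrite lexx ler01.
    exists r; split=> // U U' UU' U1 Ug.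
    by apply: rP gg' UU' g1 U1 _ Ug; rewrite c0 subrr mnorm0.
  have [r [r0 rP]] := mpair_homotopic_ball (cP _ t01).
  have r2 : 0 < r / 2 by rewrite divr_gt0.
  have [d [d0 dP]] := path_continuous_at cc t01 r2.
  exists d; split=> // s s01 /(dP _ s01) st.
  have near_t U : mnorm (U - c s) < r / 2 -> mnorm (U - c t) < r.
    move=> Us; rewrite -(subrKA (c s)) (le_lt_trans (mnormD _ _)) //.
    by rewrite [ltRHS]splitr ltrD.
  have c1t u : 0 <= u <= 1 -> map_mx (@scalar_part R A) (c u) = 1%:M.
    by move=> /cP[].
  split=> -[eps [eps0 epsP]].
    have e0 : 0 < Num.min eps (r / 2) by rewrite lt_min eps0.
    have [V [V' [VV' V1]]] := mpair_dense (c s) e0.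
    rewrite lt_min c1t // in V1 * => /andP[Veps /near_t Vr].
    exists r; split=> // U U' UU' U1 Ur.
    apply: homotopic_trans (epsP _ _ VV' V1 Veps) _.
    exact: rP VV' UU' V1 U1 Vr Ur.
  have e0 : 0 < Num.min eps r by rewrite lt_min eps0.
  have [V [V' [VV' V1]]] := mpair_dense (c t) e0.
  rewrite lt_min c1t // in V1 * => /andP[Veps Vr].
  exists (r / 2); split=> // U U' UU' U1 /near_t Ur.
  apply: homotopic_trans (epsP _ _ VV' V1 Veps) _.
  exact: rP VV' UU' V1 U1 Vr Ur.
move=> [eps [eps0 epsP]]; apply: (epsP _ _ hh' h1).
by rewrite c1 subrr mnorm0.
Qed.

Definition K1_rel (x : K1 A) (x' : K1 A') : Prop :=
  exists n (g : 'M[S]_n) (g' : 'M[S']_n) (gP : in_gl g) (g'P : in_gl g'),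
    [/\ mpair g g', x = K1_class (GLmk gP) & x' = K1_class (GLmk g'P)].

(** A short segment with constant scalar part leads from the given matrix to one over [Q], without
    leaving GL. *)
Lemma K1_rel_total x : exists x', K1_rel x x'.
Proof.
elim/K1W: x => g.
have [g1 [h [gh hg]]] := gl_mxP g; have [r [r0 rP]] := gl_open gh hg.
have [U [U' [UU' U1 Ur]]] := mpair_dense (gl_mx g) r0.
have gU t : 0 <= t <= 1 -> in_gl (mseg (gl_mx g) U t).
  move=> t01; split; first by apply: map_mseg; rewrite // U1.
  by apply/rP/mseg_near => //; rewrite subrr mnorm0.
have UP : in_gl U by have := gU 1; rewrite mseg1; apply; rewrite ler01 lexx.
have U'P := mpair_in_gl UU' UP.
exists (K1_class (GLmk U'P)), (gl_dim g), U, U', UP, U'P; split=> //.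
apply/K1_classP; exists (gl_dim g); split=> //.
by rewrite !pad_id; exact: mseg_homotopic.
Qed.

Lemma K1_rel_functional x x' y' : K1_rel x x' -> K1_rel x y' -> x' = y'.
Proof.
move=> [n [g [g' [gP [g'P [gg' -> ->]]]]]] [m [h [h' [hP [h'P [hh' + ->]]]]]].
move=> /K1_classP[N [gN hN gh]]; apply/K1_classP; exists N; split=> //.
by apply: mpair_homotopic gh; exact: mpair_pad.
Qed.

Lemma K1_relM x y x' y' : K1_rel x x' -> K1_rel y y' ->
  K1_rel (K1_mul x y) (K1_mul x' y').
Proof.
move=> [n [g [g' [gP [g'P [gg' -> ->]]]]]] [m [h [h' [hP [h'P [hh' -> ->]]]]]].
rewrite !K1_mulE.
exists _, _, _, (gl_mul_proof (GLmk gP) (GLmk hP)),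
  (gl_mul_proof (GLmk g'P) (GLmk h'P)).
by split=> //; apply: mpairM; exact: mpair_pad.
Qed.

End PairedAlgebras.

(** * Newton limits under conjugation and block sums; elementary matrices *)

Section NewtonLimits.
Variables (R : realType) (A : banachAlgType R).
Local Notation S := (unitization A).

Definition nlim n (a e : 'M[S]_n) : Prop :=
  ncvg (@mnorm R A n n) (fun k => iter k (@newton _) a) e.

Lemma sim_mvn n (e f : 'M[S]_n) (eP : e *m e == e) (fP : f *m f == f) :
  sim e f -> mvn (Idem eP) (Idem fP).
Proof.
move=> [z [w [zw wz zef]]]; exists (e *m w), (z *m e); rewrite /idem_mx /=.
have ee : e *m e = e by exact/eqP.
split; first by rewrite mulmxA -(mulmxA e) [w *m z]wz mulmx1.
by rewrite mulmxA -(mulmxA z) ee [z *m e]zef -mulmxA [z *m w]zw mulmx1.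
Qed.

Lemma newton_idem n (e : 'M[S]_n) : e *m e = e -> newton e = e.
Proof. by move=> ee; rewrite /newton [e * e]ee subrr mulr0 subr0. Qed.

Lemma nlim_idem n (e : 'M[S]_n) : e *m e = e -> nlim e e.
Proof.
move=> ee eps eps0; exists 0%N => i _.
have -> : iter i (@newton _) e = e by elim: i => //= i ->; exact: newton_idem.
by rewrite subrr mnorm0.
Qed.

Lemma nlim_iter n (a e : 'M[S]_n) k : nlim a e -> nlim (iter k (@newton _) a) e.
Proof.
move=> ae eps /ae[l lP]; exists l => i li.
by rewrite iter_newton_iter; apply: lP; rewrite (leq_trans li) // leq_addr.
Qed.

(** Newton's cubic commutes with conjugation, and conjugation is continuous. *)
Lemma nlim_conj n (T Ti a e : 'M[S]_n) : Ti *m T = 1%:M -> nlim a e ->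
  nlim (T *m a *m Ti) (T *m e *m Ti).
Proof.
move=> TiT ae eps eps0.
have conjM x y : T *m x *m Ti *m (T *m y *m Ti) = T *m (x *m y) *m Ti.
  by rewrite -!mulmxA (mulmxA Ti) TiT mul1mx.
have newtonJ x : newton (T *m x *m Ti) = T *m newton x *m Ti.
  have nE (y : 'M[S]_n) : newton y = y - ((y *m (y *m y - y)) *+ 2 - (y *m y - y)).
    by rewrite /newton mulrBl mul1r mulrnAl.
  rewrite !nE conjM -mulmxBl -mulmxBr conjM.
  move: (x *m (x *m x - x)) (x *m x - x) => v w.
  by rewrite !mulr2n mulmxBr mulmxBl mulmxBr mulmxBl mulmxDr mulmxDl.
have iterJ k : iter k (@newton _) (T *m a *m Ti) = T *m iter k (@newton _) a *m Ti.
  by elim: k => //= k ->.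
have K0 : 0 < mnorm T * mnorm Ti + 1 by rewrite ltr_wpDl // mulr_ge0 ?mnorm_ge0.
have [k kP] := ae _ (divr_gt0 eps0 K0); exists k => i /kP.
rewrite ltr_pdivlMr // iterJ -mulmxBl -mulmxBr; apply: le_lt_trans.
rewrite (le_trans (mnormM _ _)) // (le_trans (ler_wpM2r (mnorm_ge0 _) (mnormM _ _))) //.
rewrite mulrAC -mulrA mulrC [leLHS]mulrC mulrA mulrC.
by have := mnorm_ge0 (iter i (@newton _) a - e); nra.
Qed.

Lemma conj_idem n (T Ti e : 'M[S]_n) : Ti *m T = 1%:M -> e *m e = e ->
  (T *m e *m Ti) *m (T *m e *m Ti) = T *m e *m Ti.
Proof. by move=> TiT ee; rewrite -!mulmxA (mulmxA Ti) TiT mul1mx (mulmxA e) ee. Qed.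

Lemma sim_conj n (T Ti e : 'M[S]_n) : T *m Ti = 1%:M -> Ti *m T = 1%:M ->
  sim e (T *m e *m Ti).
Proof.
move=> TTi TiT; exists T, Ti; split=> //.
by apply: esym; rewrite -[LHS]mulmxA [Ti *m T]TiT mulmx1.
Qed.

Lemma newton_block n m (a : 'M[S]_n) (b : 'M[S]_m) :
  newton (block_mx a 0 0 b : 'M[S]_(n + m)) = block_mx (newton a) 0 0 (newton b).
Proof.
have bM (x y : 'M[S]_n) (z w : 'M[S]_m) :
    (block_mx x 0 0 z : 'M[S]_(n + m)) * block_mx y 0 0 w =
    block_mx (x * y) 0 0 (z * w).
  by rewrite [LHS]mulmx_block !(mulmx0, mul0mx, addr0, add0r).
have bB (x y : 'M[S]_n) (z w : 'M[S]_m) :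
    (block_mx x 0 0 z : 'M[S]_(n + m)) - block_mx y 0 0 w =
    block_mx (x - y) 0 0 (z - w).
  by rewrite opp_block_mx add_block_mx !oppr0 !addr0.
have b1 : 1 = block_mx 1 0 0 1 :> 'M[S]_(n + m) by exact: scalar_mx_block.
rewrite /newton bM bB b1 mulr2n add_block_mx !addr0 bB bM bB.
by rewrite -!mulr2n.
Qed.

Lemma mnorm_block n m (a : 'M[S]_n) (b : 'M[S]_m) :
  mnorm (block_mx a 0 0 b : 'M[S]_(n + m)) = mnorm a + mnorm b.
Proof.
rewrite /mnorm big_split_ord /=; congr (_ + _); apply: eq_bigr => i _;
  rewrite big_split_ord /=.
  rewrite [X in _ + X]big1 ?addr0; last by move=> j _; rewrite block_mxEur mxE unorm0.
  by apply: eq_bigr => j _; rewrite block_mxEul.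
rewrite [X in X + _]big1 ?add0r; last by move=> j _; rewrite block_mxEdl mxE unorm0.
by apply: eq_bigr => j _; rewrite block_mxEdr.
Qed.

Lemma nlim_block n m (a e : 'M[S]_n) (b f : 'M[S]_m) : nlim a e -> nlim b f ->
  nlim (block_mx a 0 0 b : 'M[S]_(n + m)) (block_mx e 0 0 f).
Proof.
move=> ae bf eps eps0; have e2 : 0 < eps / 2 by rewrite divr_gt0.
have [k kP] := ae _ e2; have [l lP] := bf _ e2.
exists (maxn k l) => i; rewrite geq_max => /andP[/kP ki /lP li].
have -> : iter i (@newton _) (block_mx a 0 0 b : 'M[S]_(n + m)) =
    block_mx (iter i (@newton _) a) 0 0 (iter i (@newton _) b).
  by elim: {ki li} i => //= i ->; exact: newton_block.
by rewrite opp_block_mx add_block_mx !oppr0 !addr0 mnorm_block [ltRHS]splitr ltrD.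
Qed.

Definition umx n m (x : 'M[S]_(n, m)) : 'M[S]_(n + m) := block_mx 1%:M x 0 1%:M.
Definition lmx n m (y : 'M[S]_(m, n)) : 'M[S]_(n + m) := block_mx 1%:M 0 y 1%:M.

(** For an equivalence [x *m y = e], [y *m x = f] with [e *m x = x], this is the block matrix with
    rows [1 - e], [x] and [- y], [1 - f]. As a product of elementary matrices it is invertible for
    all [x] and [y], hence also when they only approximate an equivalence. *)
Definition twist n m (x : 'M[S]_(n, m)) (y : 'M[S]_(m, n)) : 'M[S]_(n + m) :=
  umx x *m lmx (- y) *m umx x.
Definition untwist n m (x : 'M[S]_(n, m)) (y : 'M[S]_(m, n)) : 'M[S]_(n + m) :=
  umx (- x) *m lmx y *m umx (- x).

Lemma umxN n m (x : 'M[S]_(n, m)) : umx x *m umx (- x) = 1%:M.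
Proof.
by rewrite mulmx_block !(mulmx0, mul0mx, mulmx1, mul1mx, addr0, add0r) addNr
  -scalar_mx_block.
Qed.

Lemma lmxN n m (y : 'M[S]_(m, n)) : lmx (- y) *m lmx y = 1%:M.
Proof.
by rewrite mulmx_block !(mulmx0, mul0mx, mulmx1, mul1mx, addr0, add0r) addNr
  -scalar_mx_block.
Qed.

Lemma twistK n m (x : 'M[S]_(n, m)) (y : 'M[S]_(m, n)) :
  twist x y *m untwist x y = 1%:M.
Proof.
rewrite /twist /untwist -!mulmxA (mulmxA (umx x) (umx (- x))) umxN mul1mx.
by rewrite (mulmxA (lmx (- y))) lmxN mul1mx umxN.
Qed.

Lemma untwistK n m (x : 'M[S]_(n, m)) (y : 'M[S]_(m, n)) :
  untwist x y *m twist x y = 1%:M.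
Proof.
rewrite /twist /untwist -!mulmxA (mulmxA (umx (- x)) (umx x)).
have umxV : umx (- x) *m umx x = 1%:M by have := umxN (- x); rewrite opprK.
have lmxV : lmx y *m lmx (- y) = 1%:M by have := lmxN (- y); rewrite opprK.
by rewrite umxV mul1mx (mulmxA (lmx y)) lmxV mul1mx umxV.
Qed.

(** Equivalent idempotents become similar after a block enlargement. *)
Lemma twist_idem n m (e : 'M[S]_n) (f : 'M[S]_m) (x : 'M[S]_(n, m))
    (y : 'M[S]_(m, n)) :
  x *m y = e -> y *m x = f -> e *m x = x -> f *m y = y -> y *m e = y -> f *m f = f ->
  twist x y *m block_mx e 0 0 0 *m untwist x y = block_mx 0 0 0 f.
Proof.
move=> xy yx ex fy ye ff.
have -> : twist x y *m block_mx e 0 0 0 = block_mx 0 0 0 f *m twist x y.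
  have -> : twist x y = block_mx (1%:M - e) x (- y) (1%:M - f).
    rewrite /twist !mulmx_block !(mulmx0, mul0mx, mulmx1, mul1mx, addr0, add0r).
    by rewrite mulmxN mulNmx xy yx mulmxBl mul1mx ex subrr add0r [- f + _]addrC.
  rewrite !mulmx_block !(mulmx0, mul0mx, mulmx1, mul1mx, addr0, add0r).
  rewrite mulmxBl mul1mx mulmxBr mulmx1 ff subrr mulNmx mulmxN ye fy.
  suff -> : e *m e = e by rewrite subrr.
  by rewrite -{2}xy mulmxA ex xy.
by rewrite -mulmxA twistK mulmx1.
Qed.

End NewtonLimits.

Section PairedIdempotents.
Variables (R : realType) (A A' : banachAlgType R) (Q : A -> A' -> Prop).
Local Notation S := (unitization A).
Local Notation S' := (unitization A').
Hypothesis sQ : subalgebra_pair Q.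
Hypothesis spQ : spectral_pair Q.
Local Notation mpair := (mpair Q).

(** The defect of [a'] may be large, but [pair_spectral] makes one of its powers as small as
    [newton_cvg_spectral] requires. *)
Lemma mpair_newton_cvg n (a : 'M[S]_n) (a' : 'M[S']_n) : mpair a a' ->
  mnorm (defect a) < 8^-1 -> exists e', nlim a' e' /\ e' *m e' = e'.
Proof.
move=> aa' a8; have e0 : 0 < 8^-1 :> R by rewrite invr_gt0.
have [m [m0 mP]] := pair_spectral spQ (mpair_defect sQ aa') e0 a8.
exact: (newton_cvg_spectral (mnorm_complete_norm A' n) m0 mP).
Qed.

(** On the segment from [a] to [b] the defect stays below 1/8, so the iteration converges at every
    point of the partner segment. The similarity class of its limit is locally constant by
    [newton_limit_near], hence constant. *)
Lemma mpair_nlim_near n (h : 'M[S]_n) : h *m h = h -> exists r, 0 < r /\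
  forall a a' b b' e' f', mpair a a' -> mpair b b' ->
    mnorm (a - h) < r -> mnorm (b - h) < r ->
    nlim a' e' -> e' *m e' = e' -> nlim b' f' -> sim e' f'.
Proof.
move=> hh; have [r [r0 rP]] := defect_small (mnorm_complete_norm A n) hh.
have cA' := mnorm_complete_norm A' n.
exists r; split=> // a a' b b' e' f' aa' bb' ah bh a'e' ee' b'f'.
pose g t := mseg a b t; pose g' t := mseg a' b' t.
pose P t := exists E, [/\ nlim (g' t) E, E *m E = E & sim e' E].
have : P 1.
  apply: (@segment_ind R P) => [t t01|]; last first.
    by exists e'; rewrite /g' mseg0; split=> //; exact: sim_refl.
  have gt8 : mnorm (defect (g t)) < 8^-1 by apply: rP; exact: mseg_near.
  have [E [g'E EE]] := mpair_newton_cvg (mpair_seg sQ t aa' bb') gt8.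
  have [d [d0 dP]] := newton_limit_near cA' g'E EE.
  have [d' [d'0 d'P]] := mseg_continuous_at a' b' t d0.
  exists d'; split; first exact: d'0.
  move=> s s01 st; have [F [g'F FF EF]] := dP _ (d'P s st).
  split=> -[G [g'G GG e'G]].
    exists E; split; [exact: g'E|exact: EE|].
    rewrite -(ncvg_unique cA' g'F g'G) in e'G.
    exact: sim_trans e'G (sim_sym EF).
  exists F; split; [exact: g'F|exact: FF|].
  rewrite -(ncvg_unique cA' g'E g'G) in e'G.
  exact: sim_trans e'G EF.
move=> [E [+ _ e'E]]; rewrite /g' mseg1 => b'E.
by rewrite (ncvg_unique cA' b'f' b'E).
Qed.

Lemma mpair_dense_seq m n (U : 'M[S]_(m, n)) :
  exists (V : nat -> 'M[S]_(m, n)) (V' : nat -> 'M[S']_(m, n)),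
    (forall k, mpair (V k) (V' k)) /\ V @ \oo --> U.
Proof.
have k0 (k : nat) : 0 < (k.+1%:R)^-1 :> R by rewrite invr_gt0.
pose P k := mpair_dense spQ U (k0 k).
pose V k := sval (cid (P k)); pose V' k := sval (cid (svalP (cid (P k)))).
have VP k : [/\ mpair (V k) (V' k),
    map_mx (@scalar_part R A) (V k) = map_mx (@scalar_part R A) U &
    mnorm (V k - U) < k.+1%:R^-1].
  exact: svalP (cid (svalP (cid (P k)))).
exists V, V'; split=> [k|]; first by have [] := VP k.
apply/cvg_mnorm => eps eps0; near=> k; have [_ _] := VP k.
move=> /lt_trans; apply; near: k; exact: near_infty_natSinv_lt (PosNum eps0).
Unshelve. all: by end_near. Qed.

Lemma cvg_block T (F : set_system T) (FF : Filter F) m n p q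
    (u1 : T -> 'M[S]_(m, n)) (u2 : T -> 'M[S]_(m, q)) (u3 : T -> 'M[S]_(p, n))
    (u4 : T -> 'M[S]_(p, q)) (U1 : 'M[S]_(m, n)) (U2 : 'M[S]_(m, q))
    (U3 : 'M[S]_(p, n)) (U4 : 'M[S]_(p, q)) :
  u1 @ F --> U1 -> u2 @ F --> U2 -> u3 @ F --> U3 -> u4 @ F --> U4 ->
  (fun t => block_mx (u1 t) (u2 t) (u3 t) (u4 t)) @ F --> block_mx U1 U2 U3 U4.
Proof.
move=> /cvg_mxE h1 /cvg_mxE h2 /cvg_mxE h3 /cvg_mxE h4; apply/cvg_mxE => i j.
case: (split_ordP i) => i' ->; case: (split_ordP j) => j' ->.
- by rewrite block_mxEul; under eq_fun do rewrite block_mxEul; exact: h1.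
- by rewrite block_mxEur; under eq_fun do rewrite block_mxEur; exact: h2.
- by rewrite block_mxEdl; under eq_fun do rewrite block_mxEdl; exact: h3.
- by rewrite block_mxEdr; under eq_fun do rewrite block_mxEdr; exact: h4.
Qed.

Lemma cvg_mxN T (F : set_system T) (FF : Filter F) m n
    (u : T -> 'M[S]_(m, n)) (U : 'M[S]_(m, n)) :
  u @ F --> U -> (fun t => - u t) @ F --> - U.
Proof.
move=> /cvg_mnorm uU; apply/cvg_mnorm => eps /uU; apply: filterS => t.
by rewrite -opprD mnormN.
Qed.

Lemma cvg_twist n m (x : nat -> 'M[S]_(n, m)) (y : nat -> 'M[S]_(m, n))
    (X : 'M[S]_(n, m)) (Y : 'M[S]_(m, n)) :
  x @ \oo --> X -> y @ \oo --> Y ->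
  (fun k => twist (x k) (y k)) @ \oo --> twist X Y /\
  (fun k => untwist (x k) (y k)) @ \oo --> untwist X Y.
Proof.
move=> xX yY.
have xN : (fun k => - x k) @ \oo --> - X by exact: cvg_mxN xX.
have yN : (fun k => - y k) @ \oo --> - Y by exact: cvg_mxN yY.
have cu (z : nat -> 'M[S]_(n, m)) Z : z @ \oo --> Z ->
    (fun k => umx (z k)) @ \oo --> umx Z.
  by move=> zZ; apply: cvg_block zZ _ _; exact: cvg_cst.
have cl (z : nat -> 'M[S]_(m, n)) Z : z @ \oo --> Z ->
    (fun k => lmx (z k)) @ \oo --> lmx Z.
  by move=> zZ; apply: cvg_block _ zZ _; exact: cvg_cst.
rewrite /twist /untwist; split.
  exact: (cvg_mulmx (cvg_mulmx (cu _ _ xX) (cl _ _ yN)) (cu _ _ xX)).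
exact: (cvg_mulmx (cvg_mulmx (cu _ _ xN) (cl _ _ yY)) (cu _ _ xN)).
Qed.

Lemma mpair_twist n m (x : 'M[S]_(n, m)) x' (y : 'M[S]_(m, n)) y' :
  mpair x x' -> mpair y y' -> mpair (twist x y) (twist x' y').
Proof.
move=> xx' yy'.
have o k := @mpair1 _ _ _ _ sQ k; have z k l := @mpair0 _ _ _ _ sQ k l.
have yN := mpairN sQ yy'.
by apply: (mpairM sQ); [apply: (mpairM sQ)|]; apply: mpair_block.
Qed.

Lemma mpair_untwist n m (x : 'M[S]_(n, m)) x' (y : 'M[S]_(m, n)) y' :
  mpair x x' -> mpair y y' -> mpair (untwist x y) (untwist x' y').
Proof.
move=> xx' yy'.
have o k := @mpair1 _ _ _ _ sQ k; have z k l := @mpair0 _ _ _ _ sQ k l.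
have xN := mpairN sQ xx'.
by apply: (mpairM sQ); [apply: (mpairM sQ)|]; apply: mpair_block.
Qed.

Fact corner_proof (B : nzRingType) n m (e : 'M[B]_n) : e *m e == e ->
  block_mx e 0 0 (0 : 'M[B]_m) *m block_mx e 0 0 (0 : 'M[B]_m) == block_mx e 0 0 0.
Proof.
by move=> /eqP ee; rewrite mulmx_block !(mulmx0, mul0mx, addr0) ee.
Qed.

Fact corner_proof' (B : nzRingType) n m (f : 'M[B]_m) : f *m f == f ->
  block_mx (0 : 'M[B]_n) 0 0 f *m block_mx (0 : 'M[B]_n) 0 0 f == block_mx 0 0 0 f.
Proof.
by move=> /eqP ff; rewrite mulmx_block !(mulmx0, mul0mx, add0r, addr0) ff.
Qed.

Lemma mvn_corner (B : nzRingType) n m (e : 'M[B]_n) (eP : e *m e == e) :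
  mvn (Idem eP) (Idem (corner_proof m eP)).
Proof.
have ee := eqP eP; exists (row_mx e 0), (col_mx e 0); rewrite /idem_mx /=; split.
  by rewrite mul_row_col mul0mx addr0.
by rewrite mul_col_row !(mulmx0, mul0mx) ee.
Qed.

Lemma mvn_corner' (B : nzRingType) n m (f : 'M[B]_m) (fP : f *m f == f) :
  mvn (Idem fP) (Idem (corner_proof' n fP)).
Proof.
have ff := eqP fP; exists (row_mx 0 f), (col_mx 0 f); rewrite /idem_mx /=; split.
  by rewrite mul_row_col mul0mx add0r.
by rewrite mul_col_row !(mulmx0, mul0mx) ff.
Qed.

(** Only the starting points are paired: [Q] is not assumed closed, so nothing relates the limits
    directly. *)
Definition V_rel (x : idem_classes S) (x' : idem_classes S') : Prop :=
  exists n (a e : 'M[S]_n) (a' e' : 'M[S']_n) (eP : e *m e == e) (e'P : e' *m e' == e'),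
    [/\ mpair a a', nlim a e, nlim a' e', x = idem_class (Idem eP) &
        x' = idem_class (Idem e'P)].

(** A matrix over [Q] close to [e] has a limit similar to [e] by [newton_stable], and a defect below
    1/8, so that the iteration also converges on the other side. *)
Lemma V_rel_total x : exists x', V_rel x x'.
Proof.
elim/idem_classW: x => -[n [e eP]]; have ee := eqP eP.
have cA := mnorm_complete_norm A n.
have [r [r0 rP]] := defect_small cA ee.
have [s [s0 sP]] := newton_stable cA ee.
have rs : 0 < Num.min r s by rewrite lt_min r0.
have [a [a' [aa' _]]] := mpair_dense spQ e rs.
rewrite lt_min => /andP[/rP a8 /sP[f [af ff ef]]].
have [e' [a'e' ee']] := mpair_newton_cvg aa' a8.
have fP : f *m f == f by exact/eqP.
have e'P : e' *m e' == e' by exact/eqP.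
exists (idem_class (Idem e'P)), n, a, f, a', e', fP, e'P; split=> //.
exact/idem_classP/sim_mvn.
Qed.

(** The equivalence of [e] and [f] becomes conjugation by [twist X Y], approximated by a twist over
    [Q]. The iterations from the conjugated start [c] and from [d] then both come near the
    idempotent [h], and [mpair_nlim_near] compares their partners. *)
Lemma V_rel_functional v x' y' : V_rel v x' -> V_rel v y' -> x' = y'.
Proof.
move=> [n [a [e [a' [e' [eP [e'P [aa' ae a'e' -> ->]]]]]]]].
move=> [m [b [f [b' [f' [fP [f'P [bb' bf b'f' + ->]]]]]]]].
move=> /idem_classP[x [y [/= xy yx]]].
rewrite /idem_mx /idem_dim /= in x y xy yx.
have ee := eqP eP; have ff := eqP fP; have ee' := eqP e'P; have ff' := eqP f'P.
(* Cutting down by [e] and [f] provides the absorption relations that [twist_idem] asks for. *)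
pose X := e *m x *m f; pose Y := f *m y *m e.
have xfy : x *m f *m y = e by rewrite -yx mulmxA xy -mulmxA xy ee.
have yex : y *m e *m x = f by rewrite -xy mulmxA yx -mulmxA yx ff.
have XY : X *m Y = e.
  rewrite /X /Y !mulmxA -(mulmxA _ f f) ff -(mulmxA e x f) -(mulmxA e _ y).
  by rewrite xfy ee.
have YX : Y *m X = f.
  rewrite /X /Y !mulmxA -(mulmxA _ e e) ee -(mulmxA f y e) -(mulmxA f _ x).
  by rewrite yex ff.
have eX : e *m X = X by rewrite /X !mulmxA ee.
have fY : f *m Y = Y by rewrite /Y !mulmxA ff.
have Ye : Y *m e = Y by rewrite /Y -mulmxA ee.
pose h : 'M[S]_(n + m) := block_mx 0 0 0 f.
have hE : twist X Y *m block_mx e 0 0 0 *m untwist X Y = h by exact: twist_idem.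
have hh : h *m h = h by exact/eqP/corner_proof'.
have [r [r0 rP]] := mpair_nlim_near hh.
have r2 : 0 < r / 2 by rewrite divr_gt0.
have [xk [xk' [xkP xX]]] := mpair_dense_seq X.
have [yk [yk' [ykP yY]]] := mpair_dense_seq Y.
have [tT uT] := cvg_twist xX yY.
have : (fun k => twist (xk k) (yk k) *m block_mx e 0 0 0 *m untwist (xk k) (yk k))
    @ \oo --> h.
  by rewrite -hE; exact: (cvg_mulmx (cvg_mulmx tT (cvg_cst _)) uT).
move=> /cvg_mnorm/(_ _ r2)[k _ /(_ k (leqnn k))].
set T := twist _ _; set Ti := untwist _ _ => Th.
pose T' := twist (xk' k) (yk' k); pose Ti' := untwist (xk' k) (yk' k).
have TT' : mpair T T' by exact: mpair_twist.
have TiTi' : mpair Ti Ti' by exact: mpair_untwist.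
have z i j := @mpair0 _ _ _ _ sQ i j.
pose c := T *m block_mx a 0 0 (0 : 'M[S]_m) *m Ti.
pose c' := T' *m block_mx a' 0 0 (0 : 'M[S']_m) *m Ti'.
have cc' : mpair c c'.
  by apply: (mpairM sQ) => //; apply: (mpairM sQ) => //; exact: mpair_block.
pose e0 : 'M[S']_(n + m) := block_mx e' 0 0 0.
have ch : nlim c (T *m block_mx e 0 0 0 *m Ti).
  apply: nlim_conj; first exact: untwistK.
  by apply: nlim_block => //; apply: nlim_idem; rewrite mulmx0.
have c'h : nlim c' (T' *m e0 *m Ti').
  apply: nlim_conj; first exact: untwistK.
  by apply: nlim_block => //; apply: nlim_idem; rewrite mulmx0.
pose d : 'M[S]_(n + m) := block_mx 0 0 0 b.
pose d' : 'M[S']_(n + m) := block_mx 0 0 0 b'.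
have dd' : mpair d d' by exact: mpair_block.
have dh : nlim d h by apply: nlim_block => //; apply: nlim_idem; rewrite mulmx0.
have d'h : nlim d' (block_mx 0 0 0 f').
  by apply: nlim_block => //; apply: nlim_idem; rewrite mulmx0.
(* Enough Newton steps bring [c] within [r / 2] of its limit, which is itself within [r / 2] of [h],
   and [d] within [r] of [h]. Iterates remain paired and keep their limits. *)
have [k1 k1P] := ch _ r2; have [k2 k2P] := dh _ r0.
have TiT' : Ti' *m T' = 1%:M by exact: untwistK.
have T'Ti : T' *m Ti' = 1%:M by exact: twistK.
have e0e0 : e0 *m e0 = e0 by exact/eqP/corner_proof.
have gg : (T' *m e0 *m Ti') *m (T' *m e0 *m Ti') = T' *m e0 *m Ti' by exact: conj_idem.
have simh : sim (T' *m e0 *m Ti') (block_mx 0 0 0 f').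
  apply: (rP _ _ _ _ _ _ (mpair_newton sQ k1 cc') (mpair_newton sQ k2 dd')).
  - rewrite -(subrKA (T *m block_mx e 0 0 0 *m Ti)) (le_lt_trans (mnormD _ _)) //.
    by rewrite [ltRHS]splitr ltrD // k1P.
  - exact: k2P.
  - exact: nlim_iter.
  - exact: gg.
  - exact: nlim_iter.
(* On this side [T'] and [Ti'] are exact inverses, so the similarity holds although nothing is known
   about the convergence of [xk'] and [yk']. *)
have sime : sim e0 (T' *m e0 *m Ti') by exact: sim_conj.
apply/idem_classP.
apply: mvn_trans (mvn_corner m e'P) _.
apply: mvn_trans _ (mvn_sym (mvn_corner' n f'P)).
exact: sim_mvn (sim_trans sime simh).
Qed.

Lemma V_relD x y x' y' : V_rel x x' -> V_rel y y' -> V_rel (x + y) (x' + y').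
Proof.
move=> [n [a [e [a' [e' [eP [e'P [aa' ae a'e' -> ->]]]]]]]].
move=> [m [b [f [b' [f' [fP [f'P [bb' bf b'f' -> ->]]]]]]]].
rewrite [_ + _]vaddE [X in V_rel _ X]vaddE.
exists (n + m)%N, (block_mx a 0 0 b), (block_mx e 0 0 f), (block_mx a' 0 0 b'),
  (block_mx e' 0 0 f'), (isum_proof (Idem eP) (Idem fP)),
  (isum_proof (Idem e'P) (Idem f'P)); split=> //.
- by apply: mpair_block => //; exact: mpair0.
- exact: nlim_block.
- exact: nlim_block.
Qed.

Lemma V_rel0 : V_rel 0 0.
Proof.
exists 0%N, 0, 0, 0, 0, (izero_proof S), (izero_proof S'); split=> //.
- exact: mpair0.
- by apply: nlim_idem; rewrite mulmx0.
- by apply: nlim_idem; rewrite mulmx0.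
Qed.

(** Paired matrices have equal scalar parts, hence so do their iterates and, by continuity, the
    limits. *)
Lemma V_rel_scalar x x' : V_rel x x' ->
  idem_classes_map (@scalar_part R A) x = idem_classes_map (@scalar_part R A') x'.
Proof.
move=> [n [a [e [a' [e' [eP [e'P [aa' ae a'e' -> ->]]]]]]]].
rewrite !idem_classes_mapE; apply/idem_classP.
have see' : map_mx (@scalar_part R A) e = map_mx (@scalar_part R A') e'.
  apply/matrixP => i j; rewrite !mxE; apply/eqP; rewrite -subr_eq0; apply/eqP.
  apply: (@rnorm_eq0 R R[i]); apply/eqP; rewrite eq_le rnorm_ge0 andbT.
  apply/ler_addgt0Pl => eps eps0; rewrite addr0.
  have e2 : 0 < eps / 2 by rewrite divr_gt0.
  have [k kP] := ae _ e2; have [l lP] := a'e' _ e2.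
  have {}kP := kP _ (leq_maxl k l); have {}lP := lP _ (leq_maxr k l).
  set q := maxn k l in kP lP.
  have [_] := mpair_newton sQ q aa' i j.
  set b := iter q _ a in kP *; set b' := iter q _ a' in lP *.
  move: kP lP => kP lP; pose u := b i j; pose u' := b' i j.
  rewrite -/u -/u' => uu'.
  have ue : rnorm (u.2 - (e i j).2) < eps / 2.
    apply: le_lt_trans kP; apply: le_trans (unorm_le_mnorm _ i j).
    by rewrite !mxE /unorm lerDr rnorm_ge0.
  have ue' : rnorm (u'.2 - (e' i j).2) < eps / 2.
    apply: le_lt_trans lP; apply: le_trans (unorm_le_mnorm _ i j).
    by rewrite !mxE /unorm lerDr rnorm_ge0.
  rewrite /scalar_part -(subrKA u.2) (le_trans (rnormD _ _)) // [leRHS]splitr lerD //.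
    by rewrite -rnormN opprB ltW.
  by rewrite uu' ltW.
exists (map_mx (@scalar_part R A) e), (map_mx (@scalar_part R A) e).
rewrite /idem_mx /= -see' -map_mxM.
by rewrite (eqP eP).
Qed.

End PairedIdempotents.

(** * From spectral pairs to isomorphisms of K-groups *)

Lemma rel_bijection (T T' : Type) (P : T -> T' -> Prop) :
  (forall x, exists x', P x x') -> (forall x', exists x, P x x') ->
  (forall x x' y', P x x' -> P x y' -> x' = y') ->
  (forall x' x y, P x x' -> P y x' -> x = y) ->
  exists (f : T -> T') (g : T' -> T),
    [/\ forall x, P x (f x), forall x', P (g x') x', cancel f g & cancel g f].
Proof.
move=> tot tot' fct fct'; pose f x := sval (cid (tot x)); pose g x := sval (cid (tot' x)).
have fP x : P x (f x) by exact: svalP (cid (tot x)).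
have gP x : P (g x) x by exact: svalP (cid (tot' x)).
by exists f, g; split=> // x; [exact: fct' (gP _) (fP _)|exact: fct (fP _) (gP _)].
Qed.

Lemma groth_mapK (M N : nmodType) (f : {additive M -> N}) (g : {additive N -> M}) :
  cancel f g -> cancel (groth_map f) (groth_map g).
Proof. by move=> fg; elim/gdiffW => a b; rewrite !groth_mapE !fg. Qed.

(** A monoid isomorphism compatible with the scalar parts extends to the Grothendieck groups and
    restricts to the kernels defining K_0. *)
Lemma K0_iso (R : realType) (A A' : banachAlgType R)
    (f : {additive idem_classes (unitization A) -> idem_classes (unitization A')})
    (g : {additive idem_classes (unitization A') -> idem_classes (unitization A)}) :
  cancel f g -> cancel g f ->
  (forall x, idem_classes_map (@scalar_part R A') (f x) =
    idem_classes_map (@scalar_part R A) x) ->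
  exists phi : {additive K0 A -> K0 A'}, bijective phi.
Proof.
move=> fg gf fs.
have fS x : K0_scalar A' (groth_map f x) = K0_scalar A x.
  by elim/gdiffW: x => a b; rewrite /K0_scalar groth_mapE /= !groth_mapE /= !fs.
have fP (x : K0 A) : in_K0 (groth_map f (val x)).
  by rewrite /in_K0 fS; case: x.
have gP (x : K0 A') : in_K0 (groth_map g (val x)).
  rewrite /in_K0 -fS (groth_mapK gf); by case: x.
pose phi (x : K0 A) : K0 A' := InK0 (fP x).
have phiB : zmod_morphism phi.
  by move=> x y; apply: val_inj; rewrite /= !raddfB.
pose phiA : {additive K0 A -> K0 A'} :=
  HB.pack phi (GRing.isZmodMorphism.Build _ _ phi phiB).
exists phiA; exists (fun x => InK0 (gP x)) => x; apply: val_inj => /=.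
  exact: groth_mapK.
exact: groth_mapK.
Qed.

Section KTheoryIso.
Variables (R : realType) (A A' : banachAlgType R) (Q : A -> A' -> Prop).
Let Q' a' a := Q a a'.
Hypothesis sQ : subalgebra_pair Q.
Hypothesis spQ : spectral_pair Q.
Hypothesis spQ' : spectral_pair Q'.

Let sQ' : subalgebra_pair Q'.
Proof.
split; first exact: (pair0 sQ).
- by move=> x y x' y'; exact: (pairD sQ).
- by move=> a x x'; exact: (pairZ sQ).
- by move=> x y x' y'; exact: (pairM sQ).
Qed.

Lemma mpair_flip m n (U : 'M[unitization A]_(m, n)) (U' : 'M[unitization A']_(m, n)) :
  mpair Q U U' <-> mpair Q' U' U.
Proof. by split=> UU' i j; have [] := UU' i j; split. Qed.

Lemma K1_rel_flip x x' : K1_rel Q x x' <-> K1_rel Q' x' x.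
Proof.
split=> -[n [g [g' [gP [g'P [gg' -> ->]]]]]];
  by exists n, g', g, g'P, gP; split=> //; apply/mpair_flip.
Qed.

Lemma V_rel_flip x x' : V_rel Q x x' <-> V_rel Q' x' x.
Proof.
split=> -[n [a [e [a' [e' [eP [e'P [aa' ae a'e' -> ->]]]]]]]];
  by exists n, a', e', a, e, e'P, eP; split=> //; apply/mpair_flip.
Qed.

Theorem spectral_pair_K1 : exists phi : {multiplicative K1 A -> K1 A'}, bijective phi.
Proof.
have [x|x'|x x' y'|x' x y|f [g [fP _ fg gf]]] := @rel_bijection _ _ (K1_rel Q).
- exact: K1_rel_total.
- by have [x xx'] := K1_rel_total sQ' spQ' x'; exists x; exact/K1_rel_flip.
- exact: K1_rel_functional.
- by move=> /K1_rel_flip xx' /K1_rel_flip; exact: K1_rel_functional xx'.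
have fM : {morph f : x y / (x * y)%g >-> (x * y)%g}.
  by move=> x y; apply: (K1_rel_functional sQ spQ (fP _)); exact: K1_relM.
pose phi : {multiplicative K1 A -> K1 A'} :=
  HB.pack f (isMultiplicative.Build _ _ f fM).
by exists phi; exists g.
Qed.

Theorem spectral_pair_K0 : exists phi : {additive K0 A -> K0 A'}, bijective phi.
Proof.
have [x|x'|x x' y'|x' x y|f [g [fP gP fg gf]]] := @rel_bijection _ _ (V_rel Q).
- exact: V_rel_total.
- by have [x xx'] := V_rel_total sQ' spQ' x'; exists x; exact/V_rel_flip.
- exact: V_rel_functional.
- by move=> /V_rel_flip xx' /V_rel_flip; exact: V_rel_functional xx'.
have fD : nmod_morphism f.
  split; first by apply: (V_rel_functional sQ spQ (fP _)); exact: V_rel0.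
  by move=> x y; apply: (V_rel_functional sQ spQ (fP _)); exact: V_relD.
have gD : nmod_morphism g.
  have [f0 fA] := fD; split; first by apply: (can_inj fg); rewrite gf f0.
  by move=> x y; apply: (can_inj fg); rewrite fA !gf.
pose fA : {additive idem_classes (unitization A) -> idem_classes (unitization A')} :=
  HB.pack f (GRing.isNmodMorphism.Build _ _ f fD).
pose gA : {additive idem_classes (unitization A') -> idem_classes (unitization A)} :=
  HB.pack g (GRing.isNmodMorphism.Build _ _ g gD).
apply: (@K0_iso _ _ _ fA gA) => // x.
by rewrite (V_rel_scalar sQ (fP x)).
Qed.

End KTheoryIso.

(** * Reduced norms of a groupoid *)

Section GroupoidAlgebra.
Variable G : topGroupoid.
Implicit Types x y z u : G.

Lemma composableVl x : composable (ginv x, x).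
Proof. by have := composableV (ginv x); rewrite ginvK. Qed.

Lemma gsource_mull x y : composable (x, y) -> gmul (gsource x) y = y.
Proof.
move=> xy; have [_ _ ->] := gmulA (composableVl x) xy.
by have [] := gmulKV xy.
Qed.

Lemma composable_gsource x : composable (x, gsource x) /\ gmul x (gsource x) = x.
Proof.
have [_ ? e] := gmulA (composableV x) (composableVl x); split=> //.
rewrite /gsource -e; have [_] := gmulKV (composableV x); by rewrite ginvK.
Qed.

Lemma composable_grange y : composable (grange y, y) /\ gmul (grange y) y = y.
Proof.
have [? _ _] := gmulA (composableV y) (composableVl y); split=> //.
have [_] := gmulKV (composableV y); by rewrite ginvK.
Qed.

(** The usual criterion, recovered from associativity: one direction regroups [ginv x], [x], [y],
    the other inserts the common unit between [x] and [y]. *)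
Lemma composableP x y : composable (x, y) <-> gsource x = grange y.
Proof.
split=> [xy|xy].
  have [sxy _ _] := gmulA (composableVl x) xy.
  by have [_] := gmulKV sxy; rewrite gsource_mull.
have [xs xsE] := composable_gsource x; have [ry _] := composable_grange y.
rewrite xy in xs xsE; have [+ _ _] := gmulA xs ry.
by rewrite xsE.
Qed.

Lemma gsourceV x : gsource (ginv x) = grange x.
Proof. by rewrite /gsource ginvK. Qed.

Lemma grangeV x : grange (ginv x) = gsource x.
Proof. by rewrite /grange ginvK. Qed.

Lemma gsourceM x y : composable (x, y) -> gsource (gmul x y) = gsource y.
Proof.
move=> xy; have [xyV _ _] := gmulA xy (composableV y).
by move/composableP : xyV; rewrite grangeV.
Qed.

Lemma grangeM x y : composable (x, y) -> grange (gmul x y) = grange x.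
Proof.
move=> xy; have [_ xVxy _] := gmulA (composableVl x) xy.
by move/composableP : xVxy; rewrite gsourceV.
Qed.

Lemma gunits_gsource x : gunits (gsource x).
Proof. by exists (ginv x) => //; exact: grangeV. Qed.

Lemma gsource_unit u : gunits u -> gsource u = u.
Proof. by move=> [x _ <-]; rewrite [LHS]gsourceM ?gsourceV //; exact: composableV. Qed.

Lemma gmul_gsourceV x : gmul x (ginv (gsource x)) = x.
Proof.
have [xs xsE] := composable_gsource x.
by have [_] := gmulKV xs; rewrite xsE.
Qed.

Lemma composable_div x y : gsource x = gsource y -> composable (x, ginv y).
Proof. by move=> xy; apply/composableP; rewrite grangeV. Qed.

Lemma gdivK x y : gsource x = gsource y ->
  composable (gmul x (ginv y), y) /\ gmul (gmul x (ginv y)) y = x.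
Proof.
move=> xy; have c := composable_div xy.
split; first by apply/composableP; rewrite gsourceM // gsourceV.
by have [_] := gmulKV c; rewrite ginvK.
Qed.

Lemma gsource_div x y : gsource x = gsource y ->
  gsource (gmul x (ginv y)) = grange y.
Proof. by move=> /composable_div/gsourceM ->; rewrite gsourceV. Qed.

Lemma grange_div x y : gsource x = gsource y ->
  grange (gmul x (ginv y)) = grange x.
Proof. by move=> /composable_div/grangeM. Qed.

Lemma gdiv_injr x y z : gsource x = gsource y -> gsource x = gsource z ->
  gmul x (ginv y) = gmul x (ginv z) -> y = z.
Proof.
move=> /composable_div/gmulKV[e1 _] /composable_div/gmulKV[e2 _] e.
by apply: (can_inj (@ginvK G)); rewrite -e1 -e2 e.
Qed.

Lemma gdiv_injl x y z : gsource x = gsource z -> gsource y = gsource z ->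
  gmul x (ginv z) = gmul y (ginv z) -> x = y.
Proof. by move=> /gdivK[_ {2}<-] /gdivK[_ {2}<-] ->. Qed.

End GroupoidAlgebra.

Section LpBounds.
Variables (R : realType) (G : topGroupoid) (l : G -> R).
Hypothesis hl : length_function l.
Implicit Types (f xi : G -> R[i]) (u x y : G).

Definition ball_bound (t b : R) : Prop := forall u, gunits u ->
  finite_set (fiber_ball l u t) /\ (size (fset_set (fiber_ball l u t)))%:R <= b.

Lemma size_fiber_ball t b u (s : seq G) : ball_bound t b -> gunits u ->
  uniq s -> {subset s <= fiber_ball l u t} -> (size s)%:R <= b.
Proof.
move=> /(_ u) bb /bb[fin szb] us sB; apply: le_trans szb; rewrite ler_nat.
by apply: uniq_leq_size => // x /sB; rewrite in_fset_set.
Qed.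

Definition row_ball u x t : set G := [set y | gfiber u y /\ l (gmul x (ginv y)) <= t].

(** The map y |-> (x y^-1)^-1 embeds the row in a ball of the source fibre over r(x). The outer
    inverse is needed because x y^-1 has range r(x), not source r(x); it preserves lengths. *)
Lemma row_ball_finite t b u x : ball_bound t b -> gsource x = u ->
  finite_set (row_ball u x t) /\ (size (fset_set (row_ball u x t)))%:R <= b.
Proof.
move=> tb xu; pose h y := ginv (gmul x (ginv y)).
have hB y : row_ball u x t y -> fiber_ball l (grange x) t (h y).
  move=> [yu yt]; split; last by rewrite /h (length_inv hl).
  by rewrite /gfiber /h /= gsourceV grange_div // xu yu.
have hinj y z : row_ball u x t y -> row_ball u x t z -> h y = h z -> y = z.
  move=> [yu _] [zu _] /(can_inj (@ginvK G)); apply: gdiv_injr; rewrite xu.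
    by rewrite yu.
  by rewrite zu.
have rx : gunits (grange x) by exists x.
have fin : finite_set (row_ball u x t).
  have hI : {in row_ball u x t &, injective h}.
    by move=> y z; rewrite !inE; exact: hinj.
  rewrite -(eq_finite_set (inj_card_eq hI)).
  have [finB _] := tb _ rx; apply: sub_finite_set finB.
  by move=> _ [y /hB ? <-].
split=> //; rewrite -(size_map h).
apply: (size_fiber_ball tb rx).
  rewrite map_inj_in_uniq ?fset_uniq // => y z.
  by rewrite !in_fset_set // !inE; exact: hinj.
move=> _ /mapP[y + ->]; rewrite in_fset_set // !inE; exact: hB.
Qed.

(** Here x |-> x y^-1 already lands in the source fibre over r(y). *)
Lemma size_column t b u y (s : seq G) : ball_bound t b -> gsource y = u ->
  uniq s -> (forall x, x \in s -> gsource x = u) ->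
  (count (fun x => l (gmul x (ginv y)) <= t) s)%:R <= b.
Proof.
move=> tb yu us su; pose h x := gmul x (ginv y).
have ry : gunits (grange y) by exists y.
rewrite -size_filter -(size_map h); apply: (size_fiber_ball tb ry).
  rewrite map_inj_in_uniq ?filter_uniq // => x z; rewrite !mem_filter.
  move=> /andP[_ /su xu] /andP[_ /su zu]; apply: gdiv_injl; rewrite yu //.
move=> _ /mapP[x + ->]; rewrite mem_filter inE => /andP[xt /su xu]; split=> //.
by rewrite /gfiber /h /= gsource_div // xu yu.
Qed.

Lemma lreg_row t b u f xi x : ball_bound t b -> gsource x = u ->
  (forall z, f z != 0 -> l z <= t) ->
  lreg u f xi x = \sum_(y <- fset_set (row_ball u x t)) f (gmul x (ginv y)) * xi y.
Proof.
move=> tb xu ft; have [fin _] := row_ball_finite tb xu.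
rewrite /lreg -fsbig_finite //; apply/esym/fsbig_widen; first by move=> y [].
move=> y [yu yN] /=; have [->|/ft fy] := eqVneq (f (gmul x (ginv y))) 0.
  by rewrite mul0r.
by exfalso; apply: yN.
Qed.

Lemma rnorm_sum (I : eqType) (s : seq I) (F : I -> R[i]) (c : R) : 0 <= c ->
  (forall i, i \in s -> rnorm (F i) <= c) -> rnorm (\sum_(i <- s) F i) <= (size s)%:R * c.
Proof.
move=> c0; elim: s => [|i s IHs] Fc; first by rewrite big_nil rnorm0 mul0r.
rewrite big_cons (le_trans (rnormD _ _)) //= -addn1 natrD mulrDl mul1r addrC.
rewrite lerD ?Fc ?mem_head // IHs // => j js.
by rewrite Fc // inE js orbT.
Qed.

(* The crude bound (m a)^p <= m^p a^p with a the largest entry, instead of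
   Hoelder's inequality, costs a further factor [b], which subexponential growth
   absorbs. *)
Lemma lreg_le t b M p u f xi x : ball_bound t b -> gsource x = u -> 0 <= M ->
  0 < p -> (forall z, f z != 0 -> l z <= t) -> (forall z, rnorm (f z) <= M) ->
  rnorm (lreg u f xi x) `^ p <=
    (b * M) `^ p * \sum_(y <- fset_set (row_ball u x t)) rnorm (xi y) `^ p.
Proof.
move=> tb xu M0 p0 ft fM; have [fin szb] := row_ball_finite tb xu.
rewrite (lreg_row _ tb xu ft); set s : seq G := fset_set _ in szb *.
have b0 : 0 <= b by rewrite (le_trans _ szb).
have [s0|sn0] := eqVneq s [::].
  by rewrite s0 !big_nil rnorm0 powR0 ?gt_eqF // mulr0.
(* [y0] carries the largest entry of [xi] in the row; its power is one term of the sum on the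
   right. *)
have [y0 [y0s y0P]] : exists y0, y0 \in s /\ forall y, y \in s -> rnorm (xi y) <= rnorm (xi y0).
  elim: s sn0 {szb} => // y s IHs _; have [->|/IHs[z [zs zP]]] := eqVneq s [::].
    by exists y; split=> [|z]; rewrite ?mem_head // inE => /eqP ->.
  have [yz|zy] := leP (rnorm (xi y)) (rnorm (xi z)).
    exists z; split=> [|w]; first by rewrite inE zs orbT.
    by rewrite inE => /predU1P[-> //|/zP].
  exists y; split=> [|w]; first by rewrite mem_head.
  rewrite inE => /predU1P[-> //|/zP wz]; exact: le_trans wz (ltW zy).
apply: (@le_trans _ _ ((b * M * rnorm (xi y0)) `^ p)).
  apply: ge0_ler_powR; [exact: ltW|by rewrite nnegrE rnorm_ge0|
    by rewrite nnegrE !mulr_ge0 ?rnorm_ge0|].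
  apply: (@le_trans _ _ ((size s)%:R * (M * rnorm (xi y0)))).
    apply: rnorm_sum => [|y ys]; first by rewrite mulr_ge0 // rnorm_ge0.
    by rewrite rnormM ler_pM ?rnorm_ge0 // y0P.
  by rewrite -mulrA ler_wpM2r // mulr_ge0 // rnorm_ge0.
rewrite powRM ?mulr_ge0 ?rnorm_ge0 // ler_wpM2l ?powR_ge0 //.
rewrite (big_rem y0) //= lerDl; apply: sumr_ge0 => y _; exact: powR_ge0.
Qed.

Lemma lpnorm_le1_sum p u xi (s : seq G) : 0 < p -> (lpnorm p u xi <= 1)%E -> uniq s ->
  (forall y, y \in s -> gfiber u y) -> \sum_(y <- s) rnorm (xi y) `^ p <= 1.
Proof.
move=> p0; rewrite /lpnorm; set e := esum _ _ => e1 us su.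
have e0 : (0 <= e)%E by apply: esum_ge0 => x _; rewrite lee_fin powR_ge0.
have {}e1 : (e <= 1)%E.
  have -> : e = ((e `^ p^-1) `^ p)%E.
    by rewrite -poweRrM mulVf ?gt_eqF // poweRe1.
  have -> : 1%E = (1%E `^ p)%E :> \bar R by rewrite poweR_EFin powR1.
  apply: gt0_ler_poweR; first exact: ltW.
  - by rewrite in_itv /= poweR_ge0 leey.
  - by rewrite in_itv /= lee01 leey.
  - exact: e1.
rewrite -lee_fin; apply: le_trans e1; rewrite -sumEFin.
apply: esum_ge; exists [set` s]; first by split; [exact: finite_seq|move=> y /= /su].
by rewrite -fsbig_seq.
Qed.

(** Rows give the factor [b * M]. After the sums over [x] and [y] are exchanged, each entry of [xi]
    is counted at most [b] times by [size_column], whence the p-th root of [b]. *)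
Lemma lpnorm_lreg_le t b M p u f xi : ball_bound t b -> 0 <= M -> 0 <= b ->
  0 < p -> (forall z, f z != 0 -> l z <= t) -> (forall z, rnorm (f z) <= M) ->
  (lpnorm p u xi <= 1)%E ->
  (lpnorm p u (lreg u f xi) <= ((b * M) * b `^ p^-1)%:E)%E.
Proof.
move=> tb M0 b0 p0 ft fM xi1; rewrite /lpnorm.
have bM0 : 0 <= b * M by rewrite mulr_ge0.
have -> : ((b * M) * b `^ p^-1)%:E = ((((b * M) `^ p * b)%:E) `^ p^-1)%E.
  rewrite poweR_EFin powRM ?powR_ge0 // -powRrM mulfV ?gt_eqF // powRr1 //.
apply: gt0_ler_poweR.
- by rewrite invr_ge0 ltW.
- by rewrite in_itv /= leey andbT; apply: esum_ge0 => x _; rewrite lee_fin powR_ge0.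
- by rewrite in_itv /= leey andbT lee_fin mulr_ge0 // powR_ge0.
apply: ge_ereal_sup => _ [X [finX Xu] <-].
rewrite fsbig_finite //= sumEFin lee_fin; set s : seq G := fset_set X.
have su x : x \in s -> gsource x = u by rewrite in_fset_set // inE => /Xu.
have us : uniq s by exact: fset_uniq.
(* [Y] collects the finitely many points of the rows through [s], so that only finite sums are
   exchanged. *)
pose Y : seq G := undup (flatten [seq (fset_set (row_ball u x t) : seq G) | x <- s]).
have Yu y : y \in Y -> gfiber u y.
  rewrite mem_undup => /flattenP[_ /mapP[x xs ->]].
  have [fin _] := row_ball_finite tb (su _ xs).
  by rewrite in_fset_set // inE => -[].
apply: (@le_trans _ _ (\sum_(x <- s) (b * M) `^ p *
    \sum_(y <- Y | l (gmul x (ginv y)) <= t) rnorm (xi y) `^ p)).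
  rewrite big_seq [leRHS]big_seq; apply: ler_sum => x xs.
  apply: (le_trans (lreg_le xi tb (su _ xs) M0 p0 ft fM)).
  rewrite ler_wpM2l ?powR_ge0 // -[leRHS]big_filter.
  have [fin _] := row_ball_finite tb (su _ xs).
  rewrite le_eqVlt; apply/orP; left; apply/eqP/perm_big.
  apply: uniq_perm; rewrite ?fset_uniq ?filter_uniq ?undup_uniq // => y.
  rewrite mem_filter in_fset_set // mem_undup; apply/idP/andP.
    rewrite inE => -[yu yt]; split=> //; apply/flattenP; eexists.
      exact: (map_f (fun x => fset_set (row_ball u x t) : seq G) xs).
    by rewrite in_fset_set // inE.
  move=> [yt yY]; rewrite inE; split=> //; apply: Yu.
  by rewrite mem_undup.
rewrite -mulr_sumr ler_wpM2l ?powR_ge0 //.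
under eq_bigr do rewrite big_mkcond.
rewrite exchange_big /=.
apply: (@le_trans _ _ (\sum_(y <- Y) b * rnorm (xi y) `^ p)).
  rewrite big_seq [leRHS]big_seq; apply: ler_sum => y /Yu yu.
  rewrite -big_mkcond big_const_seq iter_addr_0 -mulr_natl ler_wpM2r ?powR_ge0 //.
  exact: (size_column tb yu us su).
rewrite -mulr_sumr ler_piMr //.
by apply: (lpnorm_le1_sum p0 xi1); rewrite ?undup_uniq.
Qed.

(** The remaining p-th root of [b] is at most [b], which makes the bound independent of [p]. *)
Lemma reduced_norm_le t b M p f : ball_bound t b -> 0 <= M -> 1 <= b -> 1 <= p ->
  (forall z, f z != 0 -> l z <= t) -> (forall z, rnorm (f z) <= M) ->
  (reduced_norm p f <= (b ^+ 2 * M)%:E)%E.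
Proof.
move=> tb M0 b1 p1 ft fM; have b0 : 0 <= b by rewrite (le_trans ler01).
have p0 : 0 < p by rewrite (lt_le_trans ltr01).
apply: ge_ereal_sup => _ [->|[u _ <-]].
  by rewrite lee_fin mulr_ge0 // exprn_ge0.
apply: ge_ereal_sup => _ [xi /= xi1 <-].
apply: (le_trans (lpnorm_lreg_le tb M0 b0 p0 ft fM xi1)).
rewrite lee_fin expr2 -!mulrA ler_wpM2l // mulrC ler_wpM2r //.
rewrite -[leRHS]powRr1 //; apply: ler_powR => //.
by rewrite invf_le1.
Qed.

(** [f x] is the value at [x] of [lreg u f] applied to the unit vector at the unit [u] of the fibre
    of [x]. *)
Lemma reduced_norm_ge p f x : 0 < p -> ((rnorm (f x))%:E <= reduced_norm p f)%E.
Proof.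
move=> p0; pose u := gsource x; have uu : gunits u by exact: gunits_gsource.
have su : gsource u = u by exact: gsource_unit.
pose xi y : R[i] := (y == u)%:R.
have xiE y : rnorm (xi y) `^ p = (y == u)%:R.
  rewrite /xi /rnorm; case: eqP => _; first by rewrite normr1 powR1.
  by rewrite normr0 powR0 // gt_eqF.
have lx : lreg u f xi x = f x.
  rewrite /lreg -(fsbig_widen [set u]).
  - by rewrite fsbig_set1 /xi eqxx mulr1 gmul_gsourceV.
  - by move=> _ ->.
  - by move=> y [_ /= /eqP yu]; rewrite /xi (negbTE yu) mulr0.
apply: (@le_trans _ _ (lpnorm p u (lreg u f xi))).
  rewrite /lpnorm; apply: (@le_trans _ _ (((rnorm (f x) `^ p)%:E) `^ p^-1)%E).
    by rewrite poweR_EFin -powRrM mulfV ?gt_eqF // powRr1 ?rnorm_ge0.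
  apply: gt0_ler_poweR.
  - by rewrite invr_ge0 ltW.
  - by rewrite in_itv /= leey andbT lee_fin powR_ge0.
  - by rewrite in_itv /= leey andbT; apply: esum_ge0 => y _; rewrite lee_fin powR_ge0.
  apply: esum_ge; exists [set x]; first by split=> // _ ->.
  by rewrite fsbig_set1 lx.
apply: (@le_trans _ _ (lreg_opnorm p u f)); last first.
  by apply: ereal_sup_ubound; right; exists u.
apply: ereal_sup_ubound; exists xi => //=.
rewrite /lpnorm; have -> : 1%E = (1%E `^ p^-1)%E :> \bar R by rewrite poweR_EFin powR1.
apply: gt0_ler_poweR.
- by rewrite invr_ge0 ltW.
- by rewrite in_itv /= leey andbT; apply: esum_ge0 => y _; rewrite lee_fin powR_ge0.
- by rewrite in_itv /= leey andbT lee01.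
apply: ge_ereal_sup => _ [X [finX Xu] <-].
apply: (@le_trans _ _ (\sum_(y \in X) ((y == u)%:R)%:E)%E).
  rewrite le_eqVlt; apply/orP; left; apply/eqP; apply: eq_fsbigr => y _.
  by rewrite -xiE.
rewrite fsbig_finite //= sumEFin lee_fin.
have [uX|uX] := boolP (u \in fset_set X).
  rewrite (big_rem u) //= eqxx big_seq big1 ?addr0 // => y.
  by rewrite mem_rem_uniq ?fset_uniq // inE => /andP[/negbTE ->].
rewrite big_seq big1 // => y yX; case: eqP => // yu.
by rewrite -yu yX in uX.
Qed.

End LpBounds.

(** * Convolution *)

Lemma hausdorff_neq_near (T : topologicalType) (x y : T) : hausdorff_space T ->
  x <> y -> exists A B : set T, [/\ nbhs x A, nbhs y B &
    forall z w, A z -> B w -> z <> w].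
Proof.
rewrite open_hausdorff => hT /eqP/hT[AB [xA yB] [oA oB /eqP AB0]].
exists AB.1, AB.2; split.
- by apply: open_nbhs_nbhs; split=> //; exact: set_mem xA.
- by apply: open_nbhs_nbhs; split=> //; exact: set_mem yB.
move=> z w zA wB zw; have : (AB.1 `&` AB.2) z by split=> //; rewrite zw.
by rewrite AB0.
Qed.

Lemma separate_points (T : topologicalType) (s : seq T) : hausdorff_space T ->
  exists V : T -> set T, (forall x, nbhs x (V x)) /\
    forall x y z, x \in s -> y \in s -> V x z -> V y z -> x = y.
Proof.
move=> hT.
have sep (x y : T) : exists AB : set T * set T, x <> y ->
    [/\ nbhs x AB.1, nbhs y AB.2 & forall z w, AB.1 z -> AB.2 w -> z <> w].
  have [->|/eqP xy] := eqVneq x y; first by exists (set0, set0).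
  by have [A [B AB]] := hausdorff_neq_near hT xy; exists (A, B).
pose W x y := sval (cid (sep x y)); have WP x y := svalP (cid (sep x y)).
rewrite -/(W _ _) in WP.
exists (fun x => [set z | forall y, y \in s -> x <> y -> (W x y).1 z /\ (W y x).2 z]).
split=> [x|x y z xs ys xz yz].
  apply: (filter_seq _ (P := fun y => [set z | x <> y -> (W x y).1 z /\ (W y x).2 z])).
  move=> y _; have [->|/eqP xy] := eqVneq x y; first exact: filterE.
  have [xW _ _] := WP _ _ xy; have [_ yW _] := WP y x (nesym xy).
  by apply: filterS2 xW yW => z z1 z2 _.
apply: contrapT => xy; have [_ _ W0] := WP _ _ xy.
have [Wz _] := xz _ ys xy; have [_ Wz'] := yz _ xs (nesym xy).
exact: W0 Wz Wz' erefl.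
Qed.

Section Convolution.
Variables (R : realType) (G : topGroupoid).
Hypothesis hG : etale G.
Implicit Types (f g : G -> R[i]) (u x y z : G).

Let hausG : hausdorff_space G. Proof. by case: hG. Qed.

Lemma local_homeo_continuous (B : set G) (f : G -> G) :
  local_homeo_to B f -> continuous f.
Proof.
move=> hf x; have [U [oU Ux _ /subspace_continuousP/(_ _ Ux) + _]] := hf x.
by rewrite within_interior //; exact: open_nbhs_nbhs.
Qed.

Lemma gsource_continuous : continuous (@gsource G).
Proof. by case: hG => _ _ _ /local_homeo_continuous. Qed.

Lemma grange_continuous : continuous (@grange G).
Proof. by case: hG => _ _ /local_homeo_continuous. Qed.

(** By [composableP] this is the coincidence set of two continuous maps into a Hausdorff space. *)
Lemma closed_composable : closed (@composable G).
Proof.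
move=> [x y] cxy; apply/composableP; apply: contrapT => xy.
have [A [B [xA yB AB]]] := hausdorff_neq_near hausG xy.
have [|[z w] [/composableP zw [/= Az Bw]]] := cxy ((@gsource G @^-1` A) `*` (@grange G @^-1` B)).
  exists (@gsource G @^-1` A, @grange G @^-1` B) => //; split.
    exact: gsource_continuous xA.
  exact: grange_continuous yB.
exact: AB Az Bw zw.
Qed.

(** The source map is locally injective, so each point of [K] has a neighbourhood with at most one
    point of the fibre. *)
Lemma compact_fiber_finite (K : set G) u : compact K -> finite_set (K `&` gfiber u).
Proof.
move=> /compact_near_coveringP cK.
(* With finite lists directed by inclusion as the filter, the near-covering form of compactness
   yields one finite list for all of [K]. *)
pose F : set_system (seq G) :=
  [set A | exists s : seq G, forall s' : seq G, {subset s <= s'} -> A s'].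
have FF : Filter F.
  split.
  - by exists [::].
  - move=> A B [s sA] [t tB]; exists (s ++ t) => r rP; split.
      by apply: sA => x xs; apply: rP; rewrite mem_cat xs.
    by apply: tB => x xs; apply: rP; rewrite mem_cat xs orbT.
  - by move=> A B AB [s sA]; exists s => r /sA /AB.
have [|s sP] := cK _ F (fun s x => gsource x = u -> x \in s) FF; last first.
  apply: (@sub_finite_set _ _ [set` s]); last exact: finite_seq.
  by move=> x [Kx xu]; exact: (sP s _ _ Kx xu).
move=> x Kx; have [_ _ _ /(_ x)[U [oU Ux Uinj _ _]]] := hG.
have UU : nbhs x U by exact: open_nbhs_nbhs.
have [[w [Uw wu]]|nw] := pselect (exists w, U w /\ gsource w = u).
  exists (U, [set s : seq G | w \in s]) => /=.
    by split=> //; exists [:: w] => s; apply; rewrite mem_head.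
  move=> [z s] /= [Uz ws] zu; suff -> : z = w by [].
  by apply: Uinj; rewrite ?inE // zu.
exists (U, setT); first by split=> //; exact: filterT.
by move=> [z s] /= [Uz _] zu; exfalso; apply: nw; exists z.
Qed.

Lemma convolution_support f g x : convolution f g x != 0 -> exists y,
  [/\ gsource y = gsource x, f (gmul x (ginv y)) != 0 & g y != 0].
Proof.
move=> fgx; apply: contrapT => ne; move/eqP : fgx; apply.
rewrite /convolution; apply: fsbig1 => y yx.
have [->|fy] := eqVneq (f (gmul x (ginv y))) 0; first by rewrite mul0r.
have [->|gy] := eqVneq (g y) 0; first by rewrite mulr0.
by exfalso; apply: ne; exists y.
Qed.

(** The support lies in the image under multiplication of the composable pairs in a product of two
    compact sets; that image is compact, hence closed. *)
Lemma Cc_convolution_compact f g : Cc f -> Cc g ->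
  compact (closure [set x | convolution f g x != 0]).
Proof.
move=> [_ cf] [_ cg].
pose M := (fun xy : G * G => gmul xy.1 xy.2) @`
  ((closure [set x | f x != 0] `*` closure [set x | g x != 0]) `&` @composable G).
have cM : compact M.
  apply: continuous_compact.
    by apply: continuous_subspaceW (@gmul_continuous G) => ? [].
  by apply: compact_closedI; [exact: compact_setX|exact: closed_composable].
have closedM : closed M by exact: compact_closed.
apply: (subclosed_compact _ cM); first exact: closed_closure.
move=> x /closureS; move=> /(_ M) h; rewrite (closure_id M).1 //; apply: h.
move=> {}x /convolution_support[y [yx fy gy]].
have [c e] := gdivK (esym yx).
exists (gmul x (ginv y), y) => //=; split=> //.
by split=> /=; exact: subset_closure.
Qed.

(** The filter is restricted to pairs with a common source, outside which the quotient has no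
    meaning. *)
Lemma gdiv_cvg x0 y0 : gsource x0 = gsource y0 ->
  (fun xy : G * G => gmul xy.1 (ginv xy.2)) @
    within [set xy | gsource xy.1 = gsource xy.2] (nbhs (x0, y0)) -->
  gmul x0 (ginv y0).
Proof.
move=> xy0 W /= WW; have c0 := composable_div xy0.
have /subspace_continuousP/(_ _ c0) := @gmul_continuous G.
move=> /(_ W WW); rewrite /within /= => -[[A B] [/= xA yB] AB].
exists (A, (@ginv G) @^-1` B) => /=.
  by split=> //; exact: (ginv_continuous yB).
move=> [x y] /= [Ax By] xy; apply: (AB (x, ginv y)) => //.
exact: composable_div.
Qed.

Lemma convolution_term_near f g x0 y0 eps : continuous f -> continuous g ->
  gsource x0 = gsource y0 -> 0 < eps ->
  exists A B, [/\ nbhs x0 A, nbhs y0 B & forall x y, A x -> B y ->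
    gsource x = gsource y ->
    rnorm (f (gmul x (ginv y)) * g y - f (gmul x0 (ginv y0)) * g y0) < eps].
Proof.
move=> cf cg xy0 eps0.
pose D := [set xy : G * G | gsource xy.1 = gsource xy.2].
pose F := within D (nbhs (x0, y0)).
have ff : (fun xy : G * G => f (gmul xy.1 (ginv xy.2))) @ F --> f (gmul x0 (ginv y0)).
  exact: (cvg_comp _ _ (gdiv_cvg xy0) (cf _)).
have gg : (fun xy : G * G => g xy.2) @ F --> g y0.
  move=> W /cg gW; exists (setT, g @^-1` W) => /=.
    by split=> //; exact: filterT.
  by move=> [x y] [_ Wy] _.
have FF : Filter F by exact: within_filter.
have := @cvgM R[i] _ F FF _ _ _ _ ff gg.
move=> /cvg_rnorm/(_ _ eps0); rewrite /F /within /= => -[[A B] [/= xA yB] AB].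
by exists A, B; split=> // x y Ax By xy; exact: (AB (x, y)).
Qed.

(* Near [x0] the fibre over [gsource x] meets the compact support of [g] only in
   the local sections through the finitely many points of the fibre over
   [gsource x0], so the convolution is locally a finite sum of continuous terms. *)
Lemma convolution_continuous f g : continuous f -> Cc g -> continuous (convolution f g).
Proof.
move=> cf [cg cL] x0; set L := closure _ in cL; set u0 := gsource x0.
have finL := compact_fiber_finite u0 cL.
pose s : seq G := fset_set (L `&` gfiber u0).
have sP y : y \in s <-> L y /\ gsource y = u0.
  by rewrite in_fset_set // inE.
have us : uniq s by exact: fset_uniq.
have [V [Vnbhs Vdisj]] := separate_points s hausG.
have [_ _ _ hs] := hG.
apply/cvg_rnorm => eps eps0; pose e := eps / (size s).+1%:R.
have e0 : 0 < e by rewrite divr_gt0.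
(* Local section through [y]: [AB.2] is a neighbourhood of [y] on which the source map is injective,
   and it meets the fibre of every [x] in the neighbourhood [AB.1] of [x0]. *)
have chart y : exists AB : set G * set G, gsource y = u0 -> [/\ nbhs x0 AB.1,
    nbhs y AB.2, AB.2 `<=` V y, {in AB.2 &, injective (@gsource G)} &
    (forall x, AB.1 x -> exists2 y', AB.2 y' & gsource y' = gsource x) /\
    (forall x y', AB.1 x -> AB.2 y' -> gsource x = gsource y' ->
       rnorm (f (gmul x (ginv y')) * g y' - f (gmul x0 (ginv y)) * g y) < e)].
  have [yu|yu] := pselect (gsource y = u0); last by exists (set0, set0).
  have [U [oU Uy Uinj _ Uopen]] := hs y.
  have [A [B [xA yB AB]]] := convolution_term_near cf cg (esym yu) e0.
  pose O := (U `&` V y `&` B)°.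
  have yO : nbhs y O.
    apply/nbhs_interior; do 2?apply: filterI => //; exact: open_nbhs_nbhs.
  have OU : O `<=` U by move=> z /interior_subset[[]].
  have [W oW OW] := Uopen O (open_interior _) OU.
  exists (A `&` (@gsource G @^-1` W), O) => _; split.
  - apply: filterI => //; apply: gsource_continuous; apply: open_nbhs_nbhs.
    split=> //; have : (@gsource G @` O) u0 by exists y => //; exact: nbhs_singleton.
    by rewrite OW => -[].
  - exact: yO.
  - by move=> z /interior_subset[[]].
  - by move=> z w; rewrite !inE => Oz Ow; apply: Uinj; rewrite inE; exact: OU.
  split=> [x [_ Wx]|x y' [Ax _] /interior_subset[_ By'] xy']; last exact: AB.
  have : (W `&` @gunits G) (gsource x) by split=> //; exact: gunits_gsource.
  by rewrite -OW => -[y' Oy' y'x]; exists y'.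
pose AB y := sval (cid (chart y)); have ABP y := svalP (cid (chart y)).
rewrite -/(AB _) in ABP.
have nearA : nbhs x0 [set x | forall y, y \in s -> (AB y).1 x].
  by apply: filter_seq => y /sP[_ /ABP[]].
(* By compactness of [L], for [x] near [x0] no point of the support of [g] in the fibre of [x]
   escapes the charts around [s]. *)
have nearL : \forall x \near x0, L `<=`
    [set z | gsource z = gsource x -> exists2 y, y \in s & (AB y).2 z].
  move/compact_near_coveringP : cL; apply => z Lz.
  have [zu|zu] := pselect (gsource z = u0).
    have zs : z \in s by apply/sP.
    have [_ zB _ _ _] := ABP z zu.
    exists ((AB z).2, setT); first by split=> //; exact: filterT.
    by move=> [z' x] /= [Bz' _] _; exists z.
  have [A [B [zA xB ABd]]] := hausdorff_neq_near hausG zu.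
  exists (@gsource G @^-1` A, @gsource G @^-1` B).
    by split; exact: gsource_continuous.
  by move=> [z' x] /= [Az' Bx] zx; exfalso; exact: ABd Az' Bx zx.
apply: filterS2 nearA nearL => x xA xL.
have lift y : exists y', y \in s -> (AB y).2 y' /\ gsource y' = gsource x.
  have [ys|_] := boolP (y \in s); last by exists x.
  have [_ yu] := (sP y).1 ys; have [_ _ _ _ [sec _]] := ABP y yu.
  by have [y' By' y'x] := sec x (xA y ys); exists y'.
pose h y := sval (cid (lift y)).
have hP y : y \in s -> (AB y).2 (h y) /\ gsource (h y) = gsource x.
  exact: (svalP (cid (lift y))).
(* The charts lie in the disjoint sets [V y], so distinct points of [s] have distinct lifts. *)
have hinj : {in s &, injective h}.
  move=> y z ys zs yz; have [_ yu] := (sP y).1 ys; have [_ zu] := (sP z).1 zs.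
  have [_ _ yV _ _] := ABP y yu; have [_ _ zV _ _] := ABP z zu.
  have [/yV hy _] := hP y ys; have [/zV hz _] := hP z zs.
  by apply: Vdisj hy _ => //; rewrite yz.
have sum_x : convolution f g x = \sum_(y <- s) f (gmul x (ginv (h y))) * g (h y).
  rewrite -(big_map h xpredT (fun y => f (gmul x (ginv y)) * g y)) fsbig_seq; last first.
    by rewrite map_inj_in_uniq.
  apply/esym/fsbig_widen => [_ /mapP[y /hP[_ ? ->]] //|z [/= zx zN]].
  have [->|gz] := eqVneq (g z) 0; first by rewrite mulr0.
  have Lz : L z by exact: subset_closure.
  have [y ys By] := xL z Lz zx; exfalso; apply: zN; apply/mapP; exists y => //.
  have [_ yu] := (sP y).1 ys; have [_ _ _ inj _] := ABP y yu.
  have [hB hx] := hP y ys; apply: inj; rewrite ?inE //.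
  by rewrite hx.
have sum_x0 : convolution f g x0 = \sum_(y <- s) f (gmul x0 (ginv y)) * g y.
  rewrite fsbig_seq //; apply/esym/fsbig_widen => [y /= /sP[] //|z [/= zu zN]].
  have [->|gz] := eqVneq (g z) 0; first by rewrite mulr0.
  by exfalso; apply: zN; apply/sP; split=> //; exact: subset_closure.
rewrite sum_x sum_x0 -sumrB.
apply: (@le_lt_trans _ _ ((size s)%:R * e)).
  apply: rnorm_sum => [|y ys]; first exact: ltW.
  have [_ yu] := (sP y).1 ys; have [_ _ _ _ [_ close]] := ABP y yu.
  by have [hB hx] := hP y ys; apply/ltW/close => //; exact: xA.
rewrite /e mulrCA -ltr_pdivlMl // mulVf ?gt_eqF // ltr_pdivrMr // mul1r.
by rewrite ltr_nat.
Qed.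

Lemma Cc_convolution f g : Cc f -> Cc g -> Cc (convolution f g).
Proof.
move=> fC gC; split; last exact: Cc_convolution_compact.
by apply: convolution_continuous => //; case: fC.
Qed.

Lemma Cc0 : Cc (fun _ : G => 0 : R[i]).
Proof.
split; first by move=> x; exact: cvg_cst.
have -> : [set x : G | (0 : R[i]) != 0] = set0.
  by apply/seteqP; split=> x //=; rewrite eqxx.
by rewrite closure0; exact: compact0.
Qed.

Lemma CcD f g : Cc f -> Cc g -> Cc (fun x => f x + g x).
Proof.
move=> [cf sf] [cg sg]; split; first by move=> x; apply: cvgD; [exact: cf|exact: cg].
apply: (subclosed_compact _ (compactU sf sg)); first exact: closed_closure.
rewrite -closureU; apply: closureS => x /=.
have [->|fx _] := eqVneq (f x) 0; first by rewrite add0r; right.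
by left.
Qed.

Lemma CcZ (a : R[i]) f : Cc f -> Cc (fun x => a * f x).
Proof.
move=> [cf sf]; split; first by move=> x; apply: cvgM; [exact: cvg_cst|exact: cf].
apply: (subclosed_compact _ sf); first exact: closed_closure.
apply: closureS => x /=.
by have [->|//] := eqVneq (f x) 0; rewrite mulr0 eqxx.
Qed.

End Convolution.

(** * Subexponential growth *)

(** In logarithms, with [b = - ln q], the constant contributes [2 * ln (1 + C)] and the growth a
    multiple of the power of [m] with exponent [beta < 1]; for large [m] each is at most half of
    [b * m]. *)
Lemma subexponential_beats_geometric (R : realType) (alpha beta C T q : R) :
  0 < alpha -> 0 < beta < 1 -> 0 < C -> 0 <= T -> 0 < q < 1 ->
  exists m, (0 < m)%N /\
    ((1 + C) * expR (alpha * (m%:R * T) `^ beta)) ^+ 2 * q ^+ m <= 1.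
Proof.
move=> al0 /andP[be0 be1] C0 T0 /andP[q0 q1].
pose b := - ln q; have b0 : 0 < b by rewrite oppr_gt0 ln_lt0 // q0.
pose c := 2 * alpha * T `^ beta; have c0 : 0 <= c by rewrite !mulr_ge0 ?powR_ge0 // ltW.
pose K := 2 * ln (1 + C); have K0 : 0 <= K by rewrite mulr_ge0 // ln_ge0 // lerDl ltW.
have be1' : 0 < 1 - beta by rewrite subr_gt0.
pose d := 2 * c / b; have b0' := ltW b0.
have d0 : 0 <= d by exact: divr_ge0 (mulr_ge0 (ler0n _ 2) c0) b0'.
have Kb0 : 0 <= 2 * K / b by exact: divr_ge0 (mulr_ge0 (ler0n _ 2) K0) b0'.
(* One threshold for each half: beyond the first summand the growth term is absorbed, beyond the
   second the constant. *)
pose X := d `^ (1 - beta)^-1 + 2 * K / b.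
have X0 : 0 <= X by rewrite addr_ge0 ?powR_ge0.
pose m := Num.bound X; have Xm : X < m%:R by exact: archi_boundP.
have m0 : 0 < m%:R :> R by exact: le_lt_trans Xm.
exists m; split; first by rewrite -(ltr_nat R).
have dm : d `^ (1 - beta)^-1 <= m%:R.
  by rewrite (le_trans _ (ltW Xm)) // lerDl.
have Km : 2 * K / b <= m%:R by rewrite (le_trans _ (ltW Xm)) // lerDr powR_ge0.
have {}Km : 2 * K <= b * m%:R by rewrite [leRHS]mulrC -ler_pdivrMr.
have {}dm : d <= m%:R `^ (1 - beta).
  have -> : d = (d `^ (1 - beta)^-1) `^ (1 - beta).
    by rewrite -powRrM mulVf ?gt_eqF // powRr1.
  by apply: ge0_ler_powR; [exact: ltW|rewrite nnegrE powR_ge0|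
    rewrite nnegrE ltW|exact: dm].
have cm : 2 * (c * m%:R `^ beta) <= b * m%:R.
  have mE : m%:R = m%:R `^ (1 - beta) * m%:R `^ beta :> R.
    by rewrite -powRD ?subrK ?powRr1 ?ltW // gt_eqF // implybT.
  rewrite [X in _ <= b * X]mE !mulrA ler_wpM2r ?powR_ge0 //.
  move: dm; rewrite /d ler_pdivrMr //.
  by rewrite /c [b * _]mulrC !mulrA.
have qE : q ^+ m = expR (- (b * m%:R)).
  by rewrite /b mulNr opprK mulrC -powR_mulrn ?ltW // /powR gt_eqF.
have CE : 1 + C = expR (ln (1 + C)) by rewrite lnK // posrE ltr_wpDl // ltW.
rewrite qE {1}CE -expRD expr2 -!expRD -[leRHS]expR0 ler_expR.
rewrite powRM //.
have {}cm : 4 * (alpha * (m%:R `^ beta * T `^ beta)) <= b * m%:R.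
  by apply: le_trans cm; rewrite /c le_eqVlt; apply/orP; left; apply/eqP; ring.
have {}Km : 4 * ln (1 + C) <= b * m%:R.
  by apply: le_trans Km; rewrite /K mulrA -natrM.
move: cm Km; move: (b * _) (alpha * _) (ln (1 + C)) => w z L; clear; lra.
Qed.

(** * Two completions of C_c(G) as a spectral pair *)

Section ReducedLpPair.
Variables (R : realType) (G : topGroupoid) (l : G -> R) (p p' : R).
Hypotheses (hG : etale G) (hl : length_function l) (hlb : locally_bounded l).
Hypothesis hgrowth : strong_subexponential_growth l.
Hypotheses (hp : 1 <= p) (hp' : 1 <= p').
Variables (F : reducedLp G p) (F' : reducedLp G p').
Implicit Types f g : G -> R[i].

Local Notation S := (unitization F).
Local Notation S' := (unitization F').

Definition length_le T f : Prop := forall x, f x != 0 -> l x <= T.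

(** The identity of C_c(G), seen as a relation between its two completions. *)
Definition Cc_pair (x : F) (x' : F') : Prop :=
  exists f, [/\ Cc f, x = Flp_in F f & x' = Flp_in F' f].

Definition Cc_pair_le T (x : F) (x' : F') : Prop :=
  exists f, [/\ Cc f, length_le T f, x = Flp_in F f & x' = Flp_in F' f].

Lemma Cc_length_le f : Cc f -> exists T, 0 <= T /\ length_le T f.
Proof.
move=> [_ /hlb[M MP]]; exists (Num.max 0 M); rewrite le_max lexx; split=> // x fx.
by rewrite le_max MP ?orbT //; exact: subset_closure.
Qed.

Lemma length_le_convolution T T' f g : length_le T f -> length_le T' g ->
  length_le (T + T') (convolution f g).
Proof.
move=> fT gT x /convolution_support[y [yx /fT fy /gT gy]].
have [c <-] := gdivK (esym yx).
by apply: (le_trans (length_mul hl c)); rewrite lerD.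
Qed.

Lemma Flp_in0 (q : R) (E : reducedLp G q) : Flp_in E (fun _ => 0) = 0.
Proof.
have := Flp_inZ E 0 (@Cc0 R G); rewrite scale0r.
by under eq_fun do rewrite mul0r.
Qed.

Lemma Cc_pair_subalgebra : subalgebra_pair Cc_pair.
Proof.
split.
- by exists (fun _ => 0); rewrite !Flp_in0; split=> //; exact: Cc0.
- move=> _ _ _ _ [f [fC -> ->]] [g [gC -> ->]].
  exists (fun x => f x + g x); rewrite !Flp_inD //; split=> //; exact: CcD.
- move=> a _ _ [f [fC -> ->]].
  exists (fun x => a * f x); rewrite !Flp_inZ //; split=> //; exact: CcZ.
- move=> _ _ _ _ [f [fC -> ->]] [g [gC -> ->]].
  exists (convolution f g); rewrite !Flp_inM //; split=> //; exact: Cc_convolution.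
Qed.

Lemma upair_le_add T (x y : S) (x' y' : S') : upair (Cc_pair_le T) x x' ->
  upair (Cc_pair_le T) y y' -> upair (Cc_pair_le T) (x + y) (x' + y').
Proof.
move=> [[f [fC fT xf xf']] sx] [[g [gC gT yg yg']] sy].
split; last by rewrite /= sx sy.
exists (fun z => f z + g z); rewrite !Flp_inD //; split=> //.
- exact: CcD.
- move=> z; have [->|/fT //] := eqVneq (f z) 0; rewrite add0r; exact: gT.
- by rewrite /= xf yg.
- by rewrite /= xf' yg'.
Qed.

Lemma upair_le0 T : upair (Cc_pair_le T) 0 0.
Proof.
split=> //; exists (fun _ => 0); rewrite !Flp_in0; split=> //; first exact: Cc0.
by move=> x; rewrite eqxx.
Qed.

Lemma Cc_pair_leW T T' x x' : T <= T' -> Cc_pair_le T x x' -> Cc_pair_le T' x x'.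
Proof.
move=> TT' [f [fC fT xf xf']]; exists f; split=> // z /fT zT; exact: le_trans TT'.
Qed.

Lemma upair_le_mul T T' (x y : S) (x' y' : S') : 0 <= T -> 0 <= T' ->
  upair (Cc_pair_le T) x x' -> upair (Cc_pair_le T') y y' ->
  upair (Cc_pair_le (T + T')) (x * y) (x' * y').
Proof.
move=> T0 T'0 [[f [fC fT xf xf']] sx] [[g [gC gT yg yg']] sy].
have fTT : length_le (T + T') f by move=> z /fT /le_trans; apply; rewrite lerDl.
have gTT : length_le (T + T') g by move=> z /gT /le_trans; apply; rewrite lerDr.
split; last by rewrite /= sx sy.
exists (fun z => (convolution f g z + x.2 * g z) + y.2 * f z).
have cC := Cc_convolution hG fC gC; have sg := CcZ x.2 gC; have sf := CcZ y.2 fC.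
have csg := CcD cC sg; split.
- exact: CcD.
- move=> z; have [->|/fTT //] := eqVneq (f z) 0.
  have [->|/gTT //] := eqVneq (g z) 0; rewrite !mulr0 !addr0.
  exact: length_le_convolution.
- by rewrite !Flp_inD // !Flp_inZ // Flp_inM //= xf yg.
- by rewrite !Flp_inD // !Flp_inZ // Flp_inM //= xf' yg' -sx -sy.
Qed.

Lemma mpair_le_exp T n (U : 'M[S]_n) (U' : 'M[S']_n) m : 0 <= T ->
  mpair (Cc_pair_le T) U U' ->
  mpair (Cc_pair_le (m.+1%:R * T)) (U ^+ m.+1) (U' ^+ m.+1).
Proof.
move=> T0 UU'; elim: m => [|m IHm]; first by rewrite !expr1 mul1r.
have -> : U ^+ m.+2 = U *m U ^+ m.+1 by rewrite exprS.
have -> : U' ^+ m.+2 = U' *m U' ^+ m.+1 by rewrite exprS.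
rewrite -natr1 mulrDl mul1r addrC => i j; rewrite [(U *m _) i j]mxE [(U' *m _) i j]mxE.
elim/big_rec2: _ => [|k x x' _ xx']; first exact: upair_le0.
apply: upair_le_add => //; apply: upair_le_mul => //; exact: mulr_ge0.
Qed.

Lemma mpair_length n (U : 'M[S]_n) (U' : 'M[S']_n) : mpair Cc_pair U U' ->
  exists T, 0 <= T /\ mpair (Cc_pair_le T) U U'.
Proof.
move=> UU'.
have ex (ij : 'I_n * 'I_n) : exists T, 0 <= T /\
    Cc_pair_le T (U ij.1 ij.2).1 (U' ij.1 ij.2).1.
  have [[f [fC Uf Uf']] _] := UU' ij.1 ij.2; have [T [T0 fT]] := Cc_length_le fC.
  by exists T; split=> //; exists f.
pose T ij := sval (cid (ex ij)); have TP ij := svalP (cid (ex ij)).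
have T0 ij : 0 <= T ij by have [] := TP ij.
exists (\sum_ij T ij); split; first by apply: sumr_ge0.
move=> i j; split; last by have [] := UU' i j.
have [_] := TP (i, j); apply: Cc_pair_leW.
by rewrite (bigD1 (i, j)) //= lerDl sumr_ge0.
Qed.

(** The algebra parts compare through the supremum norm; for the common scalar part [1 <= b ^+ 2]
    suffices. *)
Lemma unorm_pair_le T b (x : S) (x' : S') : ball_bound l T b -> 1 <= b ->
  upair (Cc_pair_le T) x x' -> unorm x' <= b ^+ 2 * unorm x.
Proof.
move=> Tb b1 [[f [fC fT xf xf']] sx].
have p0 : 0 < p by exact: lt_le_trans hp.
have fM z : rnorm (f z) <= rnorm (Flp_in F f).
  by rewrite -lee_fin (Flp_in_norm F fC); exact: reduced_norm_ge.
have b21 : 1 <= b ^+ 2 by rewrite exprn_ege1.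
rewrite /unorm mulrDr -sx lerD //; last by rewrite ler_peMl ?rnorm_ge0.
rewrite xf xf' -lee_fin (Flp_in_norm F' fC).
exact: (reduced_norm_le hl Tb (rnorm_ge0 _) b1 hp' fT fM).
Qed.

Lemma growth_ball_bound : exists alpha beta C, [/\ 0 < alpha, 0 < beta < 1, 0 < C &
  forall t, 0 <= t -> ball_bound l t (C * expR (alpha * t `^ beta))].
Proof.
have [alpha [beta [C [a0 be C0 growth]]]] := hgrowth.
exists alpha, beta, C; split=> // t /growth tC u uu.
have : (counting (fiber_ball l u t) <= (C * expR (alpha * t `^ beta))%:E)%E.
  by apply: le_trans tC; apply: ereal_sup_ubound; exists u.
by rewrite /counting; case: asboolP => // fin; rewrite lee_fin.
Qed.

(** For the spectral part, [mnorm (U' ^+ m) <= b ^+ 2 * mnorm U ^+ m] and [mnorm U <= q * rho] with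
    [q < 1]; the exponent is chosen so that [b ^+ 2 * q ^+ m <= 1]. *)
Lemma Cc_pair_spectral : spectral_pair Cc_pair.
Proof.
split.
  move=> a eps eps0; have : closure (Flp_in F @` @Cc R G) a by rewrite Flp_in_dense.
  have an : nbhs a [set b | rnorm (b - a) < eps].
    by have /cvg_rnorm/(_ _ eps0) : id @ a --> a by exact: cvg_id.
  move=> /(_ _ an)[_ [[f fC <-] fa]].
  by exists (Flp_in F f), (Flp_in F' f); split=> //; exists f.
move=> n U U' /mpair_length[T [T0 UU']] rho rho0 Urho.
have [alpha [beta [C [a0 be C0 growth]]]] := growth_ball_bound.
(* The maximum with 1/2 keeps [q] positive when [U = 0]. *)
pose q := Num.max (mnorm U / rho) 2^-1.
have q01 : 0 < q < 1.
  rewrite lt_max invr_gt0 ltr0n orbT gt_max ltr_pdivrMr // mul1r Urho.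
  by rewrite invf_lt1 // ltr1n.
have [m [m0 mP]] := subexponential_beats_geometric a0 be C0 T0 q01.
exists m; split=> //; case: m m0 mP => // m _.
(* Replacing [C] by [1 + C] ensures [1 <= b]. *)
set b := (1 + C) * _ => mP.
have mT0 : 0 <= m.+1%:R * T by rewrite mulr_ge0.
have bb : ball_bound l (m.+1%:R * T) b.
  move=> u /(growth _ mT0)[fin szC]; split=> //; apply: (le_trans szC).
  by rewrite ler_wpM2r ?expR_ge0 // lerDr.
have b1 : 1 <= b.
  rewrite /b -[leLHS]mulr1 ler_pM // ?lerDl ?(ltW C0) //.
  rewrite -expR0 ler_expR mulr_ge0 ?powR_ge0 ?ltW //.
have UU'm := mpair_le_exp m T0 UU'.
apply: (@le_trans _ _ (b ^+ 2 * mnorm (U ^+ m.+1))).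
  rewrite /mnorm mulr_sumr; apply: ler_sum => i _; rewrite mulr_sumr.
  by apply: ler_sum => j _; exact: (unorm_pair_le bb b1 (UU'm i j)).
have Uq : mnorm U <= q * rho by rewrite -ler_pdivrMr // le_max lexx.
have b20 : 0 <= b ^+ 2 by rewrite sqr_ge0.
apply: (@le_trans _ _ (b ^+ 2 * (q * rho) ^+ m.+1)).
  rewrite ler_wpM2l // (le_trans (cnormX (mnorm_complete_norm F n) _ (ltn0Sn m))) //.
  by rewrite lerXn2r // nnegrE ?mnorm_ge0 // (le_trans (mnorm_ge0 U)).
by rewrite (exprMn m.+1) [leLHS]mulrA ler_piMl // exprn_ge0 // ltW.
Qed.

End ReducedLpPair.

Theorem theorem1 (R : realType) (G : topGroupoid) (hG : etale G)
    (l : G -> R) (hl : length_function l) (hlb : locally_bounded l)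
    (hgrowth : strong_subexponential_growth l)
    (p p' : R) (hp : 1 <= p) (hp' : 1 <= p')
    (F : reducedLp G p) (F' : reducedLp G p') :
  (exists phi : {additive K0 F -> K0 F'}, bijective phi) /\
  (exists phi : {multiplicative K1 F -> K1 F'}, bijective phi).
Proof.
have sQ := Cc_pair_subalgebra hG F F'.
have spQ := Cc_pair_spectral hG hl hlb hgrowth hp hp' F F'.
have spQ' : spectral_pair (fun (x' : F') (x : F) => Cc_pair x x').
  have -> : (fun (x' : F') (x : F) => Cc_pair x x') = @Cc_pair _ _ _ _ F' F.
    apply/funext => x'; apply/funext => x; apply/propext.
    by split=> -[f [fC xf xf']]; exists f.
  exact: (Cc_pair_spectral hG hl hlb hgrowth hp' hp F' F).
by split; [exact: spectral_pair_K0 sQ spQ spQ'|exact: spectral_pair_K1 sQ spQ spQ'].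
Qed.
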